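(* Let $q\in[-1,1]$ and let $\varrho(N)$, $N\in\mathbb{N}$, be probability measures on $\hat U(N)$. Assume there are functions $\Psi,\Phi$ analytic in a neighborhood of $1$ such that for every fixed $k\in\mathbb{N}$ \[ \lim_{N\to\infty}N\Big(\frac1N\log S_{\varrho(N)}(u_1,\dots,u_k,1^{N-k})-\sum_{i=1}^k\Psi(u_i)\Big)=\sum_{i=1}^k\Phi(u_i) \] uniformly in a neighborhood of $1^k$. Then for every $k\in\mathbb{N}$ \[ \lim_{N\to\infty}N\Big(\mathbb{E}_{\lambda\sim\varrho(N)}\Big[\int_{\mathbb{R}}t^k\,m_{N,PP(q)}[\lambda](dt)\Big]-\sum_{m=0}^k\binom km\frac1{(m+1)!}\frac{d^m}{du^m}\big(u^{k-q}(\Psi'(u))^{k-m}\big)\Big|_{u=1}\Big) \] \[ =\sum_{m=0}^{k-1}\binom k{m+1}\frac1{m!}\frac{d^m}{du^m}\Big(u^{k-q}\Big(\Phi'(u)-\frac{1-q}{2u}\Big)(\Psi'(u))^{k-m-1}\Big)\Big|_{u=1}. \]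
   Context: A signature of length $N$ is a tuple $\lambda=(\lambda_1\ge\dots\ge\lambda_N)\in\mathbb{Z}^N$; $\hat U(N)$ denotes the set of signatures of length $N$. For $\lambda\in\hat U(N)$, $\chi^{\lambda}(u_1,\dots,u_N)=\det(u_i^{\lambda_j+N-j})_{i,j}/\prod_{i<j}(u_i-u_j)$ is the rational Schur function. For a probability measure $\varrho(N)$ on $\hat U(N)$, the Schur generating function is $S_{\varrho(N)}(u_1,\dots,u_N)=\sum_{\lambda\in\hat U(N)}\varrho(N)[\lambda]\,\chi^\lambda(u_1,\dots,u_N)/\chi^\lambda(1^N)$, where $1^N=(1,\dots,1)$; it is assumed that this series converges uniformly in a neighborhood of $1^N$. For $q\in[-1,1]$ and $\lambda\in\hat U(N)$ the $q$-deformed Perelomov–Popov measure is \[ m_{N,PP(q)}[\lambda]=\frac1N\sum_{i=1}^N\Big(\prod_{j\ne i}\frac{(\lambda_i-i)-(\lambda_j-j)-q}{(\lambda_i-i)-(\lambda_j-j)}\Big)\delta\Big(\frac{\lambda_i+N-i}{N}\Big). \] *)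

(* Defs.v *)
From HB Require Import structures.
From mathcomp Require Import all_boot all_order all_algebra.
From mathcomp Require Import all_classical all_reals all_analysis.
From mathcomp Require Import finmap complex.
From Stdlib Require Import ClassicalEpsilon.

Set Implicit Arguments.
Unset Strict Implicit.
Unset Printing Implicit Defensive.

Import Order.TTheory GRing.Theory Num.Theory.
Import numFieldNormedType.Exports.
Local Open Scope ring_scope.
Local Open Scope classical_set_scope.

(* The complex numbers over the reals R, seen as a numClosedFieldType
   (so that MathComp-Analysis's topology/derivatives apply to C -> C). *)
Definition Cx (R : realType) : numClosedFieldType := R[i].

Definition nonincr (N : nat) (f : {ffun 'I_N -> int}) : bool :=
  [forall i : 'I_N, forall j : 'I_N, (i <= j)%N ==> (f j <= f i)].

Definition signature (N : nat) := {f : {ffun 'I_N -> int} | nonincr f}.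

Definition sgn_at (N : nat) (l : signature N) (i : 'I_N) : int := (val l) i.

(* Unconditional sums over a (countable) choiceType: limit of the net of
   finite partial sums, directed by inclusion of finite sets.          *)
Definition totally {I : choiceType} : set_system {fset I} :=
  filter_from setT (fun A => [set B | (A `<=` B)%fset]).

Instance totally_filter {I : choiceType} : ProperFilter (@totally I).
Proof.
eapply filter_from_proper; last by move=> A _; exists A; rewrite /= fsubset_refl.
apply: filter_fromT_filter; first by exists fset0.
by move=> A B /=; exists (A `|` B)%fset => P /=; rewrite fsubUset => /andP[].
Qed.

Definition partial_sum {I : choiceType} {V : zmodType} (x : I -> V)
  (A : {fset I}) : V := \sum_(i <- A) x i.

Definition usum {I : choiceType} {K : numFieldType} {V : normedModType K}
  (x : I -> V) : V := lim (partial_sum x @ totally).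

Definition is_prob (R : realType) (N : nat) (rho : signature N -> R) : Prop :=
  (forall l, 0 <= rho l) /\ (partial_sum rho @ totally --> (1 : R)).

Definition expect (R : realType) (N : nat) (rho : signature N -> R)
  (F : signature N -> R) : R := usum (fun l => rho l * F l).

Section Schur.
Variable R : realType.
Local Notation C := (Cx R).

(* det( u_i ^ (lambda_j + N - j) ) with 1-based j, i.e. exponent
   lambda_j + N - 1 - j for 0-based j. *)
Definition alternant (N : nat) (l : signature N) (u : 'rV[C]_N) : C :=
  \det (\matrix_(i < N, j < N) (u 0 i) ^ (sgn_at l j + (N - j.+1)%:Z)).

Definition vandermonde (N : nat) (u : 'rV[C]_N) : C :=
  \prod_(i < N) \prod_(j < N | (i < j)%N) (u 0 i - u 0 j).

Definition torus (N : nat) : set 'rV[C]_N := [set u | forall i, u 0 i != 0].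

Definition distinct_coords (N : nat) : set 'rV[C]_N :=
  [set u | forall i j, i != j -> u 0 i != u 0 j].

(* chi^lambda is the rational function alternant / vandermonde, i.e. the
   (unique) continuous function on (C^* )^N which coincides with this ratio
   wherever the denominator does not vanish. *)
Definition is_schur (N : nat) (l : signature N) (f : 'rV[C]_N -> C) : Prop :=
  (forall u, torus u -> {for u, continuous f}) /\
  (forall u, torus u -> distinct_coords u ->
     f u * vandermonde u = alternant l u).

Definition schur (N : nat) (l : signature N) : 'rV[C]_N -> C :=
  epsilon (inhabits (fun _ => 0)) (is_schur l).

Definition ones (N : nat) : 'rV[C]_N := const_mx 1.

Definition sgf_term (N : nat) (rho : signature N -> R) (u : 'rV[C]_N)
  (l : signature N) : C := (rho l)%:C%C * (schur l u / schur l (ones N)).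

Definition sgf (N : nat) (rho : signature N -> R) (u : 'rV[C]_N) : C :=
  usum (sgf_term rho u).

Definition polydisc (N : nat) (r : R) : set 'rV[C]_N :=
  [set u | forall i, `|u 0 i - 1| < r%:C%C].

(* Standing assumption: the series defining S_rho converges uniformly in a
   neighborhood of 1^N. *)
Definition sgf_unif_conv (N : nat) (rho : signature N -> R) : Prop :=
  exists2 r : R, 0 < r & forall e : R, 0 < e ->
    \forall J \near totally, forall u, polydisc r u ->
      `|sgf rho u - partial_sum (sgf_term rho u) J| < e%:C%C.

Definition ext_ones (k N : nat) (v : 'rV[C]_k) : 'rV[C]_N :=
  \row_(i < N) oapp (v 0) 1 (insub (nat_of_ord i) : option 'I_k).

Definition Cexp (z : C) : C :=
  ((expR (complex.Re z) * cos (complex.Im z)) +i*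
   (expR (complex.Re z) * sin (complex.Im z)))%C.

(* principal argument in (-pi, pi] (the usual atan2) *)
Definition Carg (z : C) : R :=
  let a := complex.Re z in let b := complex.Im z in
  if 0 < a then atan (b / a)
  else if a < 0 then (if 0 <= b then atan (b / a) + pi else atan (b / a) - pi)
  else if 0 < b then pi / 2 else if b < 0 then - (pi / 2) else 0.

Definition Clog (z : C) : C :=
  (ln (Num.sqrt (complex.Re z ^+ 2 + complex.Im z ^+ 2)) +i* Carg z)%C.

Definition Cpow (z w : C) : C := if z == 0 then 0 else Cexp (w * Clog z).

Definition analytic_near (f : C -> C) (z0 : C) : Prop :=
  exists2 r : R, 0 < r & exists a : nat -> C,
    forall z, `|z - z0| < r%:C%C ->
      series (fun n => a n * (z - z0) ^+ n) @ \oo --> f z.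

End Schur.

(* The q-deformed Perelomov--Popov measure m_{N,PP(q)}[lambda], a finite
   combination of Dirac masses, represented as a list of
   (weight, atom) pairs; its integral against f is sum weight * f(atom). *)
Section PP.
Variable R : realType.

(* lambda_i - i (a common shift of all indices does not matter) *)
Definition shifted (N : nat) (l : signature N) (i : 'I_N) : int :=
  sgn_at l i - (nat_of_ord i)%:Z.

Definition pp_weight (N : nat) (q : R) (l : signature N) (i : 'I_N) : R :=
  \prod_(j < N | j != i)
     (((shifted l i - shifted l j)%:~R - q) / (shifted l i - shifted l j)%:~R).

(* (lambda_i + N - i) / N with 1-based i *)
Definition pp_atom (N : nat) (l : signature N) (i : 'I_N) : R :=
  (sgn_at l i + (N - i.+1)%:Z)%:~R / N%:R.

Definition mPP (N : nat) (q : R) (l : signature N) : seq (R * R) :=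
  [seq (N%:R^-1 * pp_weight q l i, pp_atom l i) | i <- enum 'I_N].

Definition atomic_integral (mu : seq (R * R)) (f : R -> R) : R :=
  \sum_(p <- mu) p.1 * f p.2.

End PP.

(* Main.v *)
Require Import Defs.
From HB Require Import structures.
From mathcomp Require Import all_boot all_order all_algebra.
From mathcomp Require Import all_classical all_reals all_analysis.
From mathcomp Require Import finmap complex.
From Stdlib Require ClassicalEpsilon.
From mathcomp Require Import fingroup perm cyclic separable cyclotomic ring zify.
Import Order.TTheory GRing.Theory Num.Theory.
Import numFieldNormedType.Exports.
Local Open Scope ring_scope.
Local Open Scope classical_set_scope.

Set Implicit Arguments.
Unset Strict Implicit.
Unset Printing Implicit Defensive.

(* On the ray [u(t, s) = (1 + t + s, 1 + t w, ..., 1 + t w^(K-1), 1, ..., 1)], [w] a primitive K-th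
   root of unity, expanding the alternant along its first row and averaging over the cyclic symmetry
   expresses the falling factorial moments of the Perelomov-Popov measure of [l] exactly through the
   Taylor coefficients of [schur l (u(t, s))] at [t = s = 0] of degree less than [K]; for [K = N] this
   is a determinant computation, and modulo [t^K] a symmetric function does not distinguish the rays of
   [K] and of [N].  Schur functions have nonnegative coefficients, so the expectation commutes with
   these Taylor coefficients and the moments become coefficients of the Schur generating function [S].
   Write [S = E * Theta] with [E = exp (N (Psi(1+t+s) - Psi(1+t)) + Phi(1+t+s) - Phi(1+t))].  As
   [S(t, 0)] is invariant under [t -> w t], [Theta(t, 0) = 1 + O(t^K)], while the coefficients of
   [Theta] of positive degree in [s] tend to 0; hence only [E] contributes to order [1/N], and its
   coefficients are polynomials in [N] whose two leading terms give the two sums of the theorem. *)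

(** The hypothesis fixes [log S] only up to [o(1)], while the theorem needs the moments up to
    [o(1/N)]. An exact symmetry and a count of powers of [N] close the gap: the part of the error
    free of [s] drops out altogether, and each power of [s] taken from the error factor instead of
    from [E] costs a factor [N], because the M-th [s]-coefficient of [E] has size [N^M].

    Two demands compete for the number of moving coordinates. At [1^N] the alternant and the
    Vandermonde product both vanish; spreading the coordinates along N-th roots of unity separates
    them and makes the Vandermonde product explicit. The hypothesis, however, concerns a fixed
    number of variables. [K = k + 1] moving coordinates reconcile the two, as the k-th moment
    involves only degrees at most [k] in [t].

    The deformed weight arises because lowering a single exponent by [q] in a Vandermonde product
    multiplies it by exactly the weight of that index.

    All function theory is done with uniform limits of polynomials on discs, so that facts about
    Taylor coefficients are limits of identities between polynomial coefficients. *)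

Section RootsOfUnity.
Variable R : realType.
Local Notation C := (Cx R).

Lemma primitive_root_exists (n : nat) : (0 < n)%N -> exists z : C, n.-primitive_root z.
Proof.
move=> n0; have [s] := closed_field_poly_normal ('X^n - 1 : {poly C}).
rewrite (monicP (monicXnsubC 1 n0)) scale1r => sE.
have us : uniq s by rewrite -separable_prod_XsubC -sE separable_Xn_sub_1// pnatr_eq0 -lt0n.
have ss : (n <= size s)%N by rewrite -ltnS -(size_prod_XsubC s id) -sE size_XnsubC.
have rs : all n.-unity_root s by apply/allP => z zs; rewrite /root_of_unity sE root_prod_XsubC.
by have /hasP[z _ pz] := has_prim_root n0 rs us ss; exists z.
Qed.

Lemma norm_primitive_root (n : nat) (z : C) : n.-primitive_root z -> `|z| = 1.
Proof.
move=> pz; have n0 := prim_order_gt0 pz.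
by apply/eqP; rewrite -(pexpr_eq1 n0) ?normr_ge0// -normrX (prim_expr_order pz) normr1.
Qed.

Lemma sum_primitive_root (n : nat) (z : C) (m : nat) : n.-primitive_root z ->
  \sum_(i < n) z ^+ (i * m) = if (n %| m)%N then n%:R else 0.
Proof.
move=> pz; case: ifP => [/dvdnP[k ->]|ndv].
  rewrite (eq_bigr (fun=> 1)) ?sumr_const ?card_ord// => i _.
  by rewrite mulnA exprM -exprM mulnC exprM (prim_expr_order pz) expr1n.
have zm1 : z ^+ m != 1.
  by rewrite -(prim_order_dvd pz) ndv.
apply: (mulfI (x := z ^+ m - 1)); first by rewrite subr_eq0.
rewrite mulr0 (eq_bigr (fun i : 'I_n => (z ^+ m) ^+ i)); last first.
  by move=> i _; rewrite mulnC exprM.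
by rewrite -subrX1 -exprM mulnC exprM (prim_expr_order pz) expr1n subrr.
Qed.

(* Cauchy's estimate; the contour integral is an average over roots of unity. *)
Lemma coef_le_circle (p : {poly C}) (B rho : C) (n : nat) : 0 <= rho ->
  (forall z, `|z| = rho -> `|p.[z]| <= B) -> `|p`_n| * rho ^+ n <= B.
Proof.
move=> rho0 pB; pose M := maxn (size p) n.+1.
have M0 : (0 < M)%N by rewrite leq_max orbT.
have nM : (n < M)%N by rewrite leq_max leqnn orbT.
have [w pw] := primitive_root_exists M0.
have w1 := norm_primitive_root pw.
have MC0 : (M%:R : C) != 0 by rewrite pnatr_eq0 -lt0n.
have key : \sum_(i < M) p.[rho * w ^+ i] * w ^+ (i * (M - n)) = M%:R * (p`_n * rho ^+ n).
  transitivity (\sum_(i < M) \sum_(k < M) p`_k * rho ^+ k * w ^+ (i * (k + (M - n)))).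
    apply: eq_bigr => i _; rewrite (horner_coef_wide _ (leq_maxl (size p) n.+1)) mulr_suml.
    apply: eq_bigr => k _; rewrite exprMn -exprM mulnDr exprD; ring.
  rewrite exchange_big /= (bigD1 (Ordinal nM)) //= [X in _ + X]big1 ?addr0.
    rewrite -mulr_sumr (sum_primitive_root _ pw) subnKC ?(ltnW nM)// dvdnn; ring.
  move=> k kn; rewrite -mulr_sumr (sum_primitive_root _ pw).
  case: ifP => [dv|_]; last by rewrite mulr0.
  case/negP: kn; apply/eqP/val_inj => /=.
  have := ltn_ord k; case/dvdnP: dv => -[|[|c]] e kM; nia.
have -> : `|p`_n| * rho ^+ n = M%:R^-1 * `|\sum_(i < M) p.[rho * w ^+ i] * w ^+ (i * (M - n))|.
  rewrite key !normrM normr_nat normrX (ger0_norm rho0); field.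
  by rewrite pnatr_eq0 -lt0n.
rewrite -[leRHS](mulKf MC0) ler_pM2l ?invr_gt0 ?ltr0n//.
apply: le_trans (ler_norm_sum _ _ _) _.
rewrite [leRHS](_ : _ = \sum_(i < M) B); last by rewrite sumr_const card_ord mulr_natl.
apply: ler_sum => i _; rewrite normrM normrX w1 expr1n mulr1; apply: pB.
by rewrite normrM normrX w1 expr1n mulr1 ger0_norm.
Qed.

Lemma coef_le_disc (p : {poly C}) (B r : C) (n : nat) : 0 < r ->
  (forall z, `|z| < r -> `|p.[z]| <= B) -> `|p`_n| <= B * (2 / r) ^+ n.
Proof.
move=> r0 pB; have r2 : 0 < r / 2 by rewrite divr_gt0.
have := @coef_le_circle p B (r / 2) n (ltW r2).
rewrite -ler_pdivlMr ?exprn_gt0// -exprVn invf_div; apply=> z zr.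
by apply: pB; rewrite zr ltr_pdivrMr// mulr_natr mulr2n ltrDl.
Qed.

Lemma geom_le2 (x : C) (n : nat) : 0 <= x -> x <= 2^-1 -> \sum_(i < n) x ^+ i <= 2.
Proof.
move=> x0 x2.
have h : 0 < 1 - x.
  by rewrite subr_gt0 (le_lt_trans x2)// invf_lt1 ?ltr1n.
have : (1 - x) * \sum_(i < n) x ^+ i <= 1.
  by rewrite -(opprB x) mulNr -subrX1 opprB gerBl exprn_ge0.
rewrite -ler_pdivlMl// mulr1 => /le_trans; apply.
rewrite -[leRHS]invrK lef_pV2 ?posrE ?invr_gt0 ?ltr0n//.
by rewrite lerBrDr [leRHS](splitr 1) !div1r lerD2l.
Qed.

(** Cauchy's estimate dominates the tail by a geometric series, whose ratio is at most 1/2 on the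
    disc of radius [r / 4]; this gives the factor 2. *)
Lemma taylor_remainder (p : {poly C}) (B r s : C) (m : nat) : 0 < r ->
  (forall z, `|z| < r -> `|p.[z]| <= B) -> `|s| <= r / 4 ->
  `|p.[s] - \sum_(n < m) p`_n * s ^+ n| <= 2 * B * (2 * `|s| / r) ^+ m.
Proof.
move=> r0 pB sr; pose x := 2 * `|s| / r.
have B0 : 0 <= B by apply: le_trans (pB 0 _) => //; rewrite normr0.
have x0 : 0 <= x by rewrite divr_ge0 ?mulr_ge0// ltW.
have x2 : x <= 2^-1.
  rewrite /x ler_pdivrMr// -ler_pdivlMl ?ltr0n//; apply: le_trans sr _.
  by rewrite le_eqVlt; apply/orP; left; apply/eqP; field; rewrite ?pnatr_eq0.
have -> : p.[s] - \sum_(n < m) p`_n * s ^+ n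
   = \sum_(i < size p) p`_(m + i) * s ^+ (m + i).
  rewrite (horner_coef_wide _ (leq_addl m (size p))) big_split_ord /= addrAC subrr add0r.
  exact: eq_bigr.
apply: le_trans (ler_norm_sum _ _ _) _.
apply: (@le_trans _ _ (\sum_(i < size p) B * x ^+ m * x ^+ i)).
  apply: ler_sum => i _; rewrite normrM normrX -mulrA -exprD.
  apply: le_trans (ler_wpM2r _ (coef_le_disc _ r0 pB)) _; first exact: exprn_ge0.
  rewrite -mulrA -exprMn /x; rewrite le_eqVlt; apply/orP; left; apply/eqP.
  by congr (_ * _ ^+ _); field; rewrite gt_eqF.
rewrite -mulr_sumr mulrC -mulrA.
by apply: ler_wpM2r; rewrite ?mulr_ge0 ?exprn_ge0// geom_le2.
Qed.

(** * Completeness of the complex numbers *)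

Lemma normc_ge_Im (z : C) : (`|complex.Im z|)%:C%C <= `|z|.
Proof.
by case: z => a b; rewrite normc_def lecR -sqrtr_sqr ler_wsqrtr // lerDr sqr_ge0.
Qed.

Lemma norm_real_complex (x : R) : `|x%:C%C : C| = (`|x|)%:C%C.
Proof. by rewrite normc_def /= expr0n addr0 sqrtr_sqr. Qed.

Lemma complex_gt0P (e : C) : 0 < e -> exists2 eR : R, 0 < eR & e = eR%:C%C.
Proof.
move=> e0; have /complex_realP[eR eE] := gtr0_real e0.
by exists eR; move: e0; rewrite // eE ltcR.
Qed.

Lemma complex_complete (u : nat -> C) :
  (forall e : C, 0 < e -> exists N, forall m n, (N <= m)%N -> (N <= n)%N -> `|u m - u n| <= e) ->
  exists l : C, u @ \oo --> l.
Proof.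
move=> uC.
have part (f : C -> R) : (forall x y, f (x - y) = f x - f y) ->
    (forall z : C, (`|f z|)%:C%C <= `|z|) ->
    exists a : R, (f \o u) @ \oo --> a.
  move=> fB fle; apply/cvg_ex/cauchy_cvgP/cauchy_exP => e e0.
  have [|N uN] := uC (e / 2)%:C%C; first by rewrite ltcR divr_gt0.
  exists (f (u N)); exists N => // n /= Nn.
  rewrite /ball /= -fB.
  have := le_trans (fle _) (uN N n (leqnn _) Nn); rewrite lecR => /le_lt_trans; apply.
  by rewrite ltr_pdivrMr// mulr_natr mulr2n ltrDl.
have [a ua] : exists a : R, (fun n => complex.Re (u n)) @ \oo --> a.
  apply: (part (@complex.Re R)) => [[? ?] [? ?]//|z].
  exact: normc_ge_Re.
have [b ub] : exists b : R, (fun n => complex.Im (u n)) @ \oo --> b.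
  apply: (part (@complex.Im R)) => [[? ?] [? ?]//|z].
  exact: normc_ge_Im.
exists (a +i* b)%C; apply/cvgrPdist_le => e e0.
have [eR e0R ->] := complex_gt0P e0; move: e0R => {e e0} e0.
have e2 : 0 < eR / 2 by rewrite divr_gt0.
move/cvgrPdist_le/(_ _ e2): ua => ua; move/cvgrPdist_le/(_ _ e2): ub => ub.
near=> n.
have -> : (a +i* b)%C - u n = (a - complex.Re (u n))%:C%C + 'i%C * (b - complex.Im (u n))%:C%C.
  by case: (u n) => x y; apply/eqP; rewrite eq_complex /=; apply/andP; split; apply/eqP; rewrite /=; ring.
apply: le_trans (ler_normD _ _) _.
rewrite normrM.
have ->: `|('i%C : C)| = 1 by rewrite normc_def /= expr0n/= expr1n add0r sqrtr1.
rewrite mul1r !norm_real_complex -rmorphD lecR.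
rewrite [leRHS](splitr eR) lerD//.
  by near: n.
by near: n.
Unshelve. all: by end_near.
Qed.

End RootsOfUnity.

(** * Taylor coefficients of uniform limits of polynomials *)

Section TaylorCoefficients.
Variable R : realType.
Local Notation C := (Cx R).

Lemma eq_of_le_eps (K x y : C) : 0 <= K ->
  (forall e : C, 0 < e -> `|x - y| <= K * e) -> x = y.
Proof.
move=> K0 h; apply/eqP; rewrite -subr_eq0 -normr_eq0; apply/negPn/negP => d0.
have K1 : 0 < K + 1 by rewrite ltr_wpDl.
have d1 : 0 < `|x - y| by rewrite lt_def d0 normr_ge0.
have := h (`|x - y| / (K + 1)); rewrite divr_gt0// => /(_ isT).
rewrite mulrA ler_pdivlMr// mulrC ler_pM2r// gerDl.
by rewrite ler10.
Qed.

Lemma complex_cvg_unique (T : Type) (F : set_system T) {FF : ProperFilter F} (f : T -> C) (a b : C) :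
  f @ F --> a -> f @ F --> b -> a = b.
Proof. by move=> fa fb; apply: (cvg_unique (@norm_hausdorff _ _) fa fb). Qed.

Lemma complex_cvg_sum (T I : Type) (F : set_system T) {FF : Filter F} (s : seq I) (P : pred I)
  (f : I -> T -> C) (a : I -> C) : (forall i, P i -> f i @ F --> a i) ->
  (fun t => \sum_(i <- s | P i) f i t) @ F --> \sum_(i <- s | P i) a i.
Proof.
move=> fa; elim: s => [|i s IH].
  rewrite big_nil (_ : (fun t => _) = cst 0); first exact: cvg_cst.
  by apply/funext => t; rewrite big_nil.
rewrite big_cons; case Pi : (P i).
  rewrite (_ : (fun t => _) = (fun t => f i t + \sum_(j <- s | P j) f j t)).
    by apply: cvgD; [exact: fa Pi|exact: IH].
  by apply/funext => t; rewrite big_cons Pi.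
rewrite (_ : (fun t => _) = (fun t => \sum_(j <- s | P j) f j t))//.
by apply/funext => t; rewrite big_cons Pi.
Qed.

(* Uniform limits of polynomials on the open disc of radius [r]: an elementary substitute for
   holomorphic functions. *)
Definition hol (r : C) (f : C -> C) : Prop := forall e : C, 0 < e ->
  exists p : {poly C}, forall z, `|z| < r -> `|f z - p.[z]| <= e.

(** The radius is left open so that the coefficient depends only on the germ of [f] at 0; a single
    polynomial must approximate both the function and the coefficient. *)
Definition is_cf (f : C -> C) (n : nat) (c : C) : Prop := exists2 r : C, 0 < r &
  forall e : C, 0 < e -> exists2 p : {poly C},
    (forall z, `|z| < r -> `|f z - p.[z]| <= e) & `|c - p`_n| <= e.

(* The n-th Taylor coefficient at 0 (and 0 if [f] is not a local uniform limit of polynomials). *)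
Definition cf (f : C -> C) (n : nat) : C := xget 0 [set c | is_cf f n c].

Lemma poly_near_coef (f : C -> C) (p q : {poly C}) (r A B : C) (n : nat) : 0 < r ->
  (forall z, `|z| < r -> `|f z - p.[z]| <= A) ->
  (forall z, `|z| < r -> `|f z - q.[z]| <= B) -> `|p`_n - q`_n| <= (A + B) * (2 / r) ^+ n.
Proof.
move=> r0 fp fq; rewrite -coefB; apply: coef_le_disc => // z zr.
rewrite hornerD hornerN -[p.[z]](subrK (f z)) -addrA.
by apply: le_trans (ler_normD _ _) _; rewrite lerD ?fq// distrC fp.
Qed.

Lemma lt_minC (a b : C) : 0 < a -> 0 < b -> exists c : C, [/\ 0 < c, c <= a & c <= b].
Proof.
move=> /complex_gt0P[x x0 ->] /complex_gt0P[y y0 ->].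
exists (Num.min x y)%:C%C; split; rewrite ?ltcR ?lecR ?lt_min ?x0 ?y0//.
  by rewrite ge_min lexx.
by rewrite ge_min lexx orbT.
Qed.

Lemma is_cf_uniq (f : C -> C) (n : nat) (c d : C) : is_cf f n c -> is_cf f n d -> c = d.
Proof.
move=> [r1 r10 h1] [r2 r20 h2].
have [r [r0 rr1 rr2]] := lt_minC r10 r20.
apply: (@eq_of_le_eps (2 + 2 * (2 / r) ^+ n)).
  by rewrite addr_ge0 ?mulr_ge0 ?exprn_ge0 ?divr_ge0 ?ltW.
move=> e e0; have [p fp cp] := h1 _ e0; have [q fq dq] := h2 _ e0.
have := @poly_near_coef f p q r e e n r0 (fun z zr => fp z (lt_le_trans zr rr1))
  (fun z zr => fq z (lt_le_trans zr rr2)) => pq.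
have -> : c - d = (c - p`_n) + (p`_n - q`_n) + (q`_n - d) by ring.
apply: le_trans (ler_normD _ _) _; rewrite [X in _ + X]distrC.
apply: le_trans (lerD (ler_normD _ _) (lexx _)) _.
apply: le_trans (lerD (lerD cp pq) dq) _.
by rewrite le_eqVlt; apply/orP; left; apply/eqP; ring.
Qed.

Lemma natSV_gt0 k : 0 < (k.+1%:R^-1 : C).
Proof. by rewrite invr_gt0 ltr0n. Qed.

Lemma natSV_small (e : C) : 0 < e -> exists N, forall k, (N <= k)%N -> (k.+1%:R^-1 : C) <= e.
Proof.
move=> /complex_gt0P[x x0 ->].
have /cvgrPdist_le/(_ _ x0)[N _ hN] := @cvg_harmonic R.
exists N => k Nk; have := hN k Nk.
rewrite sub0r normrN /= ger0_norm ?invr_ge0//.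
by rewrite -(@lecR R) fmorphV rmorph_nat.
Qed.

(** By [poly_near_coef] the n-th coefficients of ever better approximants form a Cauchy sequence,
    and [c] is its limit. *)
Lemma hol_is_cf (r : C) (f : C -> C) (n : nat) : 0 < r -> hol r f -> exists c : C,
  forall e : C, 0 < e -> exists2 p : {poly C},
    (forall z, `|z| < r -> `|f z - p.[z]| <= e) & `|c - p`_n| <= e.
Proof.
move=> r0 fA.
have /choice[p fp] : forall k : nat, exists p : {poly C},
    forall z, `|z| < r -> `|f z - p.[z]| <= k.+1%:R^-1.
  by move=> k; apply: fA; exact: natSV_gt0.
have K0 : 0 < (2 / r) ^+ n by rewrite exprn_gt0 ?divr_gt0.
have [|l pl] := @complex_complete R (fun k => (p k)`_n).
  move=> e e0; have [|N hN] := @natSV_small (e / 2 / (2 / r) ^+ n).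
    by rewrite !divr_gt0.
  exists N => k m Nk Nm; apply: le_trans (poly_near_coef n r0 (fp k) (fp m)) _.
  rewrite -ler_pdivlMr//; apply: le_trans (lerD (hN _ Nk) (hN _ Nm)) _.
  by rewrite -mulrDl -splitr.
exists l => e e0; move/cvgrPdist_le/(_ _ e0): pl => [N1 _ h1].
have [N2 h2] := natSV_small e0.
exists (p (maxn N1 N2)) => [z zr|]; last by apply: (h1 _ (leq_maxl _ _)).
exact: le_trans (fp _ _ zr) (h2 _ (leq_maxr _ _)).
Qed.

Lemma cf_near (r : C) (f : C -> C) (p : {poly C}) (B : C) (n : nat) : 0 < r -> hol r f ->
  (forall z, `|z| < r -> `|f z - p.[z]| <= B) -> `|cf f n - p`_n| <= B * (2 / r) ^+ n.
Proof.
move=> r0 fA fp; have [c hc] := hol_is_cf n r0 fA.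
have -> : cf f n = c.
  have hc' : [set c | is_cf f n c] c by exists r.
  exact: is_cf_uniq (xgetI 0 hc') hc'.
apply/ler_addgt0Pl => e e0.
have K0 : 0 <= (2 / r) ^+ n by rewrite exprn_ge0 ?divr_ge0 ?ltW.
have K1 : 0 < 1 + (2 / r) ^+ n by rewrite ltr_wpDr.
have [|q fq cq] := hc (e / (1 + (2 / r) ^+ n)); first by rewrite divr_gt0.
rewrite -[c](subrK q`_n) -addrA; apply: le_trans (ler_normD _ _) _.
apply: le_trans (lerD cq (poly_near_coef n r0 fq fp)) _.
set K := (2 / r) ^+ n in K0 K1 *.
by rewrite [leLHS](_ : _ = e + B * K)//; field; rewrite gt_eqF.
Qed.

Lemma hol_sub (r r' : C) (f : C -> C) : r' <= r -> hol r f -> hol r' f.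
Proof.
move=> rr fA e e0; have [p fp] := fA e e0.
by exists p => z zr; apply: fp; apply: lt_le_trans rr.
Qed.

Lemma hol_ext (r : C) (f g : C -> C) : (forall z, `|z| < r -> f z = g z) -> hol r f -> hol r g.
Proof.
move=> fg fA e e0; have [p fp] := fA e e0.
by exists p => z zr; rewrite -fg// fp.
Qed.

Lemma cf_ext (r : C) (f g : C -> C) (n : nat) : 0 < r -> (forall z, `|z| < r -> f z = g z) ->
  cf f n = cf g n.
Proof.
move=> r0 fg.
have H (h k : C -> C) c : (forall z, `|z| < r -> h z = k z) -> is_cf h n c -> is_cf k n c.
  move=> hk [r1 r10 hc]; have [r2 [r20 rr2 rr1]] := lt_minC r0 r10.
  exists r2 => // e e0; have [p hp cp] := hc e e0; exists p => // z zr.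
  by rewrite -hk ?(lt_le_trans zr)// hp// (lt_le_trans zr).
congr (xget 0 _); apply/seteqP; split => c /=; apply: H => // z zr.
by rewrite fg.
Qed.

Lemma poly_bounded (p : {poly C}) (r : C) : 0 < r -> exists2 B : C, 0 < B &
  forall z, `|z| < r -> `|p.[z]| <= B.
Proof.
move=> r0; exists (1 + \sum_(i < size p) `|p`_i| * r ^+ i).
  rewrite ltr_wpDr// sumr_ge0// => i _; by rewrite mulr_ge0// exprn_ge0// ltW.
move=> z zr; rewrite horner_coef; apply: le_trans (ler_norm_sum _ _ _) _.
apply: le_trans (_ : \sum_(i < size p) `|p`_i| * r ^+ i <= _); last by rewrite lerDr.
apply: ler_sum => i _; rewrite normrM normrX ler_wpM2l// lerXn2r// ?nnegrE// ltW//.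
Qed.

Lemma hol_bounded (r : C) (f : C -> C) : 0 < r -> hol r f -> exists2 B : C, 0 < B &
  forall z, `|z| < r -> `|f z| <= B.
Proof.
move=> r0 /(_ 1 ltr01)[p fp]; have [B B0 pB] := poly_bounded p r0.
exists (1 + B); first by rewrite addr_gt0.
move=> z zr; rewrite -[f z](subrK p.[z]).
by apply: le_trans (ler_normD _ _) _; rewrite lerD ?fp ?pB.
Qed.

Lemma hol_poly (r : C) (p : {poly C}) : hol r (horner p).
Proof. by move=> e e0; exists p => z _; rewrite subrr normr0 ltW. Qed.

Lemma hol_cst (r c : C) : hol r (fun=> c).
Proof. by move=> e e0; exists c%:P => z _; rewrite hornerC subrr normr0 ltW. Qed.

Lemma hol_id (r : C) : hol r id.
Proof. by move=> e e0; exists 'X => z _; rewrite hornerX subrr normr0 ltW. Qed.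

Lemma holD (r : C) (f g : C -> C) : hol r f -> hol r g -> hol r (fun z => f z + g z).
Proof.
move=> fA gA e e0; have e2 : 0 < e / 2 by rewrite divr_gt0.
have [p fp] := fA _ e2; have [q gq] := gA _ e2; exists (p + q) => z zr.
rewrite hornerD opprD addrACA (splitr e); apply: le_trans (ler_normD _ _) _.
by rewrite lerD ?fp ?gq.
Qed.

Lemma holM (r : C) (f g : C -> C) : 0 < r -> hol r f -> hol r g -> hol r (fun z => f z * g z).
Proof.
move=> r0 fA gA e e0; have [B B0 fB] := hol_bounded r0 fA.
have e2 : 0 < e / 2 / B by rewrite !divr_gt0.
have [q gq] := gA _ e2; have [D D0 qD] := poly_bounded q r0.
have e3 : 0 < e / 2 / D by rewrite !divr_gt0.
have [p fp] := fA _ e3; exists (p * q) => z zr.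
have -> : f z * g z - (p * q).[z] = f z * (g z - q.[z]) + (f z - p.[z]) * q.[z].
  by rewrite hornerM; ring.
apply: le_trans (ler_normD _ _) _; rewrite (splitr e) lerD// normrM.
  apply: le_trans (ler_pM _ _ (fB _ zr) (gq _ zr)) _ => //.
  by rewrite mulrC divfK// gt_eqF.
apply: le_trans (ler_pM _ _ (fp _ zr) (qD _ zr)) _ => //.
by rewrite divfK// gt_eqF.
Qed.

Lemma holZ (r c : C) (f : C -> C) : 0 < r -> hol r f -> hol r (fun z => c * f z).
Proof. by move=> r0 fA; apply: holM => //; apply: hol_cst. Qed.

Lemma holN (r : C) (f : C -> C) : 0 < r -> hol r f -> hol r (fun z => - f z).
Proof. by move=> r0 fA; apply: hol_ext (holZ (-1) r0 fA) => z _; rewrite mulN1r. Qed.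

Lemma holB (r : C) (f g : C -> C) : 0 < r -> hol r f -> hol r g -> hol r (fun z => f z - g z).
Proof. by move=> r0 fA gA; apply: holD => //; apply: holN. Qed.

Lemma hol_sum (r : C) (I : Type) (s : seq I) (P : pred I) (F : I -> C -> C) :
  (forall i, P i -> hol r (F i)) -> hol r (fun z => \sum_(i <- s | P i) F i z).
Proof.
move=> FA; elim: s => [|i s IH].
  by apply: hol_ext (hol_cst r 0) => z _; rewrite big_nil.
case Pi : (P i); last by apply: hol_ext IH => z _; rewrite big_cons Pi.
by apply: hol_ext (holD (FA i Pi) IH) => z _; rewrite big_cons Pi.
Qed.

Lemma hol_prod (r : C) (I : Type) (s : seq I) (P : pred I) (F : I -> C -> C) : 0 < r ->
  (forall i, P i -> hol r (F i)) -> hol r (fun z => \prod_(i <- s | P i) F i z).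
Proof.
move=> r0 FA; elim: s => [|i s IH].
  by apply: hol_ext (hol_cst r 1) => z _; rewrite big_nil.
case Pi : (P i); last by apply: hol_ext IH => z _; rewrite big_cons Pi.
by apply: hol_ext (holM r0 (FA i Pi) IH) => z _; rewrite big_cons Pi.
Qed.

Lemma holX (r : C) (f : C -> C) (n : nat) : 0 < r -> hol r f -> hol r (fun z => f z ^+ n).
Proof.
move=> r0 fA; elim: n => [|n IH].
  by apply: hol_ext (hol_cst r 1) => z _; rewrite expr0.
by apply: hol_ext (holM r0 fA IH) => z _; rewrite exprS.
Qed.

Lemma cf_poly (p : {poly C}) (n : nat) : cf (horner p) n = p`_n.
Proof.
have := @cf_near 1 (horner p) p 0 n ltr01 (hol_poly 1 p).
rewrite mul0r => /(_ (fun z _ => _)) h; apply/eqP; rewrite -subr_eq0 -normr_le0.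
by apply: h => z; rewrite subrr normr0.
Qed.

Lemma cf_cst (c : C) (n : nat) : cf (fun=> c) n = if n == 0%N then c else 0.
Proof.
rewrite -coefC -cf_poly; apply: (@cf_ext 1) => // z _; by rewrite hornerC.
Qed.

(** The transfer principle: the rules for sums, products and rotations hold for polynomial
    coefficients and pass to the limit. *)
Lemma cf_poly_cvg (r : C) (f : C -> C) (p : nat -> {poly C}) (n : nat) : 0 < r ->
  (forall e : C, 0 < e -> exists N, forall k, (N <= k)%N ->
    forall z, `|z| < r -> `|f z - (p k).[z]| <= e) ->
  (fun k => (p k)`_n) @ \oo --> cf f n.
Proof.
move=> r0 fp; have fA : hol r f.
  by move=> e /fp[N hN]; exists (p N); apply: hN.
have K0 : 0 < (2 / r) ^+ n by rewrite exprn_gt0 ?divr_gt0.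
apply/cvgrPdist_le => e e0.
have [|N hN] := fp (e / (2 / r) ^+ n); first by rewrite divr_gt0.
exists N => // k Nk; apply: le_trans (cf_near n r0 fA (hN k Nk)) _.
by rewrite divfK// gt_eqF.
Qed.

Lemma hol_seq (r : C) (f : C -> C) : hol r f -> exists p : nat -> {poly C},
  forall e : C, 0 < e -> exists N, forall k, (N <= k)%N ->
    forall z, `|z| < r -> `|f z - (p k).[z]| <= e.
Proof.
move=> fA; have /choice[p fp] : forall k : nat, exists p : {poly C},
    forall z, `|z| < r -> `|f z - p.[z]| <= k.+1%:R^-1.
  by move=> k; apply: fA; exact: natSV_gt0.
exists p => e /natSV_small[N hN]; exists N => k Nk z zr.
exact: le_trans (fp _ _ zr) (hN _ Nk).
Qed.

Lemma cfD (r : C) (f g : C -> C) (n : nat) : 0 < r -> hol r f -> hol r g ->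
  cf (fun z => f z + g z) n = cf f n + cf g n.
Proof.
move=> r0 /hol_seq[p fp] /hol_seq[q gq].
have H : (fun k => (p k + q k)`_n) @ \oo --> cf (fun z => f z + g z) n.
  refine (@cf_poly_cvg r _ (fun k => p k + q k) n r0 _) => e e0.
  have e2 : 0 < e / 2 by rewrite divr_gt0.
  have [N1 h1] := fp _ e2; have [N2 h2] := gq _ e2; exists (maxn N1 N2) => k.
  rewrite geq_max => /andP[k1 k2] z zr.
  rewrite hornerD opprD addrACA (splitr e); apply: le_trans (ler_normD _ _) _.
  by rewrite lerD ?h1 ?h2.
move: H; rewrite (_ : (fun k => (p k + q k)`_n) = (fun k => (p k)`_n + (q k)`_n)).
  move=> H; apply: (complex_cvg_unique H).
  by apply: cvgD; [exact: cf_poly_cvg fp|exact: cf_poly_cvg gq].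
by apply/funext => k; rewrite coefD.
Qed.

Lemma cfM (r : C) (f g : C -> C) (n : nat) : 0 < r -> hol r f -> hol r g ->
  cf (fun z => f z * g z) n = \sum_(i < n.+1) cf f i * cf g (n - i).
Proof.
move=> r0 fA gA; have [B B0 fB] := hol_bounded r0 fA.
have [D D0 gD] := hol_bounded r0 gA.
have [p fp] := hol_seq fA; have [q gq] := hol_seq gA.
have H : (fun k => (p k * q k)`_n) @ \oo --> cf (fun z => f z * g z) n.
  refine (@cf_poly_cvg r _ (fun k => p k * q k) n r0 _) => e e0.
  have e1 : 0 < e / 2 / B by rewrite !divr_gt0.
  have D1 : 0 < D + 1 by rewrite addr_gt0.
  have e2 : 0 < e / 2 / (D + 1) by rewrite !divr_gt0.
  have [N1 h1] := fp _ e2; have [N2 h2] := gq _ e1.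
  have [N3 h3] := gq _ ltr01.
  exists (maxn (maxn N1 N2) N3) => k.
  rewrite !geq_max => /andP[/andP[k1 k2] k3] z zr.
  have -> : f z * g z - (p k * q k).[z] = f z * (g z - (q k).[z]) + (f z - (p k).[z]) * (q k).[z].
    by rewrite hornerM; ring.
  apply: le_trans (ler_normD _ _) _; rewrite (splitr e) lerD// normrM.
    apply: le_trans (ler_pM _ _ (fB _ zr) (h2 _ k2 _ zr)) _ => //.
    by rewrite mulrC divfK// gt_eqF.
  have qb : `|(q k).[z]| <= D + 1.
    rewrite -[_.[z]](subKr (g z)); apply: le_trans (ler_normB _ _) _.
    by rewrite lerD ?gD ?h3.
  apply: le_trans (ler_pM _ _ (h1 _ k1 _ zr) qb) _ => //.
  by rewrite divfK// gt_eqF.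
move: H; rewrite (_ : (fun k => (p k * q k)`_n) =
    (fun k => \sum_(i < n.+1) (p k)`_i * (q k)`_(n - i))).
  move=> H; apply: (complex_cvg_unique H); apply: complex_cvg_sum => i _.
  by apply: cvgM; [exact: cf_poly_cvg fp|exact: cf_poly_cvg gq].
by apply/funext => k; rewrite coefM.
Qed.

Lemma cfZ (r c : C) (f : C -> C) (n : nat) : 0 < r -> hol r f ->
  cf (fun z => c * f z) n = c * cf f n.
Proof.
move=> r0 fA; rewrite (cfM n r0 (hol_cst r c) fA) big_ord_recl big1 ?addr0 ?subn0.
  by rewrite cf_cst.
by move=> i _; rewrite cf_cst mul0r.
Qed.

Lemma cfB (r : C) (f g : C -> C) (n : nat) : 0 < r -> hol r f -> hol r g ->
  cf (fun z => f z - g z) n = cf f n - cf g n.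
Proof.
move=> r0 fA gA; rewrite (cfD n r0 fA (holN r0 gA)); congr (_ + _).
rewrite -mulN1r -(cfZ _ _ r0 gA); apply: (cf_ext n r0) => z _.
by rewrite mulN1r.
Qed.

Lemma cf_sum (r : C) (I : Type) (s : seq I) (P : pred I) (F : I -> C -> C) (n : nat) : 0 < r ->
  (forall i, P i -> hol r (F i)) ->
  cf (fun z => \sum_(i <- s | P i) F i z) n = \sum_(i <- s | P i) cf (F i) n.
Proof.
move=> r0 FA; elim: s => [|i s IH].
  rewrite big_nil (@cf_ext r _ (fun=> 0)) ?cf_cst ?if_same// => z _.
  by rewrite big_nil.
rewrite big_cons -IH; case Pi : (P i); last first.
  by apply: (cf_ext n r0) => z _; rewrite big_cons Pi.
rewrite -(cfD n r0) //; [|exact: FA|exact: hol_sum].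
by apply: (cf_ext n r0) => z _; rewrite big_cons Pi.
Qed.

Lemma cf_le (r : C) (f : C -> C) (B : C) (n : nat) : 0 < r -> hol r f ->
  (forall z, `|z| < r -> `|f z| <= B) -> `|cf f n| <= B * (2 / r) ^+ n.
Proof.
move=> r0 fA fB; have := @cf_near r f 0 B n r0 fA; rewrite coef0 subr0; apply => z zr.
by rewrite horner0 subr0 fB.
Qed.

Lemma cf0 (r : C) (f : C -> C) : 0 < r -> hol r f -> cf f 0 = f 0.
Proof.
move=> r0 fA; apply: (@eq_of_le_eps 2) => // e e0; have [p fp] := fA e e0.
have h1 := cf_near 0 r0 fA fp; rewrite expr0 mulr1 in h1.
have h2 := fp 0; rewrite normr0 horner_coef0 in h2.
rewrite -[cf f 0](subrK p`_0) -addrA; apply: le_trans (ler_normD _ _) _.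
by rewrite [X in _ + X]distrC mulr_natl mulr2n lerD// h2.
Qed.

Lemma hol_scale (r a : C) (f : C -> C) : `|a| = 1 -> hol r f -> hol r (fun z => f (a * z)).
Proof.
move=> a1 fA e e0; have [p fp] := fA e e0; exists (p \Po (a *: 'X)) => z zr.
by rewrite horner_comp hornerZ hornerX fp// normrM a1 mul1r.
Qed.

Lemma cf_scale (r a : C) (f : C -> C) (n : nat) : 0 < r -> `|a| = 1 -> hol r f ->
  cf (fun z => f (a * z)) n = a ^+ n * cf f n.
Proof.
move=> r0 a1 /hol_seq[p fp].
have H : (fun k => (p k \Po (a *: 'X))`_n) @ \oo --> cf (fun z => f (a * z)) n.
  refine (@cf_poly_cvg r _ (fun k => p k \Po (a *: 'X)) n r0 _) => e e0; have [N hN] := fp _ e0; exists N => k Nk z zr.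
  by rewrite horner_comp hornerZ hornerX hN// normrM a1 mul1r.
have h := cf_poly_cvg (n := n) r0 fp; move: H.
rewrite (_ : (fun k => (p k \Po (a *: 'X))`_n) = (fun k => a ^+ n * (p k)`_n)).
  by move=> H; apply: (complex_cvg_unique H); apply: cvgM; [exact: cvg_cst|exact: h].
apply/funext => k; rewrite comp_polyE coef_sum.
under eq_bigr do rewrite exprZn scalerA coefZ coefXn.
case: (ltnP n (size (p k))) => nk; last first.
  rewrite nth_default// mulr0 big1// => i _.
  by rewrite gtn_eqF ?mulr0// (leq_trans (ltn_ord i)).
rewrite (bigD1 (Ordinal nk)) //= eqxx mulr1 big1 ?addr0 1?mulrC// => i ni.
rewrite (_ : (n == i)%N = false) ?mulr0//; apply: contraNF ni => /eqP e.
by apply/eqP/val_inj.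
Qed.

Lemma cf_lim (r : C) (T : Type) (F : set_system T) (FF : ProperFilter F) (g : T -> C -> C)
  (f : C -> C) (n : nat) : 0 < r -> (forall k, hol r (g k)) ->
  (forall e : C, 0 < e -> \forall k \near F, forall z, `|z| < r -> `|f z - g k z| <= e) ->
  hol r f /\ cf (g k) n @[k --> F] --> cf f n.
Proof.
move=> r0 gA gf; have fA : hol r f.
  move=> e e0; have e2 : 0 < e / 2 by rewrite divr_gt0.
  have [k hk] := filter_ex (gf _ e2); have [p hp] := gA k _ e2.
  exists p => z zr; rewrite -[f z](subrK (g k z)) -addrA (splitr e).
  by apply: le_trans (ler_normD _ _) _; rewrite lerD ?hk ?hp.
split=> //; apply/cvgrPdist_le => e e0.
have K0 : 0 < (2 / r) ^+ n by rewrite exprn_gt0 ?divr_gt0.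
have e2 : 0 < e / (2 / r) ^+ n by rewrite divr_gt0.
apply: filterS (gf _ e2) => k hk; rewrite -(cfB n r0 fA (gA k)).
apply: le_trans (cf_le n r0 _ hk) _; first exact: holB.
by rewrite divfK// gt_eqF.
Qed.

(** Identity theorem. If all coefficients of [f] vanish, those of an [e]-close polynomial are at
    most [e (2 / r)^i], and on radius [r / 4] they sum to at most [2 e]; hence the constant 3. *)
Lemma eq0_of_cf (r : C) (f : C -> C) : 0 < r -> hol r f -> (forall n, cf f n = 0) ->
  forall z, `|z| <= r / 4 -> f z = 0.
Proof.
move=> r0 fA f0 z zr; apply: (@eq_of_le_eps 3) => // e e0; rewrite subr0.
have [p fp] := fA e e0.
have zr' : `|z| < r.
  by apply: le_lt_trans zr _; rewrite ltr_pdivrMr// ltr_pMr// ltr1n.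
rewrite -[f z](subrK p.[z]); apply: le_trans (ler_normD _ _) _.
have -> : 3 * e = e + 2 * e by ring.
rewrite lerD ?fp// horner_coef; apply: le_trans (ler_norm_sum _ _ _) _.
apply: (@le_trans _ _ (\sum_(i < size p) e * (2 * `|z| / r) ^+ i)).
  apply: ler_sum => i _; rewrite normrM normrX.
  have := cf_near i r0 fA fp; rewrite f0 sub0r normrN => h.
  apply: le_trans (ler_wpM2r _ h) _; first exact: exprn_ge0.
  have -> : 2 * `|z| / r = (2 / r) * `|z| by rewrite mulrAC.
  by rewrite [X in _ <= _ * X]exprMn [leRHS]mulrA.
rewrite -mulr_sumr mulrC; apply: ler_wpM2r; first exact: ltW.
apply: geom_le2; first by rewrite divr_ge0 ?mulr_ge0// ltW.
rewrite ler_pdivrMr// -ler_pdivlMl//; apply: le_trans zr _.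
by rewrite [leRHS](_ : _ = r / 4)//; field; rewrite ?pnatr_eq0.
Qed.

Lemma cf_mulXn (r : C) (f : C -> C) (d n : nat) : 0 < r -> hol r f ->
  cf (fun z => z ^+ d * f z) n = if (d <= n)%N then cf f (n - d) else 0.
Proof.
move=> r0 fA.
have XA : hol r (fun z : C => z ^+ d) by apply: holX => //; apply: hol_id.
have cX i : cf (fun z : C => z ^+ d) i = (i == d)%:R.
  rewrite -coefXn -cf_poly; apply: (cf_ext i r0) => z _.
  by rewrite hornerXn.
rewrite (cfM n r0 XA fA); case: leqP => dn.
  rewrite (bigD1 (Ordinal (dn : d < n.+1)%N)) //= cX eqxx mul1r big1 ?addr0// => i id.
  rewrite cX (_ : (i == d :> nat) = false) ?mul0r//; apply: contraNF id => /eqP e.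
  by apply/eqP/val_inj.
rewrite big1// => i _; rewrite cX ltn_eqF ?mul0r//.
by rewrite (leq_ltn_trans _ dn)// -ltnS.
Qed.

End TaylorCoefficients.

(** * Derivatives as Taylor coefficients at a moving base point *)

Section Derivatives.
Variable R : realType.
Local Notation C := (Cx R).

Lemma hol_shift (r r1 a : C) (f : C -> C) : `|a| + r1 <= r -> hol r f -> hol r1 (fun s => f (a + s)).
Proof.
move=> ar fA e e0; have [p fp] := fA e e0; exists (p \Po ('X + a%:P)) => s sr.
rewrite horner_comp hornerD hornerX hornerC [s + a]addrC fp//.
by apply: le_lt_trans (ler_normD _ _) _; apply: lt_le_trans ar; rewrite ltrD2l.
Qed.

Lemma cf_shift_poly (p : {poly C}) (z : C) (n : nat) :
  cf (fun s => p.[z + s]) n = (p^`N(n)).[z].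
Proof.
rewrite (@cf_ext _ 1 _ (horner (\poly_(i < size p) p^`N(i).[z]))) ?ltr01//.
  rewrite cf_poly coef_poly; case: ltnP => // pn.
  by rewrite nderivn_poly0// horner0.
by move=> s _; rewrite nderiv_taylor ?horner_poly//; apply: mulrC.
Qed.

(** The divided derivative [f^(n) / n!], free of difference quotients and again [hol], on half the
    disc. *)
Definition dern (n : nat) (f : C -> C) (z : C) : C := cf (fun s => f (z + s)) n.

Lemma halfC_gt0 (r : C) : 0 < r -> 0 < r / 2. Proof. by move=> r0; rewrite divr_gt0. Qed.

Lemma shift_half (r z : C) : `|z| < r / 2 -> `|z| + r / 2 <= r.
Proof. by move=> zr; rewrite [leRHS]splitr lerD2r ltW. Qed.

Lemma halfC_lt (r : C) : 0 < r -> r / 2 < r.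
Proof. by move=> r0; rewrite ltr_pdivrMr// mulr_natr mulr2n ltrDl. Qed.

Lemma dern_near (r z : C) (f : C -> C) (p : {poly C}) (n : nat) (e : C) : 0 < r -> hol r f ->
  (forall z, `|z| < r -> `|f z - p.[z]| <= e) -> `|z| < r / 2 ->
  `|dern n f z - p^`N(n).[z]| <= e * (4 / r) ^+ n.
Proof.
move=> r0 fA fp zr; have r2 := halfC_gt0 r0.
have hA := hol_shift (shift_half zr) fA.
have pA : hol (r / 2) (fun s => p.[z + s]) by apply: (hol_shift (shift_half zr)); apply: hol_poly.
rewrite -cf_shift_poly -(cfB n r2 hA pA).
have -> : 4 / r = 2 / (r / 2) by field; rewrite gt_eqF.
apply: (cf_le n r2); first exact: holB.
move=> s sr; apply: fp; apply: le_lt_trans (ler_normD _ _) _.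
by apply: lt_le_trans (shift_half zr); rewrite ltrD2l.
Qed.

Lemma dern_poly_cvg (r : C) (f : C -> C) (p : nat -> {poly C}) (n : nat) : 0 < r -> hol r f ->
  (forall e : C, 0 < e -> exists N, forall k, (N <= k)%N ->
    forall z, `|z| < r -> `|f z - (p k).[z]| <= e) ->
  forall e : C, 0 < e -> exists N, forall k, (N <= k)%N ->
    forall z, `|z| < r / 2 -> `|dern n f z - ((p k)^`N(n)).[z]| <= e.
Proof.
move=> r0 fA fp e e0; have K0 : 0 < (4 / r) ^+ n by rewrite exprn_gt0 ?divr_gt0.
have [|N hN] := fp (e / (4 / r) ^+ n); first by rewrite divr_gt0.
exists N => k Nk z zr; apply: le_trans (dern_near n r0 fA (hN k Nk) zr) _.
by rewrite divfK// gt_eqF.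
Qed.

Lemma hol_dern (r : C) (f : C -> C) (n : nat) : 0 < r -> hol r f -> hol (r / 2) (dern n f).
Proof.
move=> r0 fA; have [p fp] := hol_seq fA => e e0.
have [N hN] := dern_poly_cvg n r0 fA fp e0.
by exists (p N)^`N(n) => z zr; apply: hN.
Qed.

Lemma cf_dern (r : C) (f : C -> C) (n m : nat) : 0 < r -> hol r f ->
  cf (dern n f) m = 'C(n + m, n)%:R * cf f (n + m).
Proof.
move=> r0 fA; have [p fp] := hol_seq fA.
have H := cf_poly_cvg (n := m) (halfC_gt0 r0) (dern_poly_cvg n r0 fA fp); move: H.
rewrite (_ : (fun k => _) = (fun k => 'C(n + m, n)%:R * (p k)`_(n + m))).
  move=> H; apply: (complex_cvg_unique H); apply: cvgM; first exact: cvg_cst.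
  exact: cf_poly_cvg fp.
by apply/funext => k; rewrite coef_nderivn mulr_natl.
Qed.

Lemma hol_taylor (r B s : C) (f : C -> C) (m : nat) : 0 < r -> hol r f ->
  (forall z, `|z| < r -> `|f z| <= B) -> `|s| <= r / 4 ->
  `|f s - \sum_(n < m) cf f n * s ^+ n| <= 2 * B * (2 * `|s| / r) ^+ m.
Proof.
move=> r0 fA fB sr.
have sr' : `|s| < r.
  by apply: le_lt_trans sr _; rewrite ltr_pdivrMr// ltr_pMr// ltr1n.
pose X := (2 * `|s| / r) ^+ m; pose Y := \sum_(n < m) (2 / r) ^+ n * `|s| ^+ n.
have r20 : 0 <= 2 / r by rewrite divr_ge0// ltW.
have X0 : 0 <= X by rewrite exprn_ge0// divr_ge0 ?mulr_ge0// ltW.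
have Y0 : 0 <= Y by apply: sumr_ge0 => i _; rewrite mulr_ge0 ?exprn_ge0.
(* The three summands of [K] pay for replacing [f s] by [p.[s]], for the larger bound [B + e / K] on
   [p], and for replacing the coefficients. *)
apply/ler_addgt0Pl => e e0; pose K := 1 + 2 * X + Y.
have K0 : 0 < K by rewrite /K -addrA ltr_wpDr// addr_ge0 ?mulr_ge0.
have e1 : 0 < e / K by rewrite divr_gt0.
have [p fp] := fA _ e1.
have pB z : `|z| < r -> `|p.[z]| <= B + e / K.
  move=> zr; rewrite -[p.[z]](subKr (f z)); apply: le_trans (ler_normB _ _) _.
  by rewrite lerD ?fB ?fp.
have h := taylor_remainder m r0 pB sr.
have -> : f s - \sum_(n < m) cf f n * s ^+ n = (f s - p.[s]) +
    (p.[s] - \sum_(n < m) p`_n * s ^+ n) - \sum_(n < m) (cf f n - p`_n) * s ^+ n.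
  have -> : \sum_(n < m) (cf f n - p`_n) * s ^+ n =
      \sum_(n < m) cf f n * s ^+ n - \sum_(n < m) p`_n * s ^+ n.
    by rewrite -sumrB; apply: eq_bigr => i _; rewrite mulrBl.
  ring.
apply: le_trans (ler_normB _ _) _.
apply: le_trans (lerD (le_trans (ler_normD _ _) (lerD (fp _ sr') h)) _) _.
  exact: le_trans (ler_norm_sum _ _ _) (lexx _).
apply: le_trans (lerD (lexx _) (_ : _ <= \sum_(n < m) e / K * (2 / r) ^+ n * `|s| ^+ n)) _.
  apply: ler_sum => i _; rewrite normrM normrX ler_wpM2r ?exprn_ge0//.
  exact: (cf_near i r0 fA fp).
under eq_bigr do rewrite -mulrA.
rewrite -mulr_sumr -/Y -/X.
have eK : e / K * K = e by rewrite divfK// gt_eqF.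
rewrite [leLHS](_ : _ = e / K * K + 2 * B * X); first by rewrite eK.
by move: (e / K) => d; rewrite /K; ring.
Qed.

(** The second-order Taylor remainder controls the difference quotient. This links [dern] to the
    derivative used in the theorem. *)
Lemma derive1_dern (r z : C) (F : C -> C) (a : C) : 0 < r -> hol r (fun z => F (a + z)) ->
  `|z| < r / 2 -> derive1 F (a + z) = dern 1 (fun z => F (a + z)) z.
Proof.
move=> r0 fA zr; have r2 := halfC_gt0 r0.
have hA := hol_shift (shift_half zr) fA.
have [B B0 hB] := hol_bounded r2 hA.
rewrite /derive1; apply: cvg_lim; first exact: norm_hausdorff.
apply/cvgrPdist_le => e e0.
pose K := 2 * B * (2 / (r / 2)) ^+ 2.
have K0 : 0 < K by apply: mulr_gt0; [exact: mulr_gt0|exact/exprn_gt0/divr_gt0].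
have r8 : 0 < r / 2 / 4 by rewrite !divr_gt0.
near=> h.
have hr : `|h| <= r / 2 / 4.
  by near: h; apply: dnbhs0_le.
have he : `|h| <= e / K by near: h; apply: dnbhs0_le; rewrite divr_gt0.
have h0 : h != 0 by near: h; exact: nbhs_dnbhs_neq.
have := hol_taylor 2 r2 hA hB hr; rewrite 2!big_ord_recl big_ord0 addr0 expr0 mulr1.
rewrite (cf0 r2 hA) addr0 -/(dern 1 _ z) => T.
have -> : dern 1 (fun z => F (a + z)) z - h^-1 *: (F (h + (a + z)) - F (a + z)) =
   - (h^-1 * (F (a + (z + h)) - (F (a + z) + dern 1 (fun z => F (a + z)) z * h ^+ 1))).
  have -> : h + (a + z) = a + (z + h) by ring.
  rewrite /GRing.scale /=; field; exact: h0.
rewrite normrN normrM normfV ler_pdivrMl ?normr_gt0//.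
apply: le_trans T _.
rewrite -[leLHS](_ : K * `|h| * `|h| = _); last by rewrite /K; field; rewrite gt_eqF.
by rewrite mulrC ler_wpM2l// mulrC -ler_pdivlMr.
Unshelve. all: by end_near.
Qed.

(** Each derivative halves the disc, so the induction runs over all radii; only the value at the
    centre matters. *)
Lemma derive1n_cf (m : nat) (r : C) (F : C -> C) (a : C) : 0 < r -> hol r (fun z => F (a + z)) ->
  derive1n m F a = m`!%:R * cf (fun z => F (a + z)) m.
Proof.
elim: m r F => [|m IH] r F r0 fA.
  by rewrite /derive1n /= fact0 mul1r (cf0 r0 fA) addr0.
have r2 := halfC_gt0 r0.
have dE z : `|z| < r / 2 -> dern 1 (fun z => F (a + z)) z = derive1 F (a + z).
  by move=> zr; rewrite (derive1_dern r0 fA zr).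
rewrite derive1Sn (IH (r / 2))//; last exact: hol_ext dE (hol_dern 1 r0 fA).
rewrite -(cf_ext m r2 dE) (cf_dern 1 m r0 fA) add1n bin1 mulrA -natrM mulnC.
by rewrite -factS.
Qed.

Lemma dern1M (r z : C) (f g : C -> C) : 0 < r -> hol r f -> hol r g -> `|z| < r / 2 ->
  dern 1 (fun z => f z * g z) z = dern 1 f z * g z + f z * dern 1 g z.
Proof.
move=> r0 fA gA zr; have r2 := halfC_gt0 r0.
have hf := hol_shift (shift_half zr) fA; have hg := hol_shift (shift_half zr) gA.
rewrite /dern (cfM 1 r2 hf hg) 2!big_ord_recl big_ord0 addr0 subn0 subnn.
by rewrite (cf0 r2 hf) (cf0 r2 hg) !addr0 addrC.
Qed.

Lemma dern1X (r z : C) (f : C -> C) (n : nat) : 0 < r -> hol r f -> `|z| < r / 2 ->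
  dern 1 (fun z => f z ^+ n) z = n%:R * f z ^+ n.-1 * dern 1 f z.
Proof.
move=> r0 fA zr; elim: n => [|n IH].
  rewrite /dern (@cf_ext _ 1 _ (fun=> 1)) ?cf_cst ?mul0r ?ltr01//.
rewrite /dern (@cf_ext _ 1 _ (fun s => f (z + s) * f (z + s) ^+ n)) ?ltr01//; last first.
  by move=> s _; rewrite exprS.
rewrite -/(dern 1 (fun s => f s * f s ^+ n) z) (dern1M r0 fA (holX n r0 fA) zr) IH -/(dern 1 f z).
by case: n {IH} => [|n] /=; rewrite ?expr0 -?natr1 ?exprS; ring.
Qed.

End Derivatives.

(** * The same calculus in two variables *)

Section TwoVariables.
Variable R : realType.
Local Notation C := (Cx R).

Definition hol2 (r : C) (F : C -> C -> C) : Prop := forall e : C, 0 < e ->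
  exists P : {poly {poly C}}, forall t s, `|t| < r -> `|s| < r -> `|F t s - P.[s%:P].[t]| <= e.

Lemma hol2_ext (r : C) (F G : C -> C -> C) :
  (forall t s, `|t| < r -> `|s| < r -> F t s = G t s) -> hol2 r F -> hol2 r G.
Proof.
move=> FG FA e e0; have [P FP] := FA e e0.
by exists P => t s tr sr; rewrite -FG// FP.
Qed.

Lemma hol2_fst (r : C) (f : C -> C) : hol r f -> hol2 r (fun t _ => f t).
Proof.
move=> fA e e0; have [p fp] := fA e e0.
by exists p%:P => t s tr sr; rewrite hornerC fp.
Qed.

Lemma hol2_cst (r c : C) : hol2 r (fun _ _ => c).
Proof. by apply: hol2_fst; apply: hol_cst. Qed.

Lemma hol2_add (r : C) (f : C -> C) : hol (r + r) f -> hol2 r (fun t s => f (t + s)).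
Proof.
move=> fA e e0; have [p fp] := fA e e0.
exists (map_poly polyC p \Po ('X + 'X%:P)) => t s tr sr.
rewrite horner_comp hornerD hornerX hornerC -/(comp_poly _ _) horner_comp hornerD hornerX.
rewrite hornerC addrC [X in f X]addrC; rewrite addrC.
rewrite [s + t]addrC fp//; apply: le_lt_trans (ler_normD _ _) _; exact: ltrD.
Qed.

Lemma hol2D (r : C) (F G : C -> C -> C) : hol2 r F -> hol2 r G -> hol2 r (fun t s => F t s + G t s).
Proof.
move=> fA gA e e0; have e2 : 0 < e / 2 by rewrite divr_gt0.
have [p fp] := fA _ e2; have [q gq] := gA _ e2; exists (p + q) => t s tr sr.
rewrite !hornerD opprD addrACA (splitr e); apply: le_trans (ler_normD _ _) _.
by rewrite lerD ?fp ?gq.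
Qed.

Lemma poly2_bounded (P : {poly {poly C}}) (r : C) : 0 < r -> exists2 B : C, 0 < B &
  forall t s, `|t| < r -> `|s| < r -> `|P.[s%:P].[t]| <= B.
Proof.
move=> r0.
have /choice[b hb] : forall i : nat, exists B : C, 0 < B /\ forall z, `|z| < r -> `|(P`_i).[z]| <= B.
  by move=> i; have [B B0 hB] := poly_bounded P`_i r0; exists B.
exists (1 + \sum_(i < size P) b i * r ^+ i).
  rewrite ltr_wpDr// sumr_ge0// => i _.
  by rewrite mulr_ge0 ?exprn_ge0// ltW//; case: (hb i).
move=> t s tr sr; rewrite [X in X.[t]]horner_coef horner_sum; apply: le_trans (ler_norm_sum _ _ _) _.
apply: le_trans (_ : \sum_(i < size P) b i * r ^+ i <= _); last by rewrite lerDr.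
apply: ler_sum => i _; rewrite -rmorphXn hornerM hornerC normrM normrX.
apply: ler_pM => //; first by case: (hb i) => _; apply.
by rewrite lerXn2r// ?nnegrE// ltW.
Qed.

Lemma hol2_bounded (r : C) (F : C -> C -> C) : 0 < r -> hol2 r F -> exists2 B : C, 0 < B &
  forall t s, `|t| < r -> `|s| < r -> `|F t s| <= B.
Proof.
move=> r0 /(_ 1 ltr01)[p fp]; have [B B0 pB] := poly2_bounded p r0.
exists (1 + B); first by rewrite addr_gt0.
move=> t s tr sr; rewrite -[F t s](subrK p.[s%:P].[t]).
by apply: le_trans (ler_normD _ _) _; rewrite lerD ?fp ?pB.
Qed.

Lemma hol2M (r : C) (F G : C -> C -> C) : 0 < r -> hol2 r F -> hol2 r G ->
  hol2 r (fun t s => F t s * G t s).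
Proof.
move=> r0 fA gA e e0; have [B B0 fB] := hol2_bounded r0 fA.
have e2 : 0 < e / 2 / B by rewrite !divr_gt0.
have [q gq] := gA _ e2; have [D D0 qD] := poly2_bounded q r0.
have e3 : 0 < e / 2 / D by rewrite !divr_gt0.
have [p fp] := fA _ e3; exists (p * q) => t s tr sr.
have -> : F t s * G t s - (p * q).[s%:P].[t] =
    F t s * (G t s - q.[s%:P].[t]) + (F t s - p.[s%:P].[t]) * q.[s%:P].[t].
  by rewrite !hornerM; ring.
apply: le_trans (ler_normD _ _) _; rewrite (splitr e) lerD// normrM.
  apply: le_trans (ler_pM _ _ (fB _ _ tr sr) (gq _ _ tr sr)) _ => //.
  by rewrite mulrC divfK// gt_eqF.
apply: le_trans (ler_pM _ _ (fp _ _ tr sr) (qD _ _ tr sr)) _ => //.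
by rewrite divfK// gt_eqF.
Qed.

Lemma hol2Z (r c : C) (F : C -> C -> C) : 0 < r -> hol2 r F -> hol2 r (fun t s => c * F t s).
Proof. by move=> r0 FA; apply: hol2M => //; apply: hol2_cst. Qed.

Lemma hol2N (r : C) (F : C -> C -> C) : 0 < r -> hol2 r F -> hol2 r (fun t s => - F t s).
Proof. by move=> r0 FA; apply: hol2_ext (hol2Z (-1) r0 FA) => t s _ _; rewrite mulN1r. Qed.

Lemma hol2B (r : C) (F G : C -> C -> C) : 0 < r -> hol2 r F -> hol2 r G ->
  hol2 r (fun t s => F t s - G t s).
Proof. by move=> r0 FA GA; apply: hol2D => //; apply: hol2N. Qed.

Lemma hol2_sum (r : C) (I : Type) (s : seq I) (P : pred I) (F : I -> C -> C -> C) :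
  (forall i, P i -> hol2 r (F i)) -> hol2 r (fun t u => \sum_(i <- s | P i) F i t u).
Proof.
move=> FA; elim: s => [|i s IH].
  by apply: hol2_ext (hol2_cst r 0) => t u _ _; rewrite big_nil.
case Pi : (P i); last by apply: hol2_ext IH => t u _ _; rewrite big_cons Pi.
by apply: hol2_ext (hol2D (FA i Pi) IH) => t u _ _; rewrite big_cons Pi.
Qed.

Lemma hol2_prod (r : C) (I : Type) (s : seq I) (P : pred I) (F : I -> C -> C -> C) : 0 < r ->
  (forall i, P i -> hol2 r (F i)) -> hol2 r (fun t u => \prod_(i <- s | P i) F i t u).
Proof.
move=> r0 FA; elim: s => [|i s IH].
  by apply: hol2_ext (hol2_cst r 1) => t u _ _; rewrite big_nil.
case Pi : (P i); last by apply: hol2_ext IH => t u _ _; rewrite big_cons Pi.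
by apply: hol2_ext (hol2M r0 (FA i Pi) IH) => t u _ _; rewrite big_cons Pi.
Qed.

Lemma hol2X (r : C) (F : C -> C -> C) (n : nat) : 0 < r -> hol2 r F -> hol2 r (fun t s => F t s ^+ n).
Proof.
move=> r0 FA; elim: n => [|n IH].
  by apply: hol2_ext (hol2_cst r 1) => t s _ _; rewrite expr0.
by apply: hol2_ext (hol2M r0 FA IH) => t s _ _; rewrite exprS.
Qed.

Lemma hol2_lim (r : C) (T : Type) (L : set_system T) (FF : ProperFilter L) (G : T -> C -> C -> C)
  (F : C -> C -> C) : (forall k, hol2 r (G k)) ->
  (forall e : C, 0 < e -> \forall k \near L, forall t s, `|t| < r -> `|s| < r ->
     `|F t s - G k t s| <= e) -> hol2 r F.
Proof.
move=> GA GF e e0; have e2 : 0 < e / 2 by rewrite divr_gt0.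
have [k hk] := filter_ex (GF _ e2); have [p hp] := GA k _ e2.
exists p => t s tr sr; rewrite -[F t s](subrK (G k t s)) -addrA (splitr e).
by apply: le_trans (ler_normD _ _) _; rewrite lerD ?hk ?hp.
Qed.

Lemma poly2_row (P : {poly {poly C}}) (t s : C) :
  P.[s%:P].[t] = (map_poly (horner_eval t) P).[s].
Proof.
have := horner_map (horner_eval t) P s%:P.
by rewrite /= /horner_eval hornerC.
Qed.

Lemma hol2_row (r t : C) (F : C -> C -> C) : hol2 r F -> `|t| < r -> hol r (F t).
Proof.
move=> FA tr e e0; have [P FP] := FA e e0.
by exists (map_poly (horner_eval t) P) => s sr; rewrite -poly2_row FP.
Qed.

Lemma hol2_cf (r : C) (F : C -> C -> C) (m : nat) : 0 < r -> hol2 r F -> hol r (fun t => cf (F t) m).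
Proof.
move=> r0 FA e e0; have K0 : 0 < (2 / r) ^+ m by rewrite exprn_gt0 ?divr_gt0.
have [|P FP] := FA (e / (2 / r) ^+ m); first by rewrite divr_gt0.
exists (P`_m) => t tr.
have := @cf_near _ r (F t) (map_poly (horner_eval t) P) (e / (2 / r) ^+ m) m r0 (hol2_row FA tr).
rewrite divfK ?gt_eqF// coef_map /horner_eval; apply => s sr.
by rewrite -poly2_row FP.
Qed.

Lemma cf2_le (r : C) (F : C -> C -> C) (B : C) (n m : nat) : 0 < r -> hol2 r F ->
  (forall t s, `|t| < r -> `|s| < r -> `|F t s| <= B) ->
  `|cf (fun t => cf (F t) m) n| <= B * (2 / r) ^+ m * (2 / r) ^+ n.
Proof.
move=> r0 FA FB; apply: (cf_le n r0 (hol2_cf m r0 FA)) => t tr.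
by apply: (cf_le m r0 (hol2_row FA tr)) => s sr; apply: FB.
Qed.

Lemma cf2_lim (r : C) (T : Type) (L : set_system T) (FF : ProperFilter L) (G : T -> C -> C -> C)
  (F : C -> C -> C) (n m : nat) : 0 < r -> (forall k, hol2 r (G k)) ->
  (forall e : C, 0 < e -> \forall k \near L, forall t s, `|t| < r -> `|s| < r ->
     `|F t s - G k t s| <= e) ->
  cf (fun t => cf (G k t) m) n @[k --> L] --> cf (fun t => cf (F t) m) n.
Proof.
move=> r0 GA GF; have FA := hol2_lim FF GA GF.
have K0 : 0 < (2 / r) ^+ m by rewrite exprn_gt0 ?divr_gt0.
apply: (cf_lim FF n r0 (f := fun t => cf (F t) m) (g := fun k t => cf (G k t) m) _ _).2.
  by move=> k; apply: hol2_cf.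
move=> e e0; have e2 : 0 < e / (2 / r) ^+ m by rewrite divr_gt0.
apply: filterS (GF _ e2) => k hk t tr.
rewrite -(cfB m r0 (hol2_row FA tr) (hol2_row (GA k) tr)).
apply: le_trans (cf_le m r0 (holB r0 (hol2_row FA tr) (hol2_row (GA k) tr)) (hk t^~ tr)) _.
by rewrite divfK// gt_eqF.
Qed.

End TwoVariables.

(** * The complex exponential and its composition with [hol] functions *)

Section ComplexExponential.
Variable R : realType.
Local Notation C := (Cx R).

Lemma CexpD (x y : C) : Cexp (x + y) = Cexp x * Cexp y.
Proof.
case: x y => [a b] [c d]; rewrite /Cexp /= expRD cosD sinD.
by apply/eqP; rewrite eq_complex /=; apply/andP; split; apply/eqP; ring.
Qed.

Lemma Cexp0 : Cexp (0 : C) = 1.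
Proof. by rewrite /Cexp /= expR0 cos0 sin0 mulr1 mulr0. Qed.

Lemma CexpN_mul (x : C) : Cexp (- x) * Cexp x = 1.
Proof. by rewrite -CexpD addNr Cexp0. Qed.

Lemma Cexp_neq0 (x : C) : Cexp x != 0.
Proof.
apply/eqP => h; have := CexpN_mul x; rewrite h mulr0 => /esym/eqP.
by rewrite oner_eq0.
Qed.

Lemma CexpN (x : C) : Cexp (- x) = (Cexp x)^-1.
Proof. by apply: (mulIf (Cexp_neq0 x)); rewrite CexpN_mul mulVf ?Cexp_neq0. Qed.

Lemma Cexp_nat (n : nat) (x : C) : Cexp (n%:R * x) = Cexp x ^+ n.
Proof.
elim: n => [|n IH]; first by rewrite mul0r Cexp0 expr0.
by rewrite -natr1 mulrDl mul1r CexpD IH exprSr.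
Qed.

Lemma Cexp_int (n : int) (x : C) : Cexp (n%:~R * x) = Cexp x ^ n.
Proof.
case: n => n; first by rewrite Cexp_nat.
by rewrite NegzE mulrNz mulNr CexpN Cexp_nat.
Qed.

Lemma cvg_real_complex (T : Type) (F : set_system T) (FF : Filter F) (u : T -> R) (a : R) :
  u @ F --> a -> (fun t => (u t)%:C%C : C) @ F --> (a%:C%C : C).
Proof.
move=> /cvgrPdist_le ua; apply/cvgrPdist_le => e /complex_gt0P[x x0 ->].
by apply: filterS (ua x x0) => t; rewrite -rmorphB norm_real_complex lecR.
Qed.

Lemma complex_cvg_real (T : Type) (F : set_system T) {FF : Filter F} (u : T -> R) (a : C) :
  (fun t => (u t)%:C%C : C) @ F --> a -> u @ F --> complex.Re a.
Proof.
move=> /cvgrPdist_le ua; apply/cvgrPdist_le => e e0.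
have e0' : 0 < (e%:C%C : C) by rewrite ltcR.
apply: filterS (ua _ e0') => t h; rewrite -(@lecR R).
have -> : complex.Re a - u t = complex.Re (a - (u t)%:C%C) by case: (a).
exact: le_trans (normc_ge_Re _) h.
Qed.

Definition Epart (n : nat) (z : C) : C := \sum_(i < n) z ^+ i / i`!%:R.

Definition eexp (n : nat) (x : R) : R := \sum_(i < n) x ^+ i / i`!%:R.

Lemma eexp_cvg (x : R) : (eexp ^~ x) @ \oo --> expR x.
Proof.
rewrite (_ : eexp ^~ x = series (exp_coeff x)); first exact: is_cvg_series_exp_coeff.
by apply/funext => n; rewrite /series /= big_mkord.
Qed.

Lemma eexp_le (x : R) (n : nat) : 0 <= x -> eexp n x <= expR x.
Proof.
move=> x0; have := @nondecreasing_cvgn_le R (eexp ^~ x) _ _ n.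
rewrite (cvg_lim _ (@eexp_cvg x)); last exact: Rhausdorff.
apply; last exact: eexp_cvg.
apply/nondecreasing_seqP => k; rewrite /eexp big_ord_recr /= lerDl.
by rewrite divr_ge0 ?exprn_ge0.
Qed.

Lemma Epart_real (n : nat) (x : R) : Epart n x%:C%C = (eexp n x)%:C%C.
Proof.
rewrite /Epart /eexp rmorph_sum; apply: eq_bigr => i _.
by rewrite rmorphM fmorphV rmorphXn rmorph_nat.
Qed.

Lemma Epart_imag (n : nat) (b : R) : Epart n ('i%C * b%:C%C) =
  (series (cos_coeff b) n)%:C%C + 'i%C * (series (sin_coeff b) n)%:C%C.
Proof.
rewrite /Epart /series /= !big_mkord !rmorph_sum mulr_sumr -big_split /=.
apply: eq_bigr => i _; rewrite exprMn -mulrA.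
have -> : (b%:C%C ^+ i / i`!%:R : C) = (b ^+ i / i`!%:R)%:C%C.
  by rewrite rmorphM fmorphV rmorphXn rmorph_nat.
rewrite -{1}(odd_double_half i) exprD -mul2n exprM sqr_i.
rewrite /cos_coeff /sin_coeff /= -!mulrA; move: (b ^+ i / i`!%:R) => X.
case: (boolP (odd i)) => oi /=; rewrite ?mul0r ?mul1r ?mulr0 ?add0r ?addr0.
  have -> : i.-1./2 = i./2.
    by rewrite -{1}(odd_double_half i) oi add1n /= doubleK.
  by rewrite expr1 rmorphM rmorphXn rmorphN1 mulrA.
by rewrite rmorphM -exprnP rmorphXn rmorphN1.
Qed.

(** The left difference consists of the products of terms of total degree at least [n]; all their
    coefficients are nonnegative, so taking norms inside gives the same expression at [|z|] and
    [|w|]. *)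
Lemma Epart_mul_le (n : nat) (z w : C) : `|Epart n z * Epart n w - Epart n (z + w)| <=
  Epart n `|z| * Epart n `|w| - Epart n (`|z| + `|w|).
Proof.
pose p (x : C) : {poly C} := \poly_(i < n) (x ^+ i / i`!%:R).
have pE x : Epart n x = (p x).[1].
  by rewrite horner_poly; apply: eq_bigr => i _; rewrite expr1n mulr1.
have pC x i : (p x)`_i = if (i < n)%N then x ^+ i / i`!%:R else 0 by rewrite coef_poly.
have pZ x : (size (p x) <= n)%N by apply: size_poly.
clearbody p.
have pD x y k : (k < n)%N -> (p (x + y))`_k = (p x * p y)`_k.
  move=> kn; rewrite pC kn coefM [x + y]addrC exprDn mulr_suml; apply: eq_bigr => i _.
  have ik : (i <= k)%N by rewrite -ltnS.
  rewrite !pC (leq_ltn_trans ik kn) (leq_ltn_trans (leq_subr _ _) kn).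
  have hk : (k`!%:R : C) = 'C(k, i)%:R * i`!%:R * (k - i)`!%:R.
    by rewrite -!natrM -(bin_fact ik) mulnA.
  have f0 m : (m`!%:R : C) != 0 by rewrite pnatr_eq0 -lt0n fact_gt0.
  have c0 : ('C(k, i)%:R : C) != 0 by rewrite pnatr_eq0 -lt0n bin_gt0.
  rewrite hk -mulr_natr; field.
  by rewrite !f0 c0.
have pS x y : (size (p x * p y - p (x + y))%R <= n + n)%N.
  apply: leq_trans (size_polyD _ _) _; rewrite size_polyN geq_max.
  rewrite (leq_trans (pZ _)) ?leq_addr// andbT.
  apply: leq_trans (size_polyMleq _ _) _; apply: leq_trans (leq_pred _) _.
  exact: leq_add.
rewrite !pE -!hornerM -!hornerN -!hornerD.
rewrite !(horner_coef_wide _ (pS _ _)); apply: le_trans (ler_norm_sum _ _ _) _.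
apply: ler_sum => k _; rewrite !expr1n !mulr1 !coefB.
case: (ltnP k n) => kn; first by rewrite !pD// !subrr normr0.
have p0 x : (p x)`_k = 0 by rewrite pC ltnNge kn.
rewrite (p0 (z + w)) (p0 (`|z| + `|w|)) !subr0 !coefM; apply: le_trans (ler_norm_sum _ _ _) _.
have aux x m : `|(p x)`_m| = (p `|x|)`_m.
  by rewrite !pC; case: ifP => _; rewrite ?normr0// normrM normrX normfV normr_nat.
by apply: ler_sum => i _; rewrite normrM !aux.
Qed.

(** Real and purely imaginary arguments reduce to the series of [expR], [cos] and [sin].
    [Epart_mul_le] joins them, its bound tending to 0 because [expR] is multiplicative. *)
Lemma Epart_cvg (z : C) : (Epart ^~ z) @ \oo --> Cexp z.
Proof.
have iE (b : R) : (fun n => Epart n ('i%C * b%:C%C)) @ \oo --> ((cos b)%:C%C + 'i%C * (sin b)%:C%C : C).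
  rewrite (_ : (fun n => _) = (fun n => (series (cos_coeff b) n)%:C%C +
     'i%C * (series (sin_coeff b) n)%:C%C)); last by apply/funext => n; rewrite Epart_imag.
  apply: cvgD; first by apply: cvg_real_complex; rewrite unlock; exact: is_cvg_series_cos_coeff.
  apply: cvgM; first exact: cvg_cst.
  by apply: cvg_real_complex; rewrite unlock; exact: is_cvg_series_sin_coeff.
have rE (a : R) : (fun n => Epart n a%:C%C) @ \oo --> ((expR a)%:C%C : C).
  rewrite (_ : (fun n => _) = (fun n => (eexp n a)%:C%C)).
    by apply: cvg_real_complex; exact: eexp_cvg.
  by apply/funext => n; rewrite Epart_real.
have nE : exists2 x : R, 0 <= x & `|z| = x%:C%C.
  exists (complex.Re `|z|); last by rewrite normc_def.
  by rewrite normc_def /= sqrtr_ge0.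
pose a := complex.Re z; pose b := complex.Im z.
have zE : z = a%:C%C + 'i%C * b%:C%C by rewrite -complexE.
have -> : Cexp z = (expR a)%:C%C * ((cos b)%:C%C + 'i%C * (sin b)%:C%C).
  rewrite /Cexp -/a -/b; apply/eqP; rewrite eq_complex /=.
  by apply/andP; split; apply/eqP; ring.
have prod := @cvgM _ _ _ _ _ _ _ _ (@rE a) (@iE b).
have E0 : (fun n => Epart n a%:C%C * Epart n ('i%C * b%:C%C) - Epart n z) @ \oo --> (0 : C).
  have [x Hx] : exists x : R, `|a%:C%C : C| = x%:C%C by exists `|a|; rewrite norm_real_complex.
  have [y Hy] : exists y : R, `|'i%C * b%:C%C : C| = y%:C%C.
    exists `|b|; rewrite normrM norm_real_complex normc_def /= expr0n expr1n add0r sqrtr1.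
    by rewrite mul1r.
  have lim0 : (fun n => ((eexp n x)%:C%C * (eexp n y)%:C%C - (eexp n (x + y))%:C%C : C)) @ \oo --> (0 : C).
    rewrite -(subrr ((expR x)%:C%C * (expR y)%:C%C : C)).
    have hx : (fun n => (eexp n x)%:C%C : C) @ \oo --> ((expR x)%:C%C : C).
      by apply: cvg_real_complex; exact: eexp_cvg.
    have hy : (fun n => (eexp n y)%:C%C : C) @ \oo --> ((expR y)%:C%C : C).
      by apply: cvg_real_complex; exact: eexp_cvg.
    have hxy : (fun n => (eexp n (x + y))%:C%C : C) @ \oo --> ((expR x)%:C%C * (expR y)%:C%C : C).
      by rewrite -rmorphM -expRD; apply: cvg_real_complex; exact: eexp_cvg.
    exact: cvgB (cvgM hx hy) hxy.
  apply/cvgrPdist_le => e e0; move/cvgrPdist_le/(_ e e0): lim0.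
  apply: filterS => n; rewrite !sub0r !normrN => h.
  rewrite [in Epart n z]zE; apply: le_trans (Epart_mul_le _ _ _) _.
  rewrite Hx Hy -rmorphD !Epart_real; apply: le_trans h.
  by apply: real_ler_norm; apply/complex_realP; eexists; rewrite -rmorphM -rmorphB.
rewrite -[X in _ --> X]subr0.
rewrite (_ : Epart ^~ z = (fun n => Epart n a%:C%C * Epart n ('i%C * b%:C%C) -
   (Epart n a%:C%C * Epart n ('i%C * b%:C%C) - Epart n z))).
  exact: cvgB (prod _) E0.
by apply/funext => n; rewrite subKr.
Qed.

Lemma Epart_le (B z : C) (m n : nat) : (n <= m)%N -> `|z| <= B ->
  `|Epart m z - Epart n z| <= Epart m B - Epart n B.
Proof.
move=> nm zB; rewrite -(subnKC nm).
have E x : Epart (n + (m - n)) x - Epart n x = \sum_(i < m - n) x ^+ (n + i) / (n + i)`!%:R.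
  by rewrite /Epart big_split_ord /= addrAC subrr add0r.
rewrite !E.
apply: le_trans (ler_norm_sum _ _ _) _; apply: ler_sum => i _.
rewrite normrM normrX normfV normr_nat ler_wpM2r ?invr_ge0//.
by rewrite lerXn2r ?nnegrE// (le_trans _ zB).
Qed.

Lemma Epart_unif (B e : C) : 0 < B -> 0 < e -> exists n0, forall n, (n0 <= n)%N ->
  forall z, `|z| <= B -> `|Cexp z - Epart n z| <= e.
Proof.
move=> /complex_gt0P[b b0 ->] e0.
have hb : (fun n => (eexp n b)%:C%C : C) @ \oo --> ((expR b)%:C%C : C).
  by apply: cvg_real_complex; exact: eexp_cvg.
move/cvgrPdist_le/(_ _ e0): hb => [n0 _ h0].
exists n0 => n nn z zB.
have h : `|(expR b)%:C%C - (eexp n b)%:C%C : C| <= e by exact: h0.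
apply/ler_addgt0Pl => d d0.
have /cvgrPdist_le/(_ _ d0)[m0 _ hm] := @Epart_cvg z.
have Hm := hm (maxn n m0) (leq_maxr _ _).
rewrite -[Cexp z](subrK (Epart (maxn n m0) z)) -addrA.
apply: le_trans (ler_normD _ _) _; rewrite lerD// ?Hm//.
apply: le_trans (Epart_le (leq_maxl n m0) zB) _; apply: le_trans h.
rewrite !Epart_real -!rmorphB norm_real_complex lecR.
rewrite ger0_norm ?subr_ge0 ?eexp_le// ?(ltW b0)//.
by rewrite lerD2r eexp_le// ltW.
Qed.

Lemma Cexp_sub1_le (z : C) : `|z| <= 1 -> `|Cexp z - 1| <= 2 * `|z|.
Proof.
move=> z1; apply/ler_addgt0Pl => d d0.
have /cvgrPdist_le/(_ _ d0)[m0 _ hm] := @Epart_cvg z.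
have Hm := hm m0.+1 (leqnSn _).
rewrite -[Cexp z](subrK (Epart m0.+1 z)) -addrA; apply: le_trans (ler_normD _ _) _.
rewrite lerD// ?Hm//.
rewrite /Epart big_ord_recl expr0 fact0 divr1 addrAC subrr add0r.
apply: le_trans (ler_norm_sum _ _ _) _.
apply: (@le_trans _ _ (\sum_(i < m0) `|z| * 2^-1 ^+ i)).
  apply: ler_sum => i _; rewrite normrM normrX normfV normr_nat lift0 exprS -mulrA ler_wpM2l//.
  rewrite -[leRHS]mul1r; apply: ler_pM; rewrite ?exprn_ge0 ?invr_ge0//.
    by rewrite exprn_ile1.
  rewrite exprVn lef_pV2 ?posrE ?exprn_gt0 ?ltr0n ?fact_gt0//.
  rewrite -natrX ler_nat; elim: (i : nat) => // k IH.
  by rewrite expnS factS leq_mul.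
by rewrite -mulr_sumr mulrC ler_wpM2r// geom_le2 ?invr_ge0.
Qed.

Lemma hol2_exp (r : C) (F : C -> C -> C) : 0 < r -> hol2 r F -> hol2 r (fun t s => Cexp (F t s)).
Proof.
move=> r0 FA; have [B B0 FB] := hol2_bounded r0 FA.
apply: (@hol2_lim R r nat \oo _ (fun n t s => Epart n (F t s))) => [n|e e0].
  by apply: hol2_sum => i _; apply: hol2M => //; [exact: hol2X|exact: hol2_cst].
have [n0 h] := Epart_unif B0 e0.
by exists n0 => // n nn t s tr sr; apply: h => //; apply: FB.
Qed.

Lemma hol_of_hol2 (r : C) (f : C -> C) : 0 < r -> hol2 r (fun t _ => f t) -> hol r f.
Proof.
move=> r0 fA; apply: hol_ext (hol2_cf 0 r0 fA) => t tr.
by rewrite cf_cst.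
Qed.

Lemma hol_exp (r : C) (f : C -> C) : 0 < r -> hol r f -> hol r (fun z => Cexp (f z)).
Proof. by move=> r0 fA; apply: hol_of_hol2 => //; apply: hol2_exp => //; apply: hol2_fst. Qed.

Lemma cf_mul_low (r : C) (f g : C -> C) (a b : nat) : 0 < r -> hol r f -> hol r g ->
  (forall i, (i < a)%N -> cf f i = 0) -> (forall i, (i < b)%N -> cf g i = 0) ->
  (forall i, (i < a + b)%N -> cf (fun z => f z * g z) i = 0) /\
  cf (fun z => f z * g z) (a + b) = cf f a * cf g b.
Proof.
move=> r0 fA gA fa gb; split=> [i iab|]; rewrite (cfM _ r0 fA gA).
  apply: big1 => j _; case: (ltnP j a) => ja; first by rewrite fa// mul0r.
  by rewrite gb ?mulr0//; have := ltn_ord j; lia.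
have ab : (a < (a + b).+1)%N by rewrite ltnS leq_addr.
rewrite (bigD1 (Ordinal ab)) //= addKn big1 ?addr0// => j /negP ja.
case: (ltngtP j a) => [/fa->|h|h]; first by rewrite mul0r.
  by rewrite gb ?mulr0//; have := ltn_ord j; lia.
by case: ja; apply/eqP/val_inj.
Qed.

Lemma cf_expn_low (r : C) (f : C -> C) (l : nat) : 0 < r -> hol r f -> f 0 = 0 ->
  (forall i, (i < l)%N -> cf (fun z => f z ^+ l) i = 0) /\
  cf (fun z => f z ^+ l) l = cf f 1 ^+ l.
Proof.
move=> r0 fA f0; elim: l => [|l [IH1 IH2]].
  by split=> //; rewrite expr0 (cf_ext 0 r0 (g := fun=> 1)) ?cf_cst// => z _; rewrite expr0.
have low i : (i < 1)%N -> cf f i = 0 by case: i => // _; rewrite (cf0 r0 fA).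
have [h1 h2] := cf_mul_low r0 fA (holX l r0 fA) low IH1.
have E i : cf (fun z => f z ^+ l.+1) i = cf (fun z => f z * f z ^+ l) i.
  by apply: (cf_ext i r0) => z _; rewrite exprS.
split=> [i il|]; rewrite E; first by rewrite h1.
by rewrite -{2}add1n h2 IH2 exprS.
Qed.

(** The coefficient just above the lowest one. It is the origin of the second derivative of [psi] in
    the correction of order [1 / N]. *)
Lemma cf_expn_next (r : C) (f : C -> C) (l : nat) : 0 < r -> hol r f -> f 0 = 0 ->
  cf (fun z => f z ^+ l) l.+1 = l%:R * cf f 1 ^+ l.-1 * cf f 2.
Proof.
move=> r0 fA f0; elim: l => [|l IH].
  by rewrite (cf_ext 1 r0 (g := fun=> 1)) ?cf_cst ?mul0r// => z _; rewrite expr0.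
rewrite (cf_ext l.+2 r0 (g := fun z => f z * f z ^+ l)); last by move=> z _; rewrite exprS.
have [h1 h2] := cf_expn_low l r0 fA f0.
rewrite (cfM _ r0 fA (holX l r0 fA)) 3!big_ord_recl big1 ?addr0; last first.
  by move=> i _; rewrite h1 ?mulr0// !lift0; have := ltn_ord i; lia.
rewrite (cf0 r0 fA) f0 mul0r add0r /bump /= !subSS !subn0 IH h2.
by case: l {IH h1 h2} => [|l] /=; rewrite ?expr0 -?natr1 ?exprS; ring.
Qed.

(** Since [f 0 = 0], the power [f^l] starts in degree [l], so that only finitely many terms of the
    exponential series reach degree [m]. *)
Lemma cf_exp (r : C) (f : C -> C) (m : nat) : 0 < r -> hol r f -> f 0 = 0 ->
  cf (fun z => Cexp (f z)) m = \sum_(l < m.+1) cf (fun z => f z ^+ l) m / l`!%:R.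
Proof.
move=> r0 fA f0; have [B B0 fB] := hol_bounded r0 fA.
have [|e e0|_ H] := @cf_lim R r nat \oo _ (fun n z => Epart n (f z)) (fun z => Cexp (f z)) m r0.
- by move=> n; apply: hol_sum => i _; apply: holM => //; [exact: holX|exact: hol_cst].
- have [n0 h] := Epart_unif B0 e0.
  by exists n0 => // n nn z zr; apply: h => //; apply: fB.
apply: (complex_cvg_unique H); apply: cvg_near_cst.
exists m.+1 => // n /= mn.
rewrite (cf_sum _ m r0); last first.
  by move=> i _; apply: holM => //; [exact: holX|exact: hol_cst].
rewrite -(subnKC mn) big_split_ord /= [X in _ + X]big1 ?addr0.
  apply: eq_bigr => i _; rewrite mulrC -(cfZ _ _ r0 (holX i r0 fA)).
  by apply: (cf_ext m r0) => z _; rewrite mulrC.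
move=> i _; have [h _] := cf_expn_low (m.+1 + i) r0 fA f0.
rewrite (cf_ext m r0 (g := fun z => (m.+1 + i)`!%:R^-1 * f z ^+ (m.+1 + i))).
  rewrite (cfZ _ _ r0 (holX _ r0 fA)) h ?mulr0//; by rewrite addSn ltnS leq_addr.
by move=> z _; rewrite mulrC.
Qed.

Lemma dern1_exp (r z : C) (f : C -> C) : 0 < r -> hol r f -> `|z| < r / 2 ->
  dern 1 (fun z => Cexp (f z)) z = dern 1 f z * Cexp (f z).
Proof.
move=> r0 fA zr; have r2 := halfC_gt0 r0.
have hf := hol_shift (shift_half zr) fA.
have gA : hol (r / 2) (fun s => f (z + s) - f z) by apply: holB => //; apply: hol_cst.
rewrite /dern (cf_ext 1 r2 (g := fun s => Cexp (f z) * Cexp (f (z + s) - f z))); last first.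
  by move=> s _; rewrite -CexpD [f z + _]addrC subrK.
rewrite (cfZ _ _ r2 (hol_exp r2 gA)) mulrC; congr (_ * _).
rewrite (cf_exp 1 r2 gA) ?addr0 ?subrr// !big_ord_recl big_ord0.
rewrite (cf_ext 1 r2 (g := fun=> 1)) ?cf_cst ?mul0r ?add0r ?addr0; last by move=> s _; rewrite expr0.
rewrite !lift0 divr1 (cf_ext 1 r2 (g := fun s => f (z + s) - f z)); last by move=> s _; rewrite expr1.
by rewrite (cfB 1 r2 hf (hol_cst _ _)) cf_cst subr0.
Qed.

End ComplexExponential.

(** * Power series, and the passage from [analytic_near] to [hol] *)

Section PowerSeries.
Variable R : realType.
Local Notation C := (Cx R).

Lemma geom_small (M e : C) : 0 < M -> 0 < e ->
  exists n0, forall n, (n0 <= n)%N -> M * 2^-1 ^+ n <= e.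
Proof.
move=> M0 e0; have [|n0 h] := @natSV_small R (e / M); first by rewrite divr_gt0.
exists n0 => n nn; rewrite mulrC -ler_pdivlMr//; apply: le_trans (h n nn).
rewrite exprVn lef_pV2 ?posrE ?exprn_gt0 ?ltr0n//.
by rewrite -natrX ler_nat ltn_expl.
Qed.

Lemma pseries_tail (a : nat -> C) (rho M y : C) (m n : nat) : 0 < rho ->
  (forall k, `|a k| * rho ^+ k <= M) -> `|y| < rho / 2 -> (n <= m)%N ->
  `|\sum_(i < m) a i * y ^+ i - \sum_(i < n) a i * y ^+ i| <= 2 * M * 2^-1 ^+ n.
Proof.
move=> r0 aM yr nm; have M0 : 0 <= M by apply: le_trans (aM 0) => //; rewrite mulr_ge0 ?exprn_ge0// ltW.
rewrite -(subnKC nm) big_split_ord /= addrAC subrr add0r.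
apply: le_trans (ler_norm_sum _ _ _) _.
apply: (@le_trans _ _ (\sum_(i < m - n) M * 2^-1 ^+ n * 2^-1 ^+ i)).
  apply: ler_sum => i _; rewrite -mulrA -exprD normrM normrX.
  apply: le_trans (_ : `|a (n + i)%N| * (rho / 2) ^+ (n + i) <= _).
    by rewrite ler_wpM2l// lerXn2r ?nnegrE// ltW// divr_gt0.
  by rewrite exprMn mulrA ler_wpM2r// exprn_ge0// invr_ge0.
rewrite -mulr_sumr mulrC -[2 * M * _]mulrA ler_wpM2r// ?geom_le2 ?invr_ge0//.
by rewrite mulr_ge0// exprn_ge0// invr_ge0.
Qed.

Lemma pseries_hol (a : nat -> C) (rho M : C) (f : C -> C) : 0 < rho ->
  (forall k, `|a k| * rho ^+ k <= M) ->
  (forall y, `|y| < rho / 2 -> (fun m => \sum_(i < m) a i * y ^+ i) @ \oo --> f y) ->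
  hol (rho / 2) f /\ forall n, cf f n = a n.
Proof.
move=> r0 aM fy; pose p n : {poly C} := \poly_(i < n) a i.
have M0 : 0 <= M by apply: le_trans (aM 0) => //; rewrite mulr_ge0 ?exprn_ge0// ltW.
have M1 : 0 < 2 * (M + 1) by rewrite mulr_gt0// ltr_wpDl.
have close n y : `|y| < rho / 2 -> `|f y - (p n).[y]| <= 2 * (M + 1) * 2^-1 ^+ n.
  move=> yr; apply/ler_addgt0Pl => d d0.
  have /cvgrPdist_le/(_ _ d0)[m0 _ hm] := @fy y yr.
  have Hm := hm (maxn n m0) (leq_maxr _ _).
  rewrite horner_poly -[f y](subrK (\sum_(i < maxn n m0) a i * y ^+ i)) -addrA.
  apply: le_trans (ler_normD _ _) _; rewrite lerD// ?Hm//.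
  apply: le_trans (pseries_tail r0 aM yr (leq_maxl n m0)) _.
  by rewrite ler_wpM2r ?exprn_ge0 ?invr_ge0// ler_wpM2l// lerDl.
have U e : 0 < e -> exists N, forall k, (N <= k)%N ->
    forall z, `|z| < rho / 2 -> `|f z - (p k).[z]| <= e.
  move=> e0; have [n0 h] := geom_small M1 e0; exists n0 => k nk z zr.
  exact: le_trans (close _ _ zr) (h k nk).
have r2 := halfC_gt0 r0.
have A : hol (rho / 2) f.
  by move=> e e0; have [N h] := U e e0; exists (p N); apply: h.
split=> // n; have H := @cf_poly_cvg R _ _ _ n r2 U.
apply: (complex_cvg_unique H); apply: cvg_near_cst.
by exists n.+1 => // k /= nk; rewrite coef_poly nk.
Qed.

Lemma analytic_hol (F : C -> C) (z0 : C) : analytic_near F z0 ->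
  exists2 r : C, 0 < r & hol r (fun z => F (z0 + z)).
Proof.
move=> [r r0 [a aF]]; have r0' : 0 < (r%:C%C : C) by rewrite ltcR.
pose rho : C := r%:C%C / 2; have rho0 : 0 < rho by exact: halfC_gt0.
have aF' y : `|y| < r%:C%C -> (fun m => \sum_(i < m) a i * y ^+ i) @ \oo --> F (z0 + y).
  move=> yr; have := aF (z0 + y); rewrite addrAC subrr add0r => /(_ yr).
  rewrite (_ : series _ = (fun m => \sum_(i < m) a i * y ^+ i))//.
  by apply/funext => m; rewrite /series /= big_mkord.
(* Convergence at the single point [rho] bounds the terms: beyond [N] each is a difference of two
   partial sums within 1 of the limit, and the sum over the earlier ones is added. *)
have [M aM] : exists M, forall k, `|a k| * rho ^+ k <= M.
  have : `|rho| < r%:C%C by rewrite gtr0_norm// halfC_lt.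
  move=> /aF' h; have /cvgrPdist_le/(_ _ ltr01)[N _ hN] := h.
  have T k : (N <= k)%N -> `|a k| * rho ^+ k <= 2.
    move=> Nk; have h1 := hN k Nk; have h2 := hN k.+1 (leqW Nk).
    rewrite -[leLHS](_ : `|a k * rho ^+ k| = _); last by rewrite normrM normrX (gtr0_norm rho0).
    set S := \sum_(i < k) _ in h1; have -> : a k * rho ^+ k =
       (F (z0 + rho) - S) - (F (z0 + rho) - \sum_(i < k.+1) a i * rho ^+ i).
      by rewrite big_ord_recr /= -/S; ring.
    by apply: le_trans (ler_normB _ _) _; rewrite [leRHS](_ : _ = 1 + 1)// lerD.
  exists (2 + \sum_(i < N) `|a i| * rho ^+ i) => k.
  have P i : 0 <= `|a i| * rho ^+ i by rewrite mulr_ge0 ?exprn_ge0// ltW.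
  case: (leqP N k) => Nk.
    by apply: le_trans (T k Nk) _; rewrite lerDl sumr_ge0.
  rewrite (bigD1 (Ordinal Nk)) //= addrCA lerDl addr_ge0// sumr_ge0//.
exists (rho / 2); first exact: halfC_gt0.
apply: (pseries_hol rho0 aM _).1 => y yr; apply: aF'.
apply: lt_trans yr _; apply: lt_trans (halfC_lt rho0) _; exact: halfC_lt.
Qed.

Lemma pseries_exists (a : nat -> C) : (forall n, `|a n| <= 1) ->
  exists f : C -> C, hol (1 / 2) f /\ forall n, cf f n = a n.
Proof.
move=> a1; have aM k : `|a k| * 1 ^+ k <= 1 by rewrite expr1n mulr1.
have /choice[f hf] : forall y : C, exists l : C, `|y| < 1 / 2 ->
    (fun m => \sum_(i < m) a i * y ^+ i) @ \oo --> l.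
  move=> y; case: (pselect (`|y| < 1 / 2)) => [yr|ny]; last by exists 0 => /ny.
  have [|l hl] := @complex_complete R (fun m => \sum_(i < m) a i * y ^+ i); last by exists l.
  move=> e e0; have [|n0 h] := @geom_small 4 e _ e0; first by rewrite ltr0n.
  exists n0 => m n nm nn.
  rewrite -[X in `|X - _|](subrK (\sum_(i < n0) a i * y ^+ i)) -addrA.
  apply: le_trans (ler_normD _ _) _.
  have h1 := pseries_tail ltr01 aM yr nm; have h2 := pseries_tail ltr01 aM yr nn.
  rewrite [X in _ + X]distrC; apply: le_trans (lerD h1 h2) _.
  apply: le_trans (h n0 (leqnn _)).
  by rewrite -mulrDl mulr1 -natrD.
by exists f; apply: (pseries_hol ltr01 aM).
Qed.

End PowerSeries.

(** * The principal logarithm near 1 *)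

Section Logarithm.
Variable R : realType.
Local Notation C := (Cx R).

Lemma CexpK (z : C) : - (pi / 2) < complex.Im z < pi / 2 -> Clog (Cexp z) = z.
Proof.
case: z => a b /= hb; rewrite /Clog /Cexp /= /Carg /=.
have c0 := cos_gt0_pihalf hb; have e0 := expR_gt0 a.
rewrite mulr_gt0//; apply/eqP; rewrite eq_complex /=; apply/andP; split; apply/eqP.
  rewrite !exprMn -mulrDr cos2Dsin2 mulr1 sqrtr_sqr ger0_norm ?expR_ge0//.
  exact: expRK.
have -> : expR a * sin b / (expR a * cos b) = tan b.
  by rewrite /tan; field; rewrite !gt_eqF.
by apply: tanK; rewrite in_itv.
Qed.

(** The logarithm series [l] comes first. The product [(1 + z) Cexp (- l z)] has derivative 0, hence
    is constantly 1, so [l] is a logarithm of [1 + z]; as [|l z| < 1 <= pi / 2], [CexpK] identifies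
    it with the principal branch. *)
Lemma hol_log : exists2 r : C, 0 < r & [/\ hol r (fun z => Clog (1 + z)),
  forall z, `|z| < r -> Cexp (Clog (1 + z)) = 1 + z &
  forall z, `|z| < r / 2 -> (1 + z) * dern 1 (fun z => Clog (1 + z)) z = 1].
Proof.
pose a (n : nat) : C := if n is k.+1 then (-1) ^+ k / k.+1%:R else 0.
have [|l [lA cl]] := @pseries_exists R a.
  case=> [|n]; first by rewrite normr0.
  rewrite normrM normrX normrN1 expr1n mul1r normfV normr_nat invf_le1 ?ltr0n//.
  by rewrite ler1n.
have r1 : 0 < (1 / 2 : C) by rewrite divr_gt0.
have r2 := halfC_gt0 r1; have r3 := halfC_gt0 r2; have r4 := halfC_gt0 r3.
have sub (r : C) f : 0 < r -> hol r f -> hol (r / 2) f.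
  by move=> r0; apply: hol_sub; rewrite ltW// halfC_lt.
have l0 : l 0 = 0 by rewrite -(cf0 r1 lA) cl.
have holp r : hol r (fun z : C => 1 + z) by apply: holD; [exact: hol_cst|exact: hol_id].
have c1p n : cf (fun z : C => 1 + z) n = (n == 0%N)%:R + (n == 1%N)%:R.
  rewrite (cfD n r1 (hol_cst _ _) (hol_id _)) cf_cst (@cf_ext R 1 _ (horner 'X)) ?ltr01//.
    by rewrite cf_poly coefX; case: eqP.
  by move=> z _; rewrite hornerX.
have dlA := hol_dern 1 r1 lA.
(* the derivative of the series is the geometric series of 1 / (1 + z) *)
have dl z : `|z| <= 1 / 2 / 2 / 4 -> (1 + z) * dern 1 l z = 1.
  move=> zr; apply/eqP; rewrite -subr_eq0; apply/eqP.
  apply: (@eq0_of_cf R _ (fun z => (1 + z) * dern 1 l z - 1) r2) => //.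
    by apply: holB => //; [exact: holM|exact: hol_cst].
  move=> n; rewrite (cfB n r2 (holM r2 (holp _) dlA) (hol_cst _ _)) (cfM n r2 (holp _) dlA) cf_cst.
  under eq_bigr do rewrite c1p (cf_dern _ _ r1 lA) cl add1n bin1 /=.
  have E k : k.+1%:R * ((-1) ^+ k / k.+1%:R) = (-1) ^+ k :> C.
    by field; rewrite addrC natr1 pnatr_eq0.
  case: n => [|n]; first by rewrite big_ord1 /= E addr0 mul1r subrr.
  rewrite 2!big_ord_recl big1 /= ?addr0 ?add0r ?mul1r ?subr0 ?subn1 ?subn0 /=.
    by rewrite !E exprS mulN1r addNr.
  by move=> i _; rewrite mul0r.
pose h z := (1 + z) * Cexp (- l z).
have rr : 0 < (1 / 2 / 2 / 4 : C) by rewrite divr_gt0.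
pose rho : C := 1 / 2 / 2 / 4; have rho0 : 0 < rho by [].
have rhole : rho <= 1 / 2 / 2 by rewrite /rho ler_pdivrMr// ler_peMr ?(ltW r2)// ler1n.
have lA' : hol rho l by apply: hol_sub lA; apply: le_trans rhole _; rewrite ltW// halfC_lt.
have NlA : hol rho (fun z => - l z) by exact: holN.
have eA := hol_exp rho0 NlA; have hA : hol rho h by exact: holM.
have rhoh : rho / 2 <= rho by rewrite ltW// halfC_lt.
have dh z : `|z| < rho / 2 -> dern 1 h z = 0.
  move=> zr; rewrite /h (dern1M rho0 (holp _) eA zr) (dern1_exp rho0 NlA zr).
  have -> : dern 1 (fun z : C => 1 + z) z = 1.
    rewrite /dern (cf_ext 1 rho0 (g := fun s => (1 + z) + s)); last by move=> s _; rewrite addrA.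
    rewrite (cfD 1 r1 (hol_cst _ _) (hol_id _)) cf_cst (@cf_ext R 1 _ (horner 'X)) ?ltr01//.
      by rewrite cf_poly coefX add0r.
    by move=> s _; rewrite hornerX.
  have -> : dern 1 (fun z => - l z) z = - dern 1 l z.
    have lz := hol_shift (shift_half zr) lA'.
    rewrite /dern -mulN1r -(cfZ _ _ (halfC_gt0 rho0) lz).
    by apply: (cf_ext 1 rho0) => s _; rewrite mulN1r.
  have zr' : `|z| <= 1 / 2 / 2 / 4 by apply: le_trans (ltW zr) rhoh.
  by rewrite mul1r mulNr mulrN mulrA (dl z zr') mul1r subrr.
have h1 z : `|z| <= rho / 4 -> h z = 1.
  move=> zr; apply/eqP; rewrite -subr_eq0; apply/eqP.
  apply: (@eq0_of_cf R _ (fun z => h z - 1) rho0) => //.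
    by apply: holB => //; exact: hol_cst.
  move=> [|n]; rewrite (cfB _ rho0 hA (hol_cst _ _)) cf_cst /=.
    by rewrite (cf0 rho0 hA) /h l0 oppr0 Cexp0 addr0 mulr1 subrr.
  have := cf_dern 1 n rho0 hA; rewrite (cf_ext n (halfC_gt0 rho0) dh) cf_cst if_same.
  rewrite add1n bin1 => /esym/eqP; rewrite mulf_eq0 pnatr_eq0 /= subr0.
  by move/eqP.
have [B B0 lB] := hol_bounded rho0 lA'.
(* For [|z|] below this radius the first-order Taylor bound [4 B |z| / rho] on [|l z|] is less than
   1/2. *)
have q0 : 0 < rho / (8 * B) by rewrite divr_gt0// mulr_gt0.
have rho4 : 0 < rho / 4 by rewrite divr_gt0.
have [r [r0 rq rr4]] := lt_minC q0 rho4.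
have logE z : `|z| < r -> Cexp (l z) = 1 + z /\ Clog (1 + z) = l z.
  move=> zr; have zr4 : `|z| <= rho / 4 by rewrite ltW// (lt_le_trans zr).
  have E : Cexp (l z) = 1 + z.
    transitivity (h z * Cexp (l z)); first by rewrite (h1 z zr4) mul1r.
    by rewrite /h -mulrA CexpN_mul mulr1.
  split=> //; rewrite -E CexpK//.
  have T := hol_taylor 1 rho0 lA' lB zr4.
  rewrite big_ord1 cl mul0r subr0 expr1 in T.
  have ll : `|l z| < 1.
    apply: le_lt_trans T _; apply: (@lt_trans _ _ (4 * B * r / rho)).
      rewrite [ltLHS](_ : _ = 4 * B * `|z| / rho); last by field; rewrite gt_eqF.
      by rewrite ltr_pM2r ?invr_gt0// ltr_pM2l// mulr_gt0.
    apply: (@le_lt_trans _ _ (4 * B * (rho / (8 * B)) / rho)).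
      by rewrite ler_pM2r ?invr_gt0// ler_pM2l// mulr_gt0.
    rewrite [ltLHS](_ : _ = 2^-1) ?invf_lt1 ?ltr1n//.
    by field; rewrite !gt_eqF.
  have := le_lt_trans (normc_ge_Im (l z)) ll; rewrite ltcR ltr_norml => /andP[i1 i2].
  have p1 := @pihalf_ge1 R.
  by rewrite (lt_le_trans i2 p1) (le_lt_trans _ i1)// lerN2.
have rle : r <= rho by apply: le_trans rr4 _; rewrite ler_pdivrMr// ler_peMr ?(ltW rho0)// ler1n.
exists r => //; split=> [|z zr|z zr].
- by apply: hol_ext (hol_sub rle lA') => z zr; have [_ ->] := logE z zr.
- by have [e ->] := logE z zr.
have -> : dern 1 (fun z => Clog (1 + z)) z = dern 1 l z.
  apply: (cf_ext 1 (halfC_gt0 r0)) => s sr; have [|_ ->//] := logE (z + s) _.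
  by apply: le_lt_trans (ler_normD _ _) _; rewrite [ltRHS]splitr ltrD.
apply: dl; apply: ltW; apply: lt_le_trans zr _; apply: le_trans rle.
by rewrite ltW// halfC_lt.
Qed.

End Logarithm.

(** * Complex powers and the binomial series *)

Section ComplexPowers.
Variable R : realType.
Local Notation C := (Cx R).

Definition gbin (w : C) (n : nat) : C := (\prod_(i < n) (w - i%:R)) / n`!%:R.

Lemma gbin0 (w : C) : gbin w 0 = 1.
Proof. by rewrite /gbin big_ord0 fact0 divr1. Qed.

Lemma gbinS (w : C) (n : nat) : n.+1%:R * gbin w n.+1 = (w - n%:R) * gbin w n.
Proof.
rewrite /gbin big_ord_recr /= factS natrM; field.
by rewrite !pnatr_eq0 -!lt0n fact_gt0 addrC natr1 pnatr_eq0.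
Qed.

Lemma cf_one_plus (n : nat) : cf (fun z : C => 1 + z) n = (n == 0%N)%:R + (n == 1%N)%:R.
Proof.
rewrite (cfD n ltr01 (hol_cst 1 1) (hol_id 1)) cf_cst (@cf_ext R 1 _ (horner 'X)) ?ltr01//.
  by rewrite cf_poly coefX; case: eqP.
by move=> z _; rewrite hornerX.
Qed.

Lemma hol_one_plus (r : C) : hol r (fun z : C => 1 + z).
Proof. by apply: holD; [exact: hol_cst|exact: hol_id]. Qed.

Lemma Clog1 : Clog (1 : C) = 0.
Proof.
have := @CexpK R 0; rewrite Cexp0; apply=> /=.
by rewrite oppr_lt0 divr_gt0 ?pi_gt0.
Qed.

(** The radius is chosen before [w], so one disc serves all exponents. On coefficients the equation
    [(1 + z) f' = w f], inherited from the logarithm, is the recursion [gbinS]. The bound [1 / 2]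
    keeps [1 + z] away from 0. *)
Lemma Cpow_hol : exists2 r : C, 0 < r & r <= 1 / 2 /\ forall w : C,
  [/\ hol r (fun z => Cpow (1 + z) w),
      forall n, cf (fun z => Cpow (1 + z) w) n = gbin w n,
      forall z v, `|z| < r -> Cpow (1 + z) (w + v) = Cpow (1 + z) w * Cpow (1 + z) v,
      forall z (n : int), `|z| < r -> Cpow (1 + z) n%:~R = (1 + z) ^ n &
      forall z, `|z| < r / 2 -> dern 1 (fun z => Cpow (1 + z) w) z = w * Cpow (1 + z) (w - 1)].
Proof.
have [r1 r10 [lA le dl]] := hol_log R.
have [|r [r0 rr1 r12]] := lt_minC r10 (_ : 0 < (1 / 2 : C)); first by rewrite divr_gt0.
have nz z : `|z| < r -> 1 + z != 0.
  move=> zr; apply/eqP => h; have : `|z| < 1.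
    by apply: lt_le_trans zr _; apply: le_trans r12 _; rewrite ltW// halfC_lt.
  rewrite -normrN; have -> : - z = 1 by apply/eqP; rewrite eq_sym -subr_eq0 opprK h.
  by rewrite normr1 ltxx.
have E z w : `|z| < r -> Cpow (1 + z) w = Cexp (w * Clog (1 + z)).
  by move=> zr; rewrite /Cpow (negPf (nz z zr)).
have lA' := hol_sub rr1 lA.
have r2 := halfC_gt0 r0; have r2r := ltW (halfC_lt r0).
have D z w v : `|z| < r -> Cpow (1 + z) (w + v) = Cpow (1 + z) w * Cpow (1 + z) v.
  by move=> zr; rewrite !E// mulrDl CexpD.
have I z (n : int) : `|z| < r -> Cpow (1 + z) n%:~R = (1 + z) ^ n.
  by move=> zr; rewrite E// Cexp_int le// (lt_le_trans zr).
exists r => //; split=> // w.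
have gA : hol r (fun z => Cpow (1 + z) w).
  apply: (hol_ext (f := fun z => Cexp (w * Clog (1 + z)))) => [z zr|].
    by rewrite E.
  by apply: hol_exp => //; apply: holZ.
have dg z : `|z| < r / 2 -> (1 + z) * dern 1 (fun z => Cpow (1 + z) w) z = w * Cpow (1 + z) w.
  move=> zr; have zr' : `|z| < r by apply: lt_le_trans zr _.
  have -> : dern 1 (fun z => Cpow (1 + z) w) z = dern 1 (fun z => Cexp (w * Clog (1 + z))) z.
    apply: (cf_ext 1 r2) => s sr; apply: E.
    by apply: le_lt_trans (ler_normD _ _) _; rewrite [ltRHS]splitr ltrD.
  rewrite (dern1_exp r0 (holZ w r0 lA') zr) E//.
  have -> : dern 1 (fun z => w * Clog (1 + z)) z = w * dern 1 (fun z => Clog (1 + z)) z.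
    exact: (cfZ _ _ r2 (hol_shift (shift_half zr) lA')).
  have h := dl z (lt_le_trans zr _); rewrite mulrA mulrCA h ?mulr1//.
  by rewrite ler_pM2r ?invr_gt0.
have Dw z v : `|z| < r -> Cpow (1 + z) (w + v) = Cpow (1 + z) w * Cpow (1 + z) v by exact: D.
split=> //.
  have dgA := hol_dern 1 r0 gA; elim=> [|n IH].
    by rewrite (cf0 r0 gA) gbin0 E ?normr0// addr0 Clog1 mulr0 Cexp0.
  have := cf_ext n r2 dg.
  rewrite (cfM n r2 (hol_one_plus _) dgA) (cfZ _ _ r0 gA) IH.
  under eq_bigr do rewrite cf_one_plus (cf_dern _ _ r0 gA) add1n bin1.
  have n0 : (n.+1%:R : C) != 0 by rewrite pnatr_eq0.
  case: n IH n0 => [|n] IH n0.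
    rewrite big_ord1 /= addr0 !mul1r gbin0 mulr1 => ->.
    by rewrite /gbin big_ord1 subr0 divr1.
  rewrite 2!big_ord_recl big1 /= ?addr0 ?add0r ?mul1r ?subn0 ?subn1 /=; last first.
    by move=> i _; rewrite mul0r.
  rewrite IH => h; apply: (mulfI n0); rewrite gbinS mulrBl -h; ring.
move=> z zr; have zr' : `|z| < r by apply: lt_le_trans zr _.
apply: (mulfI (nz z zr')); rewrite dg// mulrCA; congr (_ * _).
rewrite -{2}[1 + z]expr1z -I// -D//; congr (Cpow _ _).
by rewrite addrC subrK.
Qed.

End ComplexPowers.

(** * The branching rule for alternants *)

Section Branching.
Variable R : realType.
Local Notation C := (Cx R).

Definition alt (N : nat) (e : 'I_N -> int) (u : 'rV[C]_N) : C :=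
  \det (\matrix_(i < N, j < N) (u 0 i) ^ (e j)).

Definition mono (N : nat) (a : {ffun 'I_N -> int}) (u : 'rV[C]_N) : C :=
  \prod_(i < N) (u 0 i) ^ (a i).

Lemma det_sum_cols (n D : nat) (F : 'I_n -> 'I_D -> 'I_n -> C) :
  \det (\matrix_(i < n, j < n) \sum_(m < D) F j m i) =
  \sum_(f : {ffun 'I_n -> 'I_D}) \det (\matrix_(i < n, j < n) F j (f j) i).
Proof.
rewrite -det_tr /determinant.
transitivity (\sum_(s : 'S_n) \sum_(f : {ffun 'I_n -> 'I_D})
    (-1) ^+ s * \prod_(j < n) F j (f j) (s j)).
  apply: eq_bigr => s _; rewrite -mulr_sumr; congr (_ * _).
  under eq_bigr do rewrite !mxE.
  by rewrite bigA_distr_bigA.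
rewrite exchange_big /=; apply: eq_bigr => f _.
rewrite -/(determinant _) -det_tr /determinant; apply: eq_bigr => s _.
by congr (_ * _); apply: eq_bigr => j _; rewrite !mxE.
Qed.

Lemma lift_max_lt0 (N : nat) (j : 'I_N) :
  (lift (ord_max : 'I_N.+1) j < lift (ord0 : 'I_N.+1) j)%N.
Proof. by rewrite lift_max lift0. Qed.

(** Column operations clear the first row except for its last entry. In the remaining minor each
    entry contains a difference [x^d - y^d], which factors as [x - y] times a geometric sum;
    multilinearity in the columns then yields one term per choice [f] of interlacing exponents. *)
Lemma alt_branch (N : nat) (e : 'I_N.+1 -> int) (u : 'rV[C]_N.+1) :
  (forall i j : 'I_N.+1, (i < j)%N -> e j < e i) -> torus u ->
  let u' : 'rV[C]_N := \row_i u 0 (lift ord0 i) in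
  let d (j : 'I_N) := `|e (lift ord_max j) - e (lift ord0 j)|%N in
  let D := \max_j d j in
  alt e u = u 0 ord0 ^ e ord_max * \prod_(i < N) (u 0 ord0 - u' 0 i) *
    \sum_(f : {ffun 'I_N -> 'I_D} | [forall j, (f j < d j)%N])
      (\prod_(j < N) u 0 ord0 ^+ ((d j).-1 - f j)) * alt (fun j : 'I_N => e (lift ord0 j) + (f j)%:Z) u'.
Proof.
move=> eD uT u' d D.
have dE j : (d j)%:Z = e (lift ord_max j) - e (lift ord0 j).
  by rewrite /d gez0_abs// subr_ge0 ltW// eD// lift_max_lt0.
(* Right multiplication by [T] subtracts from column [j] the multiple of column [j + 1] that cancels
   the entry of the first row. *)
pose T : 'M[C]_N.+1 := \matrix_(i, j) (if i == j then 1 else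
  if i == j.+1 :> nat then - u 0 ord0 ^ (e j - e i) else 0).
pose M : 'M[C]_N.+1 := \matrix_(i, j) (u 0 i) ^ (e j).
have detT : \det T = 1.
  rewrite det_trig; first by rewrite big1// => i _; rewrite mxE eqxx.
  apply/is_trig_mxP => i j ij; rewrite mxE; case: eqP => [E|_]; first by rewrite E ltnn in ij.
  by case: eqP => // E; rewrite E ltnNge leqnSn in ij.
have MTmax i : (M *m T) i ord_max = u 0 i ^ e ord_max.
  rewrite mxE (bigD1 ord_max) //= !mxE eqxx mulr1 big1 ?addr0// => k kmax.
  rewrite !mxE (negPf kmax); case: eqP => [E|_]; last by rewrite mulr0.
  by have := ltn_ord k; rewrite E ltnn.
have MTlift i j : (M *m T) i (lift ord_max j) =
    u 0 i ^ e (lift ord_max j) - u 0 ord0 ^+ d j * u 0 i ^ e (lift ord0 j).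
  have bj : bump N j = j by rewrite /bump leqNgt ltn_ord.
  rewrite mxE (bigD1 (lift ord_max j)) //= (bigD1 (lift ord0 j)) /=; last first.
    by apply/eqP => /(congr1 val) /=; rewrite bj /bump /=; lia.
  rewrite big1 => [|k /andP[k1 k2]].
    rewrite !mxE eqxx mulr1 addr0; congr (_ + _).
    rewrite ifF; last by apply/eqP => /(congr1 val) /=; rewrite bj /bump /=; lia.
    rewrite /= bj {1}/bump /= add1n eqxx -dE mulrN mulrC; congr (- (_ * _)).
  rewrite !mxE (negPf k1) /= bj; case: eqP => [E|_]; last by rewrite mulr0.
  by case/eqP: k2; apply: val_inj; rewrite /= E /bump.
have -> : alt e u = \det (M *m T) by rewrite det_mulmx detT mulr1.
rewrite (expand_det_row _ ord0) (bigD1 ord_max) //= [X in _ + X]big1 ?addr0; last first.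
  move=> j; case: (unliftP ord_max j) => [k ->|->]; last by rewrite eqxx.
  move=> _; rewrite MTlift exprnP dE -expfzDr ?uT// subrK subrr mul0r//.
rewrite MTmax -!mulrA; congr (_ * _).
rewrite /cofactor /= add0n.
(* The geometric sums have different lengths [d j]; padding with zeros to the common length [D] lets
   [det_sum_cols] apply. *)
pose F (j : 'I_N) (m : 'I_D) (i : 'I_N) : C := if (m < d j)%N then
   u 0 ord0 ^+ ((d j).-1 - m) * u' 0 i ^ (e (lift ord0 j) + m%:Z) else 0.
have -> : row' ord0 (col' ord_max (M *m T)) =
    diag_mx (\row_i (- (u 0 ord0 - u' 0 i))) *m \matrix_(i, j) \sum_(m < D) F j m i.
  apply/matrixP => i j; rewrite mul_diag_mx mxE mxE MTlift !mxE.
  have -> : u 0 (lift ord0 i) ^ e (lift ord_max j) =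
     u 0 (lift ord0 i) ^+ d j * u 0 (lift ord0 i) ^ e (lift ord0 j).
    by rewrite exprnP dE -expfzDr ?uT// subrK.
  rewrite -mulrBl -opprB subrXX !mulNr; congr (- _); rewrite -!mulrA; congr (_ * _).
  rewrite mulr_suml (big_ord_widen _ (fun m => u 0 ord0 ^+ ((d j).-1 - m) *
    u 0 (lift ord0 i) ^+ m * u 0 (lift ord0 i) ^ e (lift ord0 j)) (leq_bigmax j)).
  rewrite big_mkcond; apply: eq_bigr => m _; rewrite /F mxE; case: ifP => // _.
  by rewrite expfzDr ?uT// -mulrA [_ ^+ m * _]mulrC -exprnP.
rewrite det_mulmx det_diag det_sum_cols mulrA; congr (_ * _).
  rewrite (eq_bigr (fun i => -1 * (u 0 ord0 - u' 0 i))); last by move=> i _; rewrite !mxE mulN1r.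
  by rewrite big_split /= prodr_const card_ord mulrA -exprMn mulN1r opprK expr1n mul1r.
rewrite [RHS]big_mkcond /=; apply: eq_bigr => f _; case: ifP => [/forallP fd|/negbT].
  rewrite (_ : \matrix_(i, j) F j (f j) i = (\matrix_(i, j) u' 0 i ^ (e (lift ord0 j) + (f j)%:Z)) *m
     diag_mx (\row_j u 0 ord0 ^+ ((d j).-1 - f j))).
    by rewrite det_mulmx det_diag mulrC; congr (_ * _); apply: eq_bigr => j _; rewrite !mxE.
  by apply/matrixP => i j; rewrite mul_mx_diag !mxE /F fd mulrC mxE.
rewrite negb_forall => /existsP[j fj].
rewrite (expand_det_col _ j) big1// => i _.
by rewrite mxE /F (negPf fj) mul0r.
Qed.

Lemma vandermonde_recl (N : nat) (u : 'rV[C]_N.+1) :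
  let u' : 'rV[C]_N := \row_i u 0 (lift ord0 i) in
  vandermonde u = \prod_(i < N) (u 0 ord0 - u' 0 i) * vandermonde u'.
Proof.
move=> u'; rewrite /vandermonde big_ord_recl; congr (_ * _).
  by rewrite big_mkcond big_ord_recl /= mul1r; apply: eq_bigr => i _; rewrite mxE.
apply: eq_bigr => i _; rewrite big_mkcond big_ord_recl /= mul1r [RHS]big_mkcond /=.
by apply: eq_bigr => j _; rewrite !mxE.
Qed.

(* By the branching rule, eliminating one variable at a time. *)
Lemma alt_positive (N : nat) (e : 'I_N -> int) :
  (forall i j : 'I_N, (i < j)%N -> e j < e i) ->
  exists2 s : seq {ffun 'I_N -> int}, s != [::] &
    forall u, torus u -> alt e u = vandermonde u * \sum_(a <- s) mono a u.
Proof.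
elim: N e => [|N IH] e eD.
  exists [:: [ffun=> 0]] => // u _.
  by rewrite /alt det_mx00 /vandermonde big_ord0 mul1r big_seq1 /mono big_ord0.
pose d (j : 'I_N) := `|e (lift ord_max j) - e (lift ord0 j)|%N; pose D := \max_j d j.
have dE j : (d j)%:Z = e (lift ord_max j) - e (lift ord0 j).
  by rewrite /d gez0_abs// subr_ge0 ltW// eD// lift_max_lt0.
have d0 j : (0 < d j)%N.
  by rewrite -ltz_nat dE subr_gt0 eD// lift_max_lt0.
pose V := [pred f : {ffun 'I_N -> 'I_D} | [forall j, (f j < d j)%N]].
have /choice[s hs] : forall f : {ffun 'I_N -> 'I_D}, exists s : seq {ffun 'I_N -> int},
    V f -> s != [::] /\ forall u, torus u ->
      alt (fun j : 'I_N => e (lift ord0 j) + (f j)%:Z) u = vandermonde u * \sum_(a <- s) mono a u.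
  move=> f; case: (boolP (V f)) => [/forallP Vf|]; last by exists [::].
  have [|s s0 hs] := IH (fun j => e (lift ord0 j) + (f j)%:Z); last by exists s.
  move=> i j ij.
  have h1 : e (lift ord0 j) + (f j)%:Z < e (lift ord_max j).
    by rewrite addrC -ltrBrDr -dE ltz_nat.
  apply: lt_le_trans h1 _; apply: (@le_trans _ _ (e (lift ord0 i))); last by rewrite lerDl.
  have [->|ne] := eqVneq (lift ord_max j) (lift ord0 i); first by [].
  rewrite ltW// eD//= ; move/eqP: ne => ne.
  have bj : bump N j = j by rewrite /bump leqNgt ltn_ord.
  rewrite bj ltn_neqAle /bump /= add1n ij andbT; apply/eqP => E; apply: ne.
  by apply: val_inj; rewrite /= bj -E.
pose a0 (f : {ffun 'I_N -> 'I_D}) : int := e ord_max + (\sum_(j < N) ((d j).-1 - f j))%N%:Z.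
pose ext (f : {ffun 'I_N -> 'I_D}) (b : {ffun 'I_N -> int}) : {ffun 'I_N.+1 -> int} :=
  [ffun i => if unlift ord0 i is Some j then b j else a0 f].
exists (flatten [seq [seq ext f b | b <- s f] | f <- enum V]).
  (* The gaps [d j] are positive, so the zero choice [f0] is admissible and contributes at least one
     monomial. *)
  have D0 (j : 'I_N) : (0 < D)%N by rewrite (leq_trans (d0 j))// (leq_bigmax j).
  pose f0 : {ffun 'I_N -> 'I_D} := [ffun j => Ordinal (D0 j)].
  have Vf0 : V f0 by apply/forallP => j; rewrite ffunE.
  have [s0 _] := hs f0 Vf0.
  case E : (s f0) s0 => [//|b r] _; apply/eqP => h.
  have : ext f0 b \in flatten [seq [seq ext f b | b <- s f] | f <- enum V].
    apply/flattenP; exists [seq ext f0 b | b <- s f0].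
      by apply/mapP; exists f0; rewrite ?mem_enum.
    by rewrite E /= in_cons eqxx.
  by rewrite h.
move=> u uT; rewrite (alt_branch eD uT) -/d -/D.
set u' : 'rV[C]_N := \row_i _.
have u'T : torus u' by move=> i; rewrite mxE; apply: uT.
rewrite vandermonde_recl -/u' [X in X * _ = _]mulrC -!mulrA; congr (_ * _).
rewrite big_flatten big_map big_enum /= !mulr_sumr.
apply: eq_bigr => f Vf; have [_ hf] := hs f Vf.
rewrite (hf u' u'T) big_map [X in _ * X]mulrCA [LHS]mulrCA; congr (_ * _).
rewrite mulrA mulr_sumr.
apply: eq_bigr => b _; rewrite /mono big_ord_recl ffunE unlift_none.
rewrite /a0 expfzDr ?uT// -exprnP -prodrXr.
have -> : \prod_(i < N) u 0 (lift ord0 i) ^ ext f b (lift ord0 i) = \prod_(i < N) u' 0 i ^ b i.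
  by apply: eq_bigr => i _; rewrite !mxE ffunE liftK.
ring.
Qed.

End Branching.

(** * Schur functions: positivity, symmetry, product form *)

Section SchurFunctions.
Variable R : realType.
Local Notation C := (Cx R).

Lemma row_cvg (T : Type) (F : set_system T) {FF : Filter F} (N : nat) (v : T -> 'rV[C]_N)
  (u : 'rV[C]_N) : (forall i, (fun t => v t 0 i) @ F --> u 0 i) -> v @ F --> u.
Proof.
move=> vu A [P hP sPA].
have : \forall t \near F, forall i : 'I_N, P 0 i (v t 0 i).
  by apply: filter_forall => i; apply: vu; apply: hP.
apply: filterS => t h; apply: sPA => i j.
by rewrite (ord1 i).
Qed.

Lemma exprz_cvg (T : Type) (F : set_system T) {FF : Filter F} (f : T -> C) (a : C) (n : int) :
  a != 0 -> f @ F --> a -> (fun t => f t ^ n) @ F --> a ^ n.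
Proof.
move=> a0 fa.
have pos (k : nat) : (fun t => f t ^+ k) @ F --> a ^+ k.
  elim: k => [|k IH].
    rewrite (_ : (fun t => _) = cst 1); first by rewrite expr0; exact: cvg_cst.
    by apply/funext => t; rewrite expr0.
  rewrite (_ : (fun t => _) = (fun t => f t * f t ^+ k)).
    by rewrite exprS; apply: cvgM; [exact: fa|exact: IH].
  by apply/funext => t; rewrite exprS.
case: n => k; first exact: pos.
change ((fun t => (f t ^+ k.+1)^-1) @ F --> (a ^+ k.+1)^-1).
by apply: cvgV; [rewrite expf_neq0|exact: pos].
Qed.

Lemma complex_cvg_prod (T I : Type) (F : set_system T) {FF : Filter F} (s : seq I) (P : pred I)
  (f : I -> T -> C) (a : I -> C) : (forall i, P i -> f i @ F --> a i) ->
  (fun t => \prod_(i <- s | P i) f i t) @ F --> \prod_(i <- s | P i) a i.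
Proof.
move=> fa; elim: s => [|i s IH].
  rewrite big_nil (_ : (fun t => _) = cst 1); first exact: cvg_cst.
  by apply/funext => t; rewrite big_nil.
rewrite big_cons; case Pi : (P i).
  rewrite (_ : (fun t => _) = (fun t => f i t * \prod_(j <- s | P j) f j t)).
    by apply: cvgM; [exact: fa Pi|exact: IH].
  by apply/funext => t; rewrite big_cons Pi.
rewrite (_ : (fun t => _) = (fun t => \prod_(j <- s | P j) f j t))//.
by apply/funext => t; rewrite big_cons Pi.
Qed.

Definition monosum (N : nat) (s : seq {ffun 'I_N -> int}) (u : 'rV[C]_N) : C :=
  \sum_(a <- s) mono a u.

Lemma monosum_continuous (N : nat) (s : seq {ffun 'I_N -> int}) (k : 'I_N -> 'I_N)
  (u : 'rV[C]_N) : torus u ->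
  {for u, continuous (fun v : 'rV[C]_N => monosum s (\row_i v 0 (k i)))}.
Proof.
move=> uT; apply: (@complex_cvg_sum R _ _ (nbhs u) _) => a _.
apply: (@complex_cvg_prod _ _ (nbhs u) _) => i _.
rewrite (_ : (fun t => _) = (fun v : 'rV[C]_N => v 0 (k i) ^ a i)).
  by rewrite mxE; apply: (@exprz_cvg _ (nbhs u) _); [exact: uT|exact: coord_continuous].
by apply/funext => v; rewrite mxE.
Qed.

Lemma near_affine_neq0 (a d : C) : (a != 0) || (d != 0) ->
  \forall t \near (0 : C)^', a + t * d != 0.
Proof.
move=> ad; case: (eqVneq a 0) ad => [->|a0] /= ad.
  have : \forall t \near (0 : C)^', t != 0 by exact: nbhs_dnbhs_neq.
  by apply: filterS => t t0; rewrite add0r mulf_neq0.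
have [->|d0] := eqVneq d 0; first by apply: filterE => t; rewrite mulr0 addr0.
have e0 : 0 < `|a| / `|d| / 2 by rewrite !divr_gt0// normr_gt0.
have H : \forall t \near (0 : C)^', `|t| <= `|a| / `|d| / 2 by exact: dnbhs0_le.
apply: filterS H => t tle; apply/eqP => h.
have : `|a| <= `|a| / 2.
  have -> : `|a| / 2 = `|a| / `|d| / 2 * `|d|.
    by rewrite mulrAC divfK// normr_eq0.
  have E : `|a| = `|t| * `|d|.
    by rewrite -normrM -normrN; congr `|_|; apply/eqP; rewrite eq_sym -addr_eq0 addrC h.
  by rewrite [leLHS]E ler_wpM2r.
have a1 : 0 < `|a| by rewrite normr_gt0.
by move=> /le_lt_trans/(_ (halfC_lt a1)); rewrite ltxx.
Qed.

(** The line [u_i + t i] separates coinciding coordinates for every [t != 0], and for small [t] it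
    preserves what is already nonzero or distinct. *)
Lemma torus_dense (N : nat) (f g : 'rV[C]_N -> C) (u : 'rV[C]_N) : torus u ->
  {for u, continuous f} -> {for u, continuous g} ->
  (forall v, torus v -> distinct_coords v -> f v = g v) -> f u = g u.
Proof.
move=> uT fc gc fg; pose v (t : C) : 'rV[C]_N := \row_i (u 0 i + t * i%:R).
have vu : v @ (0 : C)^' --> u.
  apply: row_cvg => i.
  rewrite (_ : (fun t => _) = (fun t : C => u 0 i + t * i%:R)); last first.
    by apply/funext => t; rewrite mxE.
  rewrite -[X in _ --> X]addr0 -[X in _ --> _ + X](mul0r (i%:R : C)).
  apply: cvgD; first exact: cvg_cst.
  by apply: cvgM; [exact: nbhs_dnbhs|exact: cvg_cst].
have fv : (fun t => f (v t)) @ (0 : C)^' --> f u.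
  exact: (cvg_comp v f vu fc).
have gv : (fun t => g (v t)) @ (0 : C)^' --> g u.
  exact: (cvg_comp v g vu gc).
apply: (complex_cvg_unique fv).
suff E : {near (0 : C)^', (fun t => g (v t)) =1 (fun t => f (v t))}.
  exact: cvg_trans (near_eq_cvg E) gv.
have H1 : \forall t \near (0 : C)^', torus (v t).
  apply: filter_forall => i; rewrite /v.
  have : \forall t \near (0 : C)^', u 0 i + t * i%:R != 0.
    by apply: near_affine_neq0; rewrite uT.
  by apply: filterS => t; rewrite mxE.
have H2 : \forall t \near (0 : C)^', distinct_coords (v t).
  apply: filter_forall => i; apply: filter_forall => j.
  have [->|ij] := eqVneq i j; first by apply: filterE.
  have : \forall t \near (0 : C)^', (u 0 i - u 0 j) + t * (i%:R - j%:R) != 0.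
    apply: near_affine_neq0; apply/orP; right.
    by rewrite subr_eq0 eqr_nat.
  apply: filterS => t h _; rewrite !mxE -subr_eq0.
  by apply: contra_neq h => h; rewrite -[RHS]h; ring.
apply: filterS2 H1 H2 => t t1 t2.
by rewrite /= -fg.
Qed.

Lemma vandermonde_neq0 (N : nat) (u : 'rV[C]_N) : distinct_coords u -> vandermonde u != 0.
Proof.
move=> ud; apply/prodf_neq0 => i _; apply/prodf_neq0 => j ij.
by rewrite subr_eq0 ud// neq_ltn ij.
Qed.

Definition xexp (N : nat) (l : signature N) (j : 'I_N) : int := sgn_at l j + (N - j.+1)%:Z.

Lemma xexp_decr (N : nat) (l : signature N) (i j : 'I_N) : (i < j)%N -> xexp l j < xexp l i.
Proof.
move=> ij; rewrite /xexp ler_ltD//.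
  by have /forallP/(_ i)/forallP/(_ j) := valP l; rewrite (ltnW ij).
by rewrite ltz_nat; have := ltn_ord j; lia.
Qed.

(** The choice operator in [schur] is harmless: a sum of Laurent monomials satisfies [is_schur], and
    by density it is the only solution on the torus. *)
Lemma schur_mono (N : nat) (l : signature N) : exists2 s : seq {ffun 'I_N -> int}, s != [::] &
  forall u, torus u -> schur l u = monosum s u /\ alternant l u = vandermonde u * monosum s u.
Proof.
have [s s0 hs] := alt_positive R (@xexp_decr N l); exists s => // u uT.
have rid (v : 'rV[C]_N) : (\row_i v 0 (id i)) = v by apply/rowP => i; rewrite mxE.
have mc v : torus v -> {for v, continuous (monosum s)}.
  move=> vT; have := @monosum_continuous N s id v vT.
  by rewrite (_ : (fun v => _) = monosum s)//; apply/funext => w; rewrite rid.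
have P : exists f : 'rV[C]_N -> C, is_schur l f.
  exists (monosum s); split=> // v vT _; rewrite mulrC -hs//.
have [sc sv] := ClassicalEpsilon.epsilon_spec (inhabits (fun _ : 'rV[C]_N => 0 : C)) _ P.
split; last exact: hs.
apply: (torus_dense uT (sc u uT) (mc u uT)) => v vT vd.
apply: (mulIf (vandermonde_neq0 vd)); rewrite sv// mulrC -hs//.
Qed.

Lemma schur_vandermonde (N : nat) (l : signature N) (u : 'rV[C]_N) : torus u ->
  schur l u * vandermonde u = alternant l u.
Proof. by have [s _ h] := schur_mono l; move=> /h[-> ->]; rewrite mulrC. Qed.

Lemma vandermonde_det (N : nat) : exists c : C, forall u : 'rV[C]_N,
  vandermonde u = c * \det (Vandermonde N u).
Proof.
exists (\prod_(i < N) \prod_(j < N | (i < j)%N) -1) => u.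
rewrite det_Vandermonde /vandermonde -big_split /=; apply: eq_bigr => i _.
by rewrite -big_split /=; apply: eq_bigr => j _; rewrite mulN1r opprB.
Qed.

(** Alternant and Vandermonde product change by the same sign; density extends the equality to
    coinciding coordinates. *)
Lemma schur_sym (N : nat) (l : signature N) (s : 'S_N) (u : 'rV[C]_N) : torus u ->
  schur l (\row_i u 0 (s i)) = schur l u.
Proof.
move=> uT; have [m _ hm] := schur_mono l; have [c hc] := vandermonde_det N.
have pT (v : 'rV[C]_N) : torus v -> torus (\row_i v 0 (s i)).
  by move=> vT i; rewrite mxE.
rewrite (hm _ uT).1 (hm _ (pT _ uT)).1.
have rid (v : 'rV[C]_N) : (\row_i v 0 (id i)) = v by apply/rowP => i; rewrite mxE.
have gc : {for u, continuous (monosum m)}.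
  have := @monosum_continuous N m id u uT.
  by rewrite (_ : (fun v => _) = monosum m)//; apply/funext => w; rewrite rid.
apply: (torus_dense uT (@monosum_continuous N m s u uT) gc) => v vT vd.
apply: (mulIf (vandermonde_neq0 vd)).
rewrite -[RHS]mulrC -(hm v vT).2.
have Vs : vandermonde (\row_i v 0 (s i)) = (-1) ^+ s * vandermonde v.
  rewrite !hc mulrCA; congr (_ * _).
  have -> : Vandermonde N (\row_i v 0 (s i)) = col_perm s (Vandermonde N v).
    by apply/matrixP => i j; rewrite !mxE.
  by rewrite col_permE det_mulmx det_perm odd_permV mulrC.
have As : alternant l (\row_i v 0 (s i)) = (-1) ^+ s * alternant l v.
  rewrite /alternant -det_perm -det_mulmx -row_permE; congr (\det _).
  by apply/matrixP => i j; rewrite !mxE.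
have := (hm _ (pT _ vT)).2; rewrite Vs As -mulrA => /(congr1 ( *%R ((-1) ^+ s))).
by rewrite !mulrA -!expr2 sqrr_sign !mul1r => ->; rewrite mulrC.
Qed.

(** Ryser's formula for the permanent. The inner sum over [T] of the auxiliary products detects
    whether [f] is surjective, equivalently injective; the product vanishes unless [T] contains the
    range of [f], and is the sign of [T] otherwise. *)
Lemma ryser (N : nat) (M : 'I_N -> 'I_N -> C) :
  \sum_(s : 'S_N) \prod_(b < N) M (s b) b =
  \sum_(T : {set 'I_N}) (\prod_(i < N) (if i \in T then 1 else -1)) *
     \prod_(b < N) \sum_(a in T) M a b.
Proof.
transitivity (\sum_(f : {ffun 'I_N -> 'I_N}) (\sum_(T : {set 'I_N})
   \prod_(i < N) (if i \in T then 1 else if i \in codom f then 0 else -1)) *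
   \prod_(b < N) M (f b) b).
  have E (f : {ffun 'I_N -> 'I_N}) : \sum_(T : {set 'I_N})
      \prod_(i < N) (if i \in T then 1 else if i \in codom f then 0 else -1) =
      (injectiveb f)%:R :> C.
    transitivity (\prod_(i < N) (1 + if i \in codom f then 0 else -1 : C)).
      by rewrite bigA_distr; apply: eq_bigl => T; rewrite inE.
    case: (boolP (injectiveb f)) => [/injectiveP inj|ninj] /=.
      apply: big1 => i _; rewrite ifT ?addr0//.
      by have [g _ fg] := injF_bij inj; rewrite -(fg i) codom_f.
    have [i ni] : exists i, i \notin codom f.
      apply/existsP; apply: contraNT ninj; rewrite negb_exists => /forallP h.
      rewrite /injectiveb /dinjectiveb; apply/card_uniqP; rewrite size_map -cardE.
      by apply/eq_card => i; have := h i; rewrite negbK => ->.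
    by rewrite (bigD1 i) //= (negPf ni) subrr mul0r.
  rewrite (bigID (fun f : {ffun 'I_N -> 'I_N} => injectiveb f)) /= [X in _ + X]big1 ?addr0.
    rewrite (reindex (@pval _)) /=; last first.
      pose in_Sn := insubd (1%g : 'S_N).
      by exists in_Sn => /= f Uf; first apply: val_inj; apply: insubdK.
    apply: eq_big => /= [s | s _]; first by rewrite (valP s).
    by rewrite E (valP s) mul1r; apply: eq_bigr => b _; rewrite pvalE.
  by move=> f nf; rewrite E (negPf nf) mul0r.
transitivity (\sum_(f : {ffun 'I_N -> 'I_N}) \sum_(T : {set 'I_N})
   (\prod_(i < N) (if i \in T then 1 else if i \in codom f then 0 else -1)) *
   \prod_(b < N) M (f b) b).
  by apply: eq_bigr => f _; rewrite mulr_suml.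
rewrite exchange_big; apply: eq_bigr => T _ /=.
rewrite bigA_distr_big mulr_sumr [RHS]big_mkcond /=; apply: eq_bigr => f _.
case: ffun_onP => [fT|nfT]; congr (_ * _) || idtac.
  apply: eq_bigr => i _; case: ifP => // iT; rewrite ifF//.
  by apply/negP => /codomP[b ib]; rewrite ib fT in iT.
have [b fb] : exists b, f b \notin T.
  apply/existsP; rewrite -[X in is_true X]negbK; apply/negP => h; apply: nfT => b.
  by move: h; rewrite negb_exists => /forallP/(_ b); rewrite negbK.
by rewrite (bigD1 (f b)) //= (negPf fb) codom_f mul0r mul0r.
Qed.

(* Polarisation: symmetrise the monomials and apply [ryser] to the resulting permanents. *)
Lemma schur_product_form (N : nat) (l : signature N) : (0 < N)%N ->
  exists2 L : seq (C * seq int), all (fun p => p.2 != [::]) L &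
    forall u, torus u -> schur l u =
      \sum_(p <- L) p.1 * \prod_(b < N) \sum_(k <- p.2) (u 0 b) ^ k.
Proof.
move=> N0; have [m _ hm] := schur_mono l.
pose cT (T : {set 'I_N}) : C := \prod_(i < N) (if i \in T then 1 else -1).
exists [seq (N`!%:R^-1 * cT T, [seq a i | i <- enum T]) |
   a : {ffun 'I_N -> int} <- m,
   T : {set 'I_N} <- [seq T : {set 'I_N} <- enum {: {set 'I_N}} | T != finset.set0]].
  apply/allP => p /allpairsP[[a T] /= [_ ]]; rewrite mem_filter => /andP[T0 _] -> /=.
  apply/eqP => /(congr1 size); rewrite size_map -cardE => /eqP; rewrite cards_eq0.
  by rewrite (negPf T0).
move=> u uT; have f0 : (N`!%:R : C) != 0 by rewrite pnatr_eq0 -lt0n fact_gt0.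
apply: (mulfI f0).
transitivity (\sum_(s : 'S_N) monosum m (\row_i u 0 (s i))).
  rewrite (eq_bigr (fun=> schur l u)); last first.
    move=> s _; rewrite -(schur_sym l s uT) (hm _ _).1//.
    by move=> i; rewrite mxE.
  by rewrite sumr_const card_Sn mulr_natl.
rewrite /monosum exchange_big big_allpairs_dep mulr_sumr /=.
rewrite big_seq [RHS]big_seq; apply: eq_bigr => a _.
transitivity (\sum_(s : 'S_N) \prod_(b < N) u 0 b ^ a (s b)).
  rewrite (reindex_inj invg_inj) /=; apply: eq_bigr => s _; rewrite /mono.
  rewrite (reindex_perm s); apply: eq_bigr => b _; rewrite mxE.
  by rewrite permK.
rewrite (ryser (fun i b => u 0 b ^ a i)) mulr_sumr big_filter big_enum_cond /=.
rewrite (bigID (fun T => T != finset.set0)) /= [X in _ + X]big1 ?addr0.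
  apply: eq_bigr => T _.
  rewrite !mulrA mulfV// mul1r; congr (_ * _); apply: eq_bigr => b _.
  by rewrite big_map big_enum.
move=> T; rewrite negbK => /eqP ->.
rewrite [X in _ * X](bigD1 (Ordinal N0)) //= [X in _ * (X * _)]big1 ?mul0r ?mulr0// => i.
by rewrite inE.
Qed.

End SchurFunctions.

(** * Lowest coefficients of determinants, and Vandermonde products *)

Section Determinants.
Variable R : realType.
Local Notation C := (Cx R).

Lemma cf_prod_low (r : C) (I : Type) (s : seq I) (f : I -> C -> C) (d : I -> nat) : 0 < r ->
  (forall i, hol r (f i)) -> (forall i k, (k < d i)%N -> cf (f i) k = 0) ->
  (forall k, (k < \sum_(i <- s) d i)%N -> cf (fun t => \prod_(i <- s) f i t) k = 0) /\
  cf (fun t => \prod_(i <- s) f i t) (\sum_(i <- s) d i) = \prod_(i <- s) cf (f i) (d i).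
Proof.
move=> r0 fA fd; elim: s => [|i s [IH1 IH2]].
  rewrite !big_nil; split=> //.
  by rewrite (cf_ext 0 r0 (g := fun=> 1)) ?cf_cst// => t _; rewrite big_nil.
have E k : cf (fun t => \prod_(j <- i :: s) f j t) k =
    cf (fun t => f i t * \prod_(j <- s) f j t) k.
  by apply: (cf_ext k r0) => t _; rewrite big_cons.
have [h1 h2] := cf_mul_low r0 (fA i) (@hol_prod R r _ s xpredT f r0 (fun j _ => fA j)) (fd i) IH1.
rewrite !big_cons; split=> [k hk|]; rewrite E; first exact: h1.
by rewrite h2 IH2.
Qed.

Lemma vandermonde_scale (N : nat) (t : C) (u : 'rV[C]_N) :
  vandermonde (t *: u) = t ^+ (\sum_(n < N) n) * vandermonde u.
Proof.
elim: N u => [|N IH] u.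
  by rewrite /vandermonde !big_ord0 expr0 mul1r.
rewrite !vandermonde_recl big_ord_recr /= exprD.
set u' : 'rV[C]_N := \row_i u 0 (lift ord0 i).
have -> : (\row_i (t *: u) 0 (lift ord0 i) : 'rV[C]_N) = t *: u'.
  by apply/rowP => i; rewrite !mxE.
rewrite IH.
have -> : \prod_(i < N) ((t *: u) 0 ord0 - (t *: u') 0 i) =
    t ^+ N * \prod_(i < N) (u 0 ord0 - u' 0 i).
  rewrite -[X in t ^+ X](card_ord N) -prodr_const -big_split /=.
  by apply: eq_bigr => i _; rewrite !mxE mulrBr.
ring.
Qed.

Lemma vandermonde_shift (N : nat) (u : 'rV[C]_N) (v : 'rV[C]_N) :
  (forall i, v 0 i = 1 + u 0 i) -> vandermonde v = vandermonde u.
Proof.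
move=> uv; apply: eq_bigr => i _; apply: eq_bigr => j _.
by rewrite !uv opprD addrACA subrr add0r.
Qed.

(** The factorisation of [(x^(n+1) - t^(n+1)) / (x - t)], obtained from [t = 1] by homogeneity;
    dividing by [t] forces [t = 0] to be treated apart. *)
Lemma prod_sub_roots (n : nat) (z x t : C) : n.+1.-primitive_root z ->
  \prod_(i < n) (x - t * z ^+ i.+1) = \sum_(i < n.+1) x ^+ i * t ^+ (n - i).
Proof.
move=> pz.
have P1 : \prod_(i < n) ('X - (z ^+ i.+1)%:P) = \sum_(i < n.+1) 'X^i :> {poly C}.
  apply: (mulfI (x := 'X - 1%:P)); first by rewrite polyXsubC_eq0.
  have := factor_Xn_sub_1 pz; rewrite big_mkord big_ord_recl expr0 => ->.
  by rewrite subrX1 polyC1.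
have ev y : \prod_(i < n) (y - z ^+ i.+1) = \sum_(i < n.+1) y ^+ i.
  have := congr1 (horner^~ y) P1; rewrite horner_prod horner_sum.
  under eq_bigr do rewrite hornerXsubC.
  by under [X in _ = X]eq_bigr do rewrite hornerXn.
have [->|t0] := eqVneq t 0.
  rewrite (bigD1 ord_max) //= subnn expr0 mulr1 [X in _ + X]big1 ?addr0.
    under eq_bigr do rewrite mul0r subr0.
    by rewrite prodr_const card_ord.
  move=> i im; rewrite expr0n subn_eq0 leqNgt ltn_neqAle -ltnS ltn_ord andbT.
  rewrite [(i != n :> nat)](_ : _ = true) ?mulr0//.
have -> : \prod_(i < n) (x - t * z ^+ i.+1) = t ^+ n * \prod_(i < n) (x / t - z ^+ i.+1).
  rewrite -[X in t ^+ X](card_ord n) -prodr_const -big_split /=.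
  by apply: eq_bigr => i _; rewrite mulrBr mulrCA mulfV// mulr1.
rewrite ev mulr_sumr; apply: eq_bigr => i _.
have ni : (i <= n)%N by rewrite -ltnS.
by rewrite expr_div_n -{1}(subnK ni) exprD mulrCA -mulrA mulfV ?expf_neq0// mulr1.
Qed.

Lemma hockey_stick (N m : nat) : (\sum_(i < N) 'C(i, m) = 'C(N, m.+1))%N.
Proof.
elim: N => [|N IH]; first by rewrite big_ord0 bin0n.
by rewrite big_ord_recr /= IH binS addnC.
Qed.

Definition zmx (N : nat) (z : C) : 'M[C]_N := \matrix_(c, n) z ^+ (c * n).

Lemma det_zmx_neq0 (N : nat) (z : C) : N.-primitive_root z -> \det (zmx N z) != 0.
Proof.
move=> pz; pose v : 'rV[C]_N := \row_c z ^+ c.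
have -> : zmx N z = (Vandermonde N v)^T by apply/matrixP => i j; rewrite !mxE -exprM.
rewrite det_tr det_Vandermonde; apply/prodf_neq0 => i _; apply/prodf_neq0 => j ij.
rewrite !mxE subr_eq0 (eq_prim_root_expr pz) !modn_small ?ltn_ord//.
by rewrite gtn_eqF.
Qed.

(** The inverse Fourier matrix [W] turns the rows into functions [H n] whose only coefficient below
    degree [N] is the n-th. The determinant thus starts in degree [0 + 1 + ... + (N - 1)], where
    each row contributes its lowest term. *)
Lemma cf_det_low (N : nat) (r z : C) (phi : 'I_N -> C -> C) : 0 < r -> N.-primitive_root z ->
  (forall a, hol r (phi a)) ->
  cf (fun t => \det (\matrix_(b < N, a < N) phi a (z ^+ b * t))) (\sum_(n < N) n) =
  \det (zmx N z) * \det (\matrix_(n < N, a < N) cf (phi a) n).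
Proof.
move=> r0 pz pA; have z1 := norm_primitive_root pz.
have Zu : zmx N z \in unitmx by rewrite unitmxE unitfE det_zmx_neq0.
pose W := invmx (zmx N z).
pose A t : 'M[C]_N := \matrix_(b, a) phi a (z ^+ b * t).
pose H (n a : 'I_N) (t : C) : C := \sum_(c < N) W n c * phi a (z ^+ c * t).
have nz (c : nat) : `|z ^+ c| = 1 by rewrite normrX z1 expr1n.
have pcA a (c : nat) : hol r (fun t => phi a (z ^+ c * t)) by apply: hol_scale.
have HA n a : hol r (H n a) by apply: hol_sum => c _; apply: holZ.
have cH n a (i : 'I_N) : cf (H n a) i = (n == i)%:R * cf (phi a) i.
  rewrite (cf_sum _ i r0); last by move=> c _; apply: holZ.
  transitivity (\sum_(c < N) W n c * zmx N z c i * cf (phi a) i).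
    apply: eq_bigr => c _; rewrite (cfZ _ _ r0 (pcA a c)) (cf_scale _ r0 (nz c) (pA a)).
    by rewrite mxE -exprM mulrA.
  rewrite -mulr_suml; congr (_ * _).
  by have := congr1 (fun M : 'M[C]_N => M n i) (mulVmx Zu); rewrite !mxE.
have AE t : \det (A t) = \det (zmx N z) * \det (\matrix_(n, a) H n a t).
  rewrite -det_mulmx; congr (\det _); rewrite -[LHS](mulKVmx Zu); congr (_ *m _).
  by apply/matrixP => n a; rewrite !mxE; apply: eq_bigr => c _; rewrite mxE.
rewrite (cf_ext _ r0 (fun t _ => AE t)).
have prodA (s : 'S_N) : hol r (fun t => \prod_(n < N) H n (s n) t).
  by apply: hol_prod.
have detA : hol r (fun t => \det (\matrix_(n < N, a < N) H n a t)).
  apply: (hol_ext (f := fun t => \sum_(s : 'S_N) (-1) ^+ s * \prod_(n < N) H n (s n) t)).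
    move=> t _; apply: eq_bigr => s _; congr (_ * _).
    by apply: eq_bigr => n _; rewrite mxE.
  by apply: hol_sum => s _; apply: holZ.
rewrite (cfZ _ _ r0 detA); congr (_ * _).
rewrite (cf_ext _ r0 (g := fun t => \sum_(s : 'S_N) (-1) ^+ s * \prod_(n < N) H n (s n) t)); last first.
  move=> t _; apply: eq_bigr => s _; congr (_ * _).
  by apply: eq_bigr => n _; rewrite mxE.
rewrite (cf_sum _ _ r0); last by move=> s _; apply: holZ.
apply: eq_bigr => s _; rewrite (cfZ _ _ r0 (prodA s)); congr (_ * _).
have low (n : 'I_N) (k : nat) : (k < n)%N -> cf (H n (s n)) k = 0.
  move=> kn; have kN := ltn_trans kn (ltn_ord n).
  have := cH n (s n) (Ordinal kN); rewrite /= => ->.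
  rewrite (_ : (n == Ordinal kN) = false) ?mul0r//.
  by apply/eqP => /(congr1 val) /= h; rewrite h ltnn in kn.
have [_ ->] := @cf_prod_low r _ (index_enum 'I_N) (fun n t => H n (s n) t) (fun n => n : nat) r0
  (fun n => HA n (s n)) low.
by apply: eq_bigr => n _; rewrite cH eqxx mul1r mxE.
Qed.

(** As a polynomial in its first argument [gbin] has degree [n], so the matrix is triangular times
    Vandermonde. Only [c != 0] matters: the constant cancels between numerator and denominator. *)
Lemma det_gbin (N : nat) : exists2 c : C, c != 0 & forall e : 'I_N -> C,
  \det (\matrix_(n < N, a < N) gbin (e a) n) =
  c * \prod_(i < N) \prod_(j < N | (i < j)%N) (e j - e i).
Proof.
pose P (n : nat) : {poly C} := n`!%:R^-1 *: \prod_(i < n) ('X - (i%:R)%:P).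
have f0 n : (n`!%:R : C) != 0 by rewrite pnatr_eq0 -lt0n fact_gt0.
have sP n : size (\prod_(i < n) ('X - (i%:R : C)%:P)) = n.+1.
  rewrite -(big_mkord xpredT (fun i => 'X - (i%:R : C)%:P)).
  by rewrite size_prod_XsubC size_iota subn0.
have mP n : \prod_(i < n) ('X - (i%:R : C)%:P) \is monic.
  exact: monic_prod_XsubC.
pose L : 'M[C]_N := \matrix_(n, i) (P n)`_i.
exists (\det L).
  rewrite det_trig; last first.
    apply/is_trig_mxP => n i ni; rewrite mxE coefZ nth_default ?mulr0//.
    by rewrite sP.
  apply/prodf_neq0 => n _; rewrite mxE coefZ mulf_neq0 ?invr_eq0//.
  have /monicP := mP n; rewrite /lead_coef sP /= => ->.
  exact: oner_neq0.
move=> e; pose v : 'rV[C]_N := \row_a e a.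
have -> : \prod_(i < N) \prod_(j < N | (i < j)%N) (e j - e i) = \det (Vandermonde N v).
  rewrite det_Vandermonde; apply: eq_bigr => i _; apply: eq_bigr => j _.
  by rewrite !mxE.
rewrite -det_mulmx; congr (\det _); apply/matrixP => n a; rewrite !mxE.
have -> : gbin (e a) n = (P n).[e a].
  rewrite hornerZ horner_prod mulrC; congr (_ / _).
  by apply: eq_bigr => i _; rewrite hornerXsubC.
have sz : (size (P n) <= N)%N.
  by apply: leq_trans (size_scale_leq _ _) _; rewrite sP.
by rewrite (horner_coef_wide _ sz); apply: eq_bigr => i _; rewrite !mxE.
Qed.

(** The source of the deformed weight. Only the pairs containing [a] change, and their quotient is
    the same whether [a] is the smaller or the larger index. *)
Lemma vandermonde_pull (N : nat) (x : 'I_N -> C) (a : 'I_N) (q : C) :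
  (forall i j, i != j -> x i != x j) ->
  let e b := x b - (if b == a then q else 0) in
  \prod_(i < N) \prod_(j < N | (i < j)%N) (e j - e i) =
  (\prod_(b < N | b != a) ((x a - x b - q) / (x a - x b))) *
  \prod_(i < N) \prod_(j < N | (i < j)%N) (x j - x i).
Proof.
move=> xd e; pose F (i j : 'I_N) := (e j - e i) / (x j - x i).
have FE (i j : 'I_N) : (i < j)%N -> e j - e i = F i j * (x j - x i).
  by move=> ij; rewrite /F divfK// subr_eq0 xd// neq_ltn ij orbT.
have -> : \prod_(i < N) \prod_(j < N | (i < j)%N) (e j - e i) =
   (\prod_(i < N) \prod_(j < N | (i < j)%N) F i j) *
   \prod_(i < N) \prod_(j < N | (i < j)%N) (x j - x i).
  rewrite -big_split /=; apply: eq_bigr => i _; rewrite -big_split /=.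
  by apply: eq_bigr => j ij; rewrite FE.
congr (_ * _).
have F1 i j : i != a -> j != a -> i != j -> F i j = 1.
  move=> ia ja ij; rewrite /F /e (negPf ia) (negPf ja) !subr0 divff//.
  by rewrite subr_eq0 xd// eq_sym.
have Fa j : j != a -> F a j = (x a - x j - q) / (x a - x j).
  move=> ja; rewrite /F /e eqxx (negPf ja) subr0 -opprB -[in x j - x a]opprB invrN mulrNN.
  by congr (_ / _); ring.
have Fb j : j != a -> F j a = (x a - x j - q) / (x a - x j).
  by move=> ja; rewrite /F /e eqxx (negPf ja) subr0; congr (_ / _); ring.
rewrite (bigD1 a) //=.
have -> : \prod_(j < N | (a < j)%N) F a j = \prod_(j < N | j != a) (if (a < j)%N then F a j else 1).
  rewrite [RHS]big_mkcond [LHS]big_mkcond /=; apply: eq_bigr => j _.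
  by case: (eqVneq j a) => [->|] //=; rewrite ltnn.
have -> : \prod_(i < N | i != a) \prod_(j < N | (i < j)%N) F i j =
    \prod_(i < N | i != a) (if (i < a)%N then F i a else 1).
  apply: eq_bigr => i ia; case: ifP => iga.
    rewrite (bigD1 a) //= big1 ?mulr1// => j /andP[ij ja].
    by rewrite F1// neq_ltn ij.
  apply: big1 => j ij; rewrite F1//; last by rewrite neq_ltn ij.
  by apply: contraFneq iga => <-.
rewrite -big_split /=; apply: eq_bigr => b ba.
have [ab|ba'|h] := ltngtP a b.
- by rewrite Fa// mulr1.
- by rewrite Fb// mul1r.
by case/eqP: ba; apply/val_inj.
Qed.

End Determinants.

(** * Rays through roots of unity, and the comparison of two rays *)

Section Rays.
Variable R : realType.
Local Notation C := (Cx R).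

(** The conclusion of [Cpow_hol] at a fixed radius, packaged as a section hypothesis. *)
Definition pow_disc (rp : C) : Prop := forall w : C,
  [/\ hol rp (fun z => Cpow (1 + z) w),
      forall n, cf (fun z => Cpow (1 + z) w) n = gbin w n,
      forall z v, `|z| < rp -> Cpow (1 + z) (w + v) = Cpow (1 + z) w * Cpow (1 + z) v,
      forall z (n : int), `|z| < rp -> Cpow (1 + z) n%:~R = (1 + z) ^ n &
      forall z, `|z| < rp / 2 -> dern 1 (fun z => Cpow (1 + z) w) z = w * Cpow (1 + z) (w - 1)].

(* The point [1 + ry K w t s] has the K moving coordinates [1 + t + s, 1 + t w, ..., 1 + t w^(K-1)]:
   at [s = 0] it is invariant, up to a permutation, under [t -> w t]. *)
Definition ry (K : nat) (w t s : C) (b : nat) : C :=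
  if (b < K)%N then (if b == 0%N then t + s else w ^+ b * t) else 0.

Definition rayv (N K : nat) (w t s : C) : 'rV[C]_N := \row_(b < N) (1 + ry K w t s b).

Lemma ext_ones_ray (N K : nat) (w t s : C) :
  ext_ones N (rayv K K w t s) = rayv N K w t s.
Proof.
apply/rowP => b; rewrite !mxE; case: insubP => [c _ cb|nb] /=.
  by rewrite mxE cb.
by rewrite /ry ifN// addr0.
Qed.

(** Invariance turns the coefficient [c] of [t^i] into [w^i c], and [w^i != 1]. *)
Lemma cf_inv (r w : C) (K : nat) (f : C -> C) (i : nat) : 0 < r -> K.-primitive_root w ->
  hol r f -> (forall t, `|t| < r -> f (w * t) = f t) -> ~~ (K %| i)%N -> cf f i = 0.
Proof.
move=> r0 pw fA fw Ki; have := cf_scale i r0 (norm_primitive_root pw) fA.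
rewrite (cf_ext i r0 fw) => /eqP; rewrite -subr_eq0 -{1}[cf f i]mul1r -mulrBl mulf_eq0.
case/orP => [|/eqP//]; rewrite subr_eq0 eq_sym -(prim_order_dvd pw).
by rewrite (negPf Ki).
Qed.

Lemma cf_cancel (r : C) (f g : C -> C) (K : nat) : 0 < r -> hol r f -> hol r g -> f 0 != 0 ->
  (forall i, (i < K)%N -> cf (fun z => f z * g z) i = 0) -> forall i, (i < K)%N -> cf g i = 0.
Proof.
move=> r0 fA gA f0 fg i; elim/ltn_ind: i => i IH iK.
have := fg i iK; rewrite (cfM i r0 fA gA) big_ord_recl subn0 big1 ?addr0.
  by rewrite (cf0 r0 fA) => /eqP; rewrite mulf_eq0 (negPf f0) => /eqP.
move=> j _; rewrite IH ?mulr0 ?lift0//; have := ltn_ord j; lia.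
Qed.

Lemma prod_rotate (K : nat) (w : C) (F : C -> C) : w ^+ K = 1 ->
  \prod_(b < K) F (w ^+ b.+1) = \prod_(b < K) F (w ^+ b).
Proof.
case: K => [|K] wK; first by rewrite !big_ord0.
by rewrite big_ord_recr big_ord_recl /= wK expr0 mulrC.
Qed.

Definition rest (K : nat) (w : C) (h : C -> C) (t : C) : C := \prod_(b < K.-1) h (w ^+ b.+1 * t).

Lemma prod_ray (N K : nat) (w t s : C) (h : C -> C) : (0 < K)%N -> (K <= N)%N ->
  \prod_(b < N) h (ry K w t s b) = h (t + s) * (rest K w h t * h 0 ^+ (N - K)).
Proof.
case: K => // K _ /subnKC <-; move: (N - K.+1)%N => d.
rewrite addKn big_split_ord /= big_ord_recl -mulrA; congr (_ * (_ * _)).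
  by apply: eq_bigr => b _; rewrite /ry lift0 ltnS ltn_ord.
rewrite -[X in _ ^+ X](card_ord d) -prodr_const; apply: eq_bigr => b _.
by rewrite /ry ltnNge leq_addr.
Qed.

Lemma hol_rest (r w : C) (K : nat) (h : C -> C) : 0 < r -> `|w| = 1 -> hol r h -> hol r (rest K w h).
Proof.
move=> r0 w1 hA; apply: hol_prod => // b _; apply: hol_scale => //.
by rewrite normrX w1 expr1n.
Qed.

Lemma cf_full (r w : C) (K : nat) (h : C -> C) (i : nat) : 0 < r -> K.-primitive_root w ->
  hol r h -> (i < K)%N ->
  cf (fun t => h t * rest K w h t) i = if i == 0%N then h 0 ^+ K else 0.
Proof.
move=> r0 pw hA iK; have w1 := norm_primitive_root pw.
have K0 : (0 < K)%N by apply: leq_ltn_trans iK.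
have E t : h t * rest K w h t = \prod_(b < K) h (w ^+ b * t).
  by case: K K0 {pw iK} => // K _; rewrite big_ord_recl expr0 mul1r.
have fA := holM r0 hA (hol_rest K r0 w1 hA).
case: (posnP i) => [->|i0] /=.
  rewrite (cf0 r0 fA) E; under eq_bigr do rewrite mulr0.
  by rewrite prodr_const card_ord.
apply: (cf_inv r0 pw fA); last by rewrite gtnNdvd.
move=> t _; rewrite !E -(prod_rotate (fun x => h (x * t)) (prim_expr_order pw)).
by apply: eq_bigr => b _; rewrite exprSr mulrA.
Qed.

(** Multiplication by [h t] completes both sides to full products over roots of unity, which are
    rotation invariant and so agree with the constant [h 0 ^+ N] modulo [t^K]; as [h 0 != 0], the
    factor [h t] can be cancelled again. *)
Lemma rest_compare (r w z : C) (K N : nat) (h : C -> C) (i : nat) : 0 < r ->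
  K.-primitive_root w -> N.-primitive_root z -> (K <= N)%N -> hol r h -> h 0 != 0 -> (i < K)%N ->
  cf (fun t => rest K w h t * h 0 ^+ (N - K)) i = cf (rest N z h) i.
Proof.
move=> r0 pw pz KN hA h0 iK; have w1 := norm_primitive_root pw; have z1 := norm_primitive_root pz.
have aA : hol r (fun t => rest K w h t * h 0 ^+ (N - K)).
  by apply: holM => //; [exact: hol_rest|exact: hol_cst].
have bA := hol_rest N r0 z1 hA.
apply/eqP; rewrite -subr_eq0 -(cfB i r0 aA bA); apply/eqP.
apply: (cf_cancel r0 hA (holB r0 aA bA) h0 _ iK) => k kK.
rewrite (cf_ext k r0 (g := fun t => (h 0 ^+ (N - K) * (h t * rest K w h t)) - h t * rest N z h t)).
  rewrite (cfB k r0); [|by apply: holZ => //; apply: holM => //; exact: hol_rest|exact: holM].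
  rewrite (cfZ _ _ r0 (holM r0 hA (hol_rest K r0 w1 hA))) (cf_full r0 pw hA kK).
  rewrite (cf_full r0 pz hA (leq_trans kK KN)).
  by case: ifP => _; rewrite ?mulr0 ?subrr// -exprD subnK// subrr.
by move=> t _; ring.
Qed.

Lemma hol2_ry (r w : C) (K b : nat) (f : C -> C) : 0 < r -> `|w| = 1 -> hol (r + r) f ->
  hol2 r (fun t s => f (ry K w t s b)).
Proof.
move=> r0 w1 fA; have fA' : hol r f by apply: hol_sub fA; rewrite lerDl ltW.
rewrite /ry; case: (b < K)%N; last exact: hol2_cst.
case: (b == 0%N); first exact: hol2_add.
apply: (hol2_fst (f := fun t => f (w ^+ b * t))); apply: hol_scale => //.
by rewrite normrX w1 expr1n.
Qed.

Section Pow.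
Variables (rp r : C).
Hypotheses (rp0 : 0 < rp) (rp2 : rp <= 1 / 2) (rpP : pow_disc rp) (r0 : 0 < r) (rrp : r + r <= rp).

Lemma one_plus_neq0 (z : C) : `|z| < rp -> 1 + z != 0.
Proof.
move=> zr; apply/eqP => h; have : `|z| < 1.
  by apply: lt_le_trans zr _; apply: le_trans rp2 _; rewrite ltW// halfC_lt.
rewrite -normrN; have -> : - z = 1 by apply/eqP; rewrite eq_sym -subr_eq0 opprK h.
by rewrite normr1 ltxx.
Qed.

Lemma hol_powz (n : int) : hol rp (fun z => (1 + z) ^ n).
Proof. by have [gA _ _ gi _] := rpP n%:~R; apply: hol_ext gA => z zr; rewrite gi. Qed.

Lemma norm_ry (K b : nat) (w t s : C) : `|w| = 1 -> `|t| < r -> `|s| < r -> `|ry K w t s b| < rp.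
Proof.
move=> w1 tr sr; apply: lt_le_trans rrp; rewrite /ry; case: ifP => _; last by rewrite normr0 addr_gt0.
case: ifP => _; last by rewrite normrM normrX w1 expr1n mul1r ltr_wpDr// ltW.
by apply: le_lt_trans (ler_normD _ _) _; apply: ltrD.
Qed.

Lemma torus_ray (N K : nat) (w t s : C) : `|w| = 1 -> `|t| < r -> `|s| < r ->
  torus (rayv N K w t s).
Proof. by move=> w1 tr sr b; rewrite mxE one_plus_neq0// norm_ry. Qed.

Lemma hol2_schur_ray (N K : nat) (l : signature N) (w : C) : `|w| = 1 ->
  hol2 r (fun t s => schur l (rayv N K w t s)).
Proof.
move=> w1; have [m _ hm] := schur_mono R l.
apply: (hol2_ext (F := fun t s => monosum m (rayv N K w t s))).
  by move=> t s tr sr; rewrite (hm _ (torus_ray K w1 tr sr)).1.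
apply: hol2_sum => a _; apply: hol2_prod => // b _.
apply: (hol2_ext (F := fun t s => (1 + ry K w t s b) ^ a b)); first by move=> t s _ _; rewrite mxE.
apply: (@hol2_ry r w K b (fun z => (1 + z) ^ a b)) => //.
exact: hol_sub rrp (hol_powz _).
Qed.

(* On symmetric functions the rays through K-th and N-th roots of unity agree modulo [t^K]:
   only the first K - 1 elementary symmetric functions of the moving points matter. *)
Lemma schur_ray_compare (N K : nat) (l : signature N) (w z : C) (G : C -> C) (m i : nat) :
  K.-primitive_root w -> N.-primitive_root z -> (K <= N)%N -> (i < K)%N -> hol r G ->
  cf (fun t => G t * cf (fun s => schur l (rayv N K w t s)) m) i =
  cf (fun t => G t * cf (fun s => schur l (rayv N N z t s)) m) i.
Proof.
move=> pw pz KN iK GA; have w1 := norm_primitive_root pw; have z1 := norm_primitive_root pz.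
have K0 : (0 < K)%N by apply: leq_ltn_trans iK.
have N0 := leq_trans K0 KN.
have [L L0 hL] := schur_product_form R l N0.
pose h (E : seq int) (x : C) : C := \sum_(k <- E) (1 + x) ^ k.
have hA E : hol rp (h E) by apply: hol_sum => k _; exact: hol_powz.
have rp1 : r <= rp by apply: le_trans rrp; rewrite lerDl ltW.
have hA' E : hol r (h E) by apply: hol_sub (hA E).
have hA2 E : hol2 r (fun t s => h E (t + s)) by apply: hol2_add; apply: hol_sub rrp (hA E).
(* At the origin [h E] counts the elements of [E]; the cancellation in [rest_compare] needs it
   nonzero, which is why empty lists were excluded from the product form. *)
have h0 E : E != [::] -> h E 0 != 0.
  move=> E0; rewrite /h (eq_bigr (fun=> 1)) => [|k _]; last by rewrite addr0 exp1rz.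
  by rewrite big_const_seq count_predT iter_addr_0 pnatr_eq0 size_eq0.
pose T (K' : nat) w' (p : C * seq int) t :=
  rest K' w' (h p.2) t * h p.2 0 ^+ (N - K').
have form K' w' : (0 < K')%N -> (K' <= N)%N -> `|w'| = 1 -> forall t, `|t| < r ->
    cf (fun s => schur l (rayv N K' w' t s)) m =
    \sum_(p <- L) p.1 * (cf (fun s => h p.2 (t + s)) m * T K' w' p t).
  move=> K'0 K'N w'1 t tr.
  rewrite (cf_ext m r0 (g := fun s => \sum_(p <- L) (p.1 * T K' w' p t) * h p.2 (t + s))).
    rewrite (cf_sum _ m r0) => [|p _]; last by apply: holZ => //; apply: hol2_row (hA2 _) tr.
    apply: eq_bigr => p _; rewrite (cfZ _ _ r0 (hol2_row (hA2 _) tr)).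
    by rewrite mulrAC -mulrA.
  move=> s sr; rewrite (hL _ (torus_ray K' w'1 tr sr)); apply: eq_bigr => p _.
  rewrite -mulrA; congr (_ * _); rewrite mulrC -prod_ray//.
  by apply: eq_bigr => b _; rewrite /h; apply: eq_bigr => k _; rewrite mxE.
have cA (p : C * seq int) : hol r (fun t => cf (fun s => h p.2 (t + s)) m) by apply: hol2_cf.
have TA K' w' p : `|w'| = 1 -> hol r (T K' w' p).
  by move=> w'1; apply: holM => //; [exact: hol_rest|exact: hol_cst].
have fin K' w' : (0 < K')%N -> (K' <= N)%N -> `|w'| = 1 ->
    cf (fun t => G t * cf (fun s => schur l (rayv N K' w' t s)) m) i =
    \sum_(p <- L) p.1 * \sum_(j < i.+1)
       cf (fun t => G t * cf (fun s => h p.2 (t + s)) m) j * cf (T K' w' p) (i - j).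
  move=> K'0 K'N w'1.
  rewrite (cf_ext i r0 (g := fun t => \sum_(p <- L) p.1 *
     ((G t * cf (fun s => h p.2 (t + s)) m) * T K' w' p t))); last first.
    move=> t tr; rewrite (form _ _ K'0 K'N w'1 t tr) mulr_sumr; apply: eq_bigr => p _.
    by rewrite mulrCA !mulrA.
  rewrite (cf_sum _ i r0) => [|p _]; last first.
    by apply: holZ => //; apply: holM => //; [exact: holM|exact: TA].
  apply: eq_bigr => p _; rewrite (cfZ _ _ r0); last by apply: holM => //; [exact: holM|exact: TA].
  by congr (_ * _); rewrite (cfM i r0 (holM r0 GA (cA p)) (TA _ _ _ w'1)).
etransitivity; first exact: (fin K w K0 KN w1).
apply: esym; etransitivity; first exact: (fin N z N0 (leqnn _) z1).
apply: esym.
rewrite big_seq [RHS]big_seq; apply: eq_bigr => p pL; congr (_ * _).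
apply: eq_bigr => j _; congr (_ * _).
have jK : (i - j < K)%N by rewrite (leq_ltn_trans (leq_subr _ _)).
have p0 : p.2 != [::] by have /allP/(_ p pL) := L0.
rewrite (rest_compare r0 pw pz KN (hA' p.2) (h0 _ p0) jK).
by apply: (cf_ext _ r0) => t _; rewrite /T subnn expr0 mulr1.
Qed.

End Pow.
End Rays.

(** * The exact formula for the moments of a fixed signature *)

Section ExactFormula.
Variable R : realType.
Local Notation C := (Cx R).

Lemma gbin_add (w : C) (j i : nat) :
  'C(j + i, j)%:R * gbin w (j + i) = gbin w j * gbin (w - j%:R) i.
Proof.
rewrite /gbin big_split_ord /=.
have -> : \prod_(k < i) (w - (j + k)%:R) = \prod_(k < i) (w - j%:R - k%:R).
  by apply: eq_bigr => k _; rewrite natrD; ring.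
have hk : ((j + i)`!%:R : C) = 'C(j + i, j)%:R * j`!%:R * i`!%:R.
  by rewrite -!natrM -(bin_fact (leq_addr i j)) addKn mulnA.
have f0 m : (m`!%:R : C) != 0 by rewrite pnatr_eq0 -lt0n fact_gt0.
have c0 : ('C(j + i, j)%:R : C) != 0 by rewrite pnatr_eq0 -lt0n bin_gt0 leq_addr.
rewrite hk; move: (\prod_(k < j) _) (\prod_(k < i) _) => X Y; field.
by rewrite !f0 c0.
Qed.

Lemma cf_add_expn (t : C) (i j : nat) : cf (fun s => (t + s) ^+ i) j = 'C(i, j)%:R * t ^+ (i - j).
Proof.
rewrite (@cf_ext R 1 _ (horner (\poly_(k < i.+1) ('C(i, k)%:R * t ^+ (i - k))))) ?ltr01//.
  by rewrite cf_poly coef_poly ltnS; case: leqP => // ij; rewrite bin_small// mul0r.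
move=> s _; rewrite horner_poly exprDn; apply: eq_bigr => k _.
by rewrite -mulr_natl mulrA.
Qed.

(** The Vandermonde product of the moving coordinates other than the first, freed of its power of
    [t]; a nonzero constant that cancels in the end. *)
Definition kap (n : nat) (z : C) : C := vandermonde (\row_(i < n) z ^+ i.+1).

Lemma vandermonde_ray (n : nat) (z t s : C) : n.+1.-primitive_root z ->
  vandermonde (rayv n.+1 n.+1 z t s) =
  kap n z * t ^+ (\sum_(i < n) i) * \sum_(i < n.+1) (t + s) ^+ i * t ^+ (n - i).
Proof.
move=> pz; rewrite vandermonde_recl mulrC; congr (_ * _).
  rewrite mulrC -vandermonde_scale; apply: vandermonde_shift => i.
  by rewrite !mxE /ry lift0 ltnS ltn_ord /= mulrC.
rewrite -(prod_sub_roots _ _ pz); apply: eq_bigr => i _.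
rewrite !mxE /ry lift0 (ltnS i.+1) /= (ltn_ord i) [t * _]mulrC; ring.
Qed.

(** Each term of the geometric sum contributes ['C(i, j)] with the same power of [t]; the
    hockey-stick identity adds these up to the factor ['C(N, j + 1)] of the final formula. *)
Lemma cf_vandermonde_ray (n : nat) (z t : C) (j : nat) : n.+1.-primitive_root z ->
  cf (fun s => vandermonde (rayv n.+1 n.+1 z t s)) j =
  kap n z * t ^+ (\sum_(i < n) i) * ('C(n.+1, j.+1)%:R * t ^+ (n - j)).
Proof.
move=> pz; have A i : hol 1 (fun s : C => (t + s) ^+ i).
  by apply: holX => //; apply: holD; [exact: hol_cst|exact: hol_id].
rewrite (cf_ext j ltr01 (fun s _ => vandermonde_ray t s pz)).
have B i : hol 1 (fun s : C => (t + s) ^+ i * t ^+ (n - i)).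
  by apply: holM => //; exact: hol_cst.
rewrite (cfZ _ _ ltr01); last by apply: hol_sum => i _; exact: B.
congr (_ * _); rewrite (cf_sum _ j ltr01) => [|i _]; last exact: B.
rewrite -hockey_stick natr_sum mulr_suml; apply: eq_bigr => i _.
rewrite (cf_ext j ltr01 (g := fun s => t ^+ (n - i) * (t + s) ^+ i)); last by move=> s _; rewrite mulrC.
rewrite (cfZ _ _ ltr01 (A i)) cf_add_expn.
case: (ltnP i j) => ij; first by rewrite bin_small// !mul0r mulr0.
rewrite mulrCA -exprD; congr (_ * _ ^+ _); have := ltn_ord i; lia.
Qed.

Lemma det_row_repl (n : nat) (A : 'M[C]_n) (v : 'I_n -> C) (b : 'I_n) :
  \det (\matrix_(c, a) (if c == b then v a else A c a)) = \sum_a v a * cofactor A b a.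
Proof.
rewrite (expand_det_row _ b); apply: eq_bigr => a _; rewrite mxE eqxx; congr (_ * _).
rewrite /cofactor; congr (_ * \det _); apply/matrixP => i j; rewrite !mxE ifF//.
by rewrite eq_sym (negPf (neq_lift _ _)).
Qed.

Lemma det_col_repl (n : nat) (A : 'M[C]_n) (v : 'I_n -> C) (a : 'I_n) :
  \det (\matrix_(b, c) (if c == a then v b else A b c)) = \sum_b v b * cofactor A b a.
Proof.
rewrite (expand_det_col _ a); apply: eq_bigr => b _; rewrite mxE eqxx; congr (_ * _).
rewrite /cofactor; congr (_ * \det _); apply/matrixP => i j; rewrite !mxE ifF//.
by rewrite eq_sym (negPf (neq_lift _ _)).
Qed.

Lemma hol_det (r : C) (n : nat) (F : 'I_n -> 'I_n -> C -> C) : 0 < r ->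
  (forall i j, hol r (F i j)) -> hol r (fun t => \det (\matrix_(i, j) F i j t)).
Proof.
move=> r0 FA; apply: (hol_ext (f := fun t => \sum_(s : 'S_n) (-1) ^+ s * \prod_(i < n) F i (s i) t)).
  move=> t _; apply: eq_bigr => s _; congr (_ * _).
  by apply: eq_bigr => i _; rewrite mxE.
by apply: hol_sum => s _; apply: holZ => //; apply: hol_prod.
Qed.

Section Pow.
Variables (rp r : C).
Hypotheses (rp0 : 0 < rp) (rp2 : rp <= 1 / 2) (rpP : pow_disc rp) (r0 : 0 < r) (rrp : r + r <= rp).

Let r_rp : r <= rp. Proof. by apply: le_trans rrp; rewrite lerDl ltW. Qed.

Lemma dern_pow (w t : C) (j : nat) : `|t| <= rp / 2 / 4 ->
  dern j (fun z => Cpow (1 + z) w) t = gbin w j * Cpow (1 + t) (w - j%:R).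
Proof.
move=> tr; have [gA gc _ _ _] := rpP w; have [hA hc _ _ _] := rpP (w - j%:R).
have r2 := halfC_gt0 rp0; have hA' := hol_sub (ltW (halfC_lt rp0)) hA.
have dA := hol_dern j rp0 gA.
apply/eqP; rewrite -subr_eq0; apply/eqP.
apply: (@eq0_of_cf R (rp / 2) (fun t => dern j (fun z => Cpow (1 + z) w) t -
   gbin w j * Cpow (1 + t) (w - j%:R))) => //.
  by apply: holB => //; apply: holZ.
move=> i; rewrite (cfB i r2 dA (holZ _ r2 hA')) (cfZ _ _ r2 hA') hc (cf_dern j i rp0 gA) gc.
by rewrite gbin_add subrr.
Qed.

Section Fixed.
Variables (n : nat) (l : signature n.+1) (z q : C) (j : nat).
Hypothesis pz : n.+1.-primitive_root z.

Let N := n.+1.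
Let x (a : 'I_N) : C := (xexp l a)%:~R.
Let g (w t : C) : C := Cpow (1 + t) w.
Let DN := (\sum_(i < N) i)%N.
Let A (t : C) : 'M[C]_N := \matrix_(b, a) g (x a) (z ^+ b * t).
(** The j-th divided derivative of [(1 + t)^x] is [gbin x j (1 + t)^(x - j)]; the extra factor
    [(1 + t)^(j - q)] makes the exponent [x - q] for every [j]. The matrix [M b] below is [A] with
    row [b] replaced by these entries. *)
Let psi (b a : 'I_N) (t : C) : C := gbin (x a) j * g (x a - q) (z ^+ b * t).
Let M (b : 'I_N) (t : C) : 'M[C]_N := \matrix_(c, a) (if c == b then psi b a t else A t c a).

Let z1 : `|z| = 1. Proof. exact: norm_primitive_root pz. Qed.
Let zb1 (b : nat) : `|z ^+ b| = 1. Proof. by rewrite normrX z1 expr1n. Qed.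

Let gA w : hol r (g w). Proof. by have [h _ _ _ _] := rpP w; apply: hol_sub h. Qed.
Let gzA w (b : nat) : hol r (fun t => g w (z ^+ b * t)).
Proof. by apply: hol_scale; [exact: zb1|exact: gA]. Qed.

Let detMA b : hol r (fun t => \det (M b t)).
Proof.
apply: (@hol_det _ _ (fun c a t => if c == b then psi b a t else A t c a)) => // c a.
case: (c == b); first by apply: holZ => //; exact: gzA.
by apply: hol_ext (gzA (x a) c) => t _; rewrite mxE.
Qed.

Let cD b := cf (fun t => \det (M b t)) DN.

Let rho : 'S_N := perm (@ordS_inj N).

Let z_ordS (c : 'I_N) : z ^+ (ordS c) = z ^+ c.+1.
Proof. by rewrite /= (prim_expr_mod pz). Qed.

(** Rotating the rows of the Fourier matrix multiplies its k-th column by [z^k]; comparing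
    determinants gives the sign without a parity count. *)
Let sign_rho : (-1) ^+ rho = z ^+ DN.
Proof.
apply: (mulIf (det_zmx_neq0 pz)); rewrite -det_perm -det_mulmx -row_permE mulrC.
have -> : z ^+ DN = \det (diag_mx (\row_(k < N) z ^+ k)).
  by rewrite det_diag -prodrXr; apply: eq_bigr => k _; rewrite mxE.
rewrite -det_mulmx; congr (\det _); apply/matrixP => c k.
rewrite mul_mx_diag !mxE permE exprM z_ordS -exprM mulSn addnC exprD.
by [].
Qed.

(* Rotating [t] by [z] permutes the rows of the determinant cyclically. *)
Let cD_ordS b : cD (ordS b) = cD b.
Proof.
have E t : \det (M b (z * t)) = (-1) ^+ rho * \det (M (ordS b) t).
  rewrite -det_perm -det_mulmx -row_permE; congr (\det _); apply/matrixP => c a.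
  rewrite !mxE permE (inj_eq (@ordS_inj N)) /psi z_ordS exprSr mulrA.
  by case: ifP => // _; rewrite z_ordS exprSr mulrA.
have := cf_scale DN r0 z1 (detMA b).
rewrite (cf_ext DN r0 (fun t _ => E t)) (cfZ _ _ r0 (detMA _)) sign_rho.
by apply: mulfI; rewrite expf_neq0// -normr_gt0 z1.
Qed.

Let cD_all b : cD b = cD ord0.
Proof.
case: b; elim=> [|k IH] kN; first by congr cD; apply/val_inj.
rewrite -(IH (ltnW kN)) -[RHS]cD_ordS; congr cD; apply/val_inj => /=.
by rewrite modn_small.
Qed.

Let e (a b : 'I_N) : C := x b - (if b == a then q else 0).

(** Double counting: summing the row replacements over [b] and the column replacements over [a]
    gives the same double sum of entries times cofactors. Replacing column [a] just lowers the
    exponent [x a] by [q], to which [cf_det_low] applies. *)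
Let sum_cD : N%:R * cD ord0 =
  \sum_(a < N) gbin (x a) j * (\det (zmx N z) * \det (\matrix_(k < N, b < N) gbin (e a b) k)).
Proof.
have -> : N%:R * cD ord0 = \sum_(b < N) cD b.
  by rewrite (eq_bigr (fun=> cD ord0)) ?sumr_const ?card_ord ?mulr_natl.
rewrite /cD -(cf_sum _ DN r0) => [|b _]; last exact: detMA.
have E t : \sum_(b < N) \det (M b t) =
    \sum_(a < N) gbin (x a) j * \det (\matrix_(b < N, c < N) g (e a c) (z ^+ b * t)).
  rewrite (eq_bigr (fun b => \sum_(a < N) psi b a t * cofactor (A t) b a)); last first.
    by move=> b _; rewrite det_row_repl.
  rewrite exchange_big; apply: eq_bigr => a _ /=.
  rewrite (_ : \matrix_(b, c) _ = \matrix_(b, c) (if c == a then g (x a - q) (z ^+ b * t)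
     else A t b c)).
    by rewrite det_col_repl mulr_sumr; apply: eq_bigr => b _; rewrite mulrA.
  by apply/matrixP => b c; rewrite !mxE /e; case: eqP => [->//|_]; rewrite subr0.
rewrite (cf_ext DN r0 (fun t _ => E t)).
have DA a : hol r (fun t => \det (\matrix_(b < N, c < N) g (e a c) (z ^+ b * t))).
  by apply: (@hol_det _ _ (fun b c t => g (e a c) (z ^+ b * t))) => // b c; exact: gzA.
rewrite (cf_sum _ DN r0) => [|a _]; last exact: holZ.
apply: eq_bigr => a _; rewrite (cfZ _ _ r0 (DA a)); congr (_ * _).
rewrite (@cf_det_low R N r z (fun c => g (e a c)) r0 pz) => [|c]; last exact: gA.
congr (_ * \det _); apply/matrixP => k c; rewrite !mxE.
by have [_ -> _ _ _] := rpP (e a c).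
Qed.

Let rayE (t s : C) (b : 'I_N) : ry N z t s b = if b == ord0 then t + s else z ^+ b * t.
Proof. by rewrite /ry ltn_ord. Qed.

(** The normalisation: the same lowest coefficient for the undeformed alternant. At [s = 0] the
    Vandermonde product is [kap n z * N * t^DN], so what is left is the Schur function at
    [t = 0]. *)
Let schur_one : schur l (ones R N) * (N%:R * kap n z) =
  \det (zmx N z) * \det (\matrix_(k < N, b < N) gbin (x b) k).
Proof.
have r1 : 0 < r by [].
have E t : `|t| < r -> \det (\matrix_(b < N, a < N) g (x a) (z ^+ b * t)) =
    kap n z * N%:R * (t ^+ DN * schur l (rayv N N z t 0)).
  move=> tr; have s0 : `|0 : C| < r by rewrite normr0.
  have T := torus_ray rp2 r0 rrp (N := N) N z1 tr s0.
  transitivity (alternant l (rayv N N z t 0)).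
    congr (\det _); apply/matrixP => b a; rewrite !mxE rayE.
    have -> : (if b == ord0 then t + 0 else z ^+ b * t) = z ^+ b * t.
      by case: eqP => [->|//]; rewrite expr0 mul1r addr0.
    have [_ _ _ gi _] := rpP (x a); rewrite -gi//.
    by rewrite normrM zb1 mul1r (lt_le_trans tr).
  rewrite -(schur_vandermonde l T) (vandermonde_ray _ _ pz) addr0.
  have -> : \sum_(i < n.+1) t ^+ i * t ^+ (n - i) = N%:R * t ^+ n.
    rewrite (eq_bigr (fun=> t ^+ n)) ?sumr_const ?card_ord ?mulr_natl// => i _.
    by rewrite -exprD subnKC// -ltnS.
  by rewrite /DN /N big_ord_recr /= exprD; ring.
have sA : hol r (fun t => schur l (rayv N N z t 0)).
  apply: hol_ext (hol2_cf 0 r0 (hol2_schur_ray rp2 rpP r0 rrp N l z1)) => t tr.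
  by rewrite (cf0 r0 (hol2_row (hol2_schur_ray rp2 rpP r0 rrp N l z1) tr)).
have tA : hol r (fun t => t ^+ DN * schur l (rayv N N z t 0)).
  by apply: holM => //; apply: holX => //; exact: hol_id.
have := @cf_det_low R N r z (fun c => g (x c)) r0 pz (fun c => gA (x c)).
rewrite (cf_ext DN r0 E) (cfZ _ _ r0 tA) (cf_mulXn _ _ r0 sA) leqnn subnn (cf0 r0 sA).
have -> : rayv N N z 0 0 = ones R N.
  by apply/rowP => b; rewrite !mxE rayE addr0 mulr0 if_same addr0.
rewrite mulrC [kap n z * _]mulrC => ->.
congr (_ * \det _); apply/matrixP => k c; rewrite !mxE.
by have [_ -> _ _ _] := rpP (x c).
Qed.

(** Along the ray [s] enters only the first row, so replacing that row amounts to taking the [s^j]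
    coefficient of the alternant. Writing the alternant as Vandermonde product times Schur function,
    the Leibniz rule gives the sum over [m], and the power of [t] in the first factor leaves degree
    [m] for the second. *)
Let cD_ord0 : cD ord0 = kap n z * \sum_(m < j.+1) 'C(N, m.+1)%:R *
  cf (fun t => g (j%:R - q) t * cf (fun s => schur l (rayv N N z t s)) (j - m)) m.
Proof.
have [|r' [r'0 r'r r'8]] := lt_minC r0 (_ : 0 < rp / 2 / 4); first by rewrite !divr_gt0.
have SA := hol2_schur_ray rp2 rpP r0 rrp N l z1.
have vA t : hol r (fun s => vandermonde (rayv N N z t s)).
  apply: (hol_ext (f := fun s => kap n z * t ^+ (\sum_(i < n) i) *
     \sum_(i < n.+1) (t + s) ^+ i * t ^+ (n - i))).
    by move=> s _; rewrite (vandermonde_ray _ _ pz).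
  apply: holZ => //; apply: hol_sum => i _; apply: holM => //; last exact: hol_cst.
  by apply: holX => //; apply: holD; [exact: hol_cst|exact: hol_id].
have E t : `|t| < r' -> \det (M ord0 t) = kap n z * \sum_(m < j.+1) 'C(N, m.+1)%:R *
   (t ^+ (\sum_(i < n) i + (n - m)) *
    (g (j%:R - q) t * cf (fun s => schur l (rayv N N z t s)) (j - m))).
  move=> tr'; have tr : `|t| < r by apply: lt_le_trans r'r.
  have trp : `|t| < rp by apply: lt_le_trans r_rp.
  have al : cf (fun s => alternant l (rayv N N z t s)) j =
     \sum_(a < N) gbin (x a) j * g (x a - j%:R) t * cofactor (A t) ord0 a.
    rewrite (cf_ext j r0 (g := fun s => \sum_(a < N) cofactor (A t) ord0 a * (1 + (t + s)) ^ xexp l a)).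
      have PA a : hol r (fun s => (1 + (t + s)) ^ xexp l a).
        apply: (hol_shift (a := t) (f := fun y => (1 + y) ^ xexp l a) (r := rp)).
          by apply: le_trans rrp; rewrite lerD2r ltW.
        exact: hol_powz.
      rewrite (cf_sum _ j r0) => [|a _]; last exact: holZ.
      apply: eq_bigr => a _; rewrite (cfZ _ _ r0 (PA a)) mulrC; congr (_ * _).
      rewrite -(dern_pow (x a) j (t := t)); last by rewrite ltW// (lt_le_trans tr').
      apply: (cf_ext j r0) => s sr; have [_ _ _ gi _] := rpP (x a); rewrite -gi//.
      by apply: le_lt_trans (ler_normD _ _) _; apply: lt_le_trans rrp; apply: ltrD.
    move=> s sr; rewrite /alternant (expand_det_row _ ord0); apply: eq_bigr => a _.
    rewrite [LHS]mulrC; congr (_ * _); last by rewrite [LHS]mxE [X in X ^ _]mxE rayE eqxx.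
    rewrite /cofactor; congr (_ * \det _); apply/matrixP => b c; rewrite !mxE rayE.
    rewrite [lift ord0 b == _]eq_sym (negPf (neq_lift _ _)).
    have [_ _ _ gi _] := rpP 0; rewrite /g gi//.
    by rewrite normrM zb1 mul1r.
  have -> : \det (M ord0 t) = g (j%:R - q) t * cf (fun s => alternant l (rayv N N z t s)) j.
    rewrite al det_row_repl mulr_sumr; apply: eq_bigr => a _.
    rewrite /psi expr0 mul1r mulrA; congr (_ * _).
    rewrite mulrCA; congr (_ * _); rewrite /g.
    have [_ _ gD _ _] := rpP (j%:R - q); rewrite -gD//; congr Cpow.
    by ring.
  have -> : cf (fun s => alternant l (rayv N N z t s)) j = \sum_(m < j.+1)
     kap n z * t ^+ (\sum_(i < n) i) * ('C(N, m.+1)%:R * t ^+ (n - m)) *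
       cf (fun s => schur l (rayv N N z t s)) (j - m).
    rewrite (cf_ext j r0 (g := fun s => vandermonde (rayv N N z t s) * schur l (rayv N N z t s))).
      rewrite (cfM j r0 (vA t) (hol2_row SA tr)); apply: eq_bigr => m _.
      by rewrite cf_vandermonde_ray.
    by move=> s sr; rewrite mulrC (schur_vandermonde l (torus_ray rp2 r0 rrp (N := N) N z1 tr sr)).
  rewrite !mulr_sumr; apply: eq_bigr => m _; rewrite exprD; ring.
have TA m : hol r' (fun t => g (j%:R - q) t * cf (fun s => schur l (rayv N N z t s)) (j - m)).
  by apply: hol_sub r'r _; apply: holM => //; apply: hol2_cf.
have TA2 m : hol r' (fun t => t ^+ (\sum_(i < n) i + (n - m)) *
    (g (j%:R - q) t * cf (fun s => schur l (rayv N N z t s)) (j - m))).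
  by apply: holM => //; apply: holX => //; exact: hol_id.
rewrite /cD (cf_ext DN r'0 E) (cfZ _ _ r'0); last by apply: hol_sum => m _; exact: holZ.
congr (_ * _); rewrite (cf_sum _ DN r'0) => [|m _]; last exact: holZ.
apply: eq_bigr => m _; rewrite (cfZ _ _ r'0 (TA2 m)).
(* For [m > n] the truncated subtraction [n - m] would be wrong, but then the binomial coefficient
   vanishes. *)
case: (ltnP n m) => nm; first by rewrite bin_small ?mul0r// /N; lia.
congr (_ * _); rewrite (cf_mulXn _ _ r'0 (TA m)) /DN /N big_ord_recr /= leq_add2l leq_subr.
by congr cf; rewrite subnDl subKn.
Qed.

(** Comparing [sum_cD] with [schur_one], the Fourier determinant and the constant of [det_gbin]
    cancel; by [vandermonde_pull] the remaining ratio is the weight of [a]. *)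
Lemma pp_ray_formula_N :
  \sum_(m < j.+1) 'C(n.+1, m.+1)%:R *
    cf (fun t => Cpow (1 + t) (j%:R - q) *
          cf (fun s => schur l (rayv n.+1 n.+1 z t s)) (j - m)) m =
  schur l (ones R n.+1) * \sum_(a < n.+1) gbin (xexp l a)%:~R j *
    \prod_(b < n.+1 | b != a) (((xexp l a)%:~R - (xexp l b)%:~R - q) /
                               ((xexp l a)%:~R - (xexp l b)%:~R)).
Proof.
have k0 : N%:R * kap n z != 0.
  rewrite mulf_neq0 ?pnatr_eq0//; apply: vandermonde_neq0 => a b ab; rewrite !mxE.
  rewrite (eq_prim_root_expr pz) !modn_small ?ltnS//.
apply: (mulfI k0); rewrite -mulrA -cD_ord0 sum_cD.
rewrite [RHS]mulrA [_ * schur _ _]mulrC schur_one mulr_sumr; apply: eq_bigr => a _.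
have [c c0 hc] := det_gbin R N; rewrite !hc.
have xd b b' : b != b' -> x b != x b'.
  move=> bb; rewrite eqr_int; have [h|h|h] := ltngtP b b'.
  - by rewrite gt_eqF// xexp_decr.
  - by rewrite lt_eqF// xexp_decr.
  by case/eqP: bb; apply/val_inj.
rewrite (vandermonde_pull a q xd); ring.
Qed.

End Fixed.

(** Every coefficient on the left has degree [m <= j < K] in [t], so the ray of [K] may replace that
    of [N]. *)
Lemma pp_ray_formula (N K : nat) (l : signature N) (w q : C) (j : nat) :
  K.-primitive_root w -> (K <= N)%N -> (j < K)%N ->
  \sum_(m < j.+1) 'C(N, m.+1)%:R *
    cf (fun t => Cpow (1 + t) (j%:R - q) * cf (fun s => schur l (rayv N K w t s)) (j - m)) m =
  schur l (ones R N) * \sum_(a < N) gbin (xexp l a)%:~R j *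
    \prod_(b < N | b != a) (((xexp l a)%:~R - (xexp l b)%:~R - q) /
                            ((xexp l a)%:~R - (xexp l b)%:~R)).
Proof.
case: N l => [|n] l pw KN jK; first by have := prim_order_gt0 pw; lia.
have [z pz] := @primitive_root_exists R n.+1 isT.
etransitivity; last exact: (pp_ray_formula_N l q j pz).
have gA : hol r (fun t => Cpow (1 + t) (j%:R - q)).
  by have [h _ _ _ _] := rpP (j%:R - q); apply: hol_sub h.
apply: eq_bigr => m _; have mK : (m < K)%N by have := ltn_ord m; lia.
have E := @schur_ray_compare R rp r rp2 rpP r0 rrp _ _ l w z _ (j - m) m pw pz KN mK gA.
exact: (congr1 (fun X : C => 'C(n.+1, m.+1)%:R * X) E).
Qed.

End Pow.
End ExactFormula.

(** * From falling factorial moments to power moments *)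

Section Moments.
Variable R : realType.
Local Notation C := (Cx R).

(** The first degree [m] is that in [s], the second degree [n] that in [t]. *)
Definition cf2 (g : C -> C) (F : C -> C -> C) (m n : nat) : C :=
  cf (fun t => g t * cf (F t) m) n.

Lemma cf2E (r : C) (g : C -> C) (F : C -> C -> C) (m n : nat) : 0 < r -> hol r g -> hol2 r F ->
  cf2 g F m n = cf (fun t => cf (fun s => g t * F t s) m) n.
Proof.
move=> r0 gA FA; apply: (cf_ext n r0) => t tr.
by rewrite (cfZ _ _ r0 (hol2_row FA tr)).
Qed.

Lemma hol2_mulfst (r : C) (g : C -> C) (F : C -> C -> C) : 0 < r -> hol r g -> hol2 r F ->
  hol2 r (fun t s => g t * F t s).
Proof. by move=> r0 gA FA; apply: hol2M => //; exact: hol2_fst. Qed.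

Lemma cf2_sum (r : C) (I : Type) (s : seq I) (g : C -> C) (F : I -> C -> C -> C) (c : I -> C)
    (m n : nat) : 0 < r -> hol r g -> (forall i, hol2 r (F i)) ->
  cf2 g (fun t u => \sum_(i <- s) c i * F i t u) m n = \sum_(i <- s) c i * cf2 g (F i) m n.
Proof.
move=> r0 gA FA; have GA i : hol r (fun t => g t * cf (F i t) m).
  by apply: holM => //; exact: hol2_cf.
rewrite /cf2 (cf_ext n r0 (g := fun t => \sum_(i <- s) c i * (g t * cf (F i t) m))).
  rewrite (cf_sum _ n r0) => [|i _]; last exact: holZ.
  by apply: eq_bigr => i _; rewrite (cfZ _ _ r0 (GA i)).
move=> t tr; rewrite (cf_sum _ m r0) => [|i _]; last exact: holZ r0 (hol2_row (FA i) tr).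
rewrite mulr_sumr; apply: eq_bigr => i _.
by rewrite (cfZ _ _ r0 (hol2_row (FA i) tr)) mulrCA.
Qed.

Lemma cf2_cvg (r : C) (T : Type) (L : set_system T) (FF : ProperFilter L) (g : C -> C)
    (G : T -> C -> C -> C) (F : C -> C -> C) (m n : nat) : 0 < r -> hol r g ->
  (forall k, hol2 r (G k)) ->
  (forall e : C, 0 < e -> \forall k \near L, forall t s, `|t| < r -> `|s| < r ->
     `|F t s - G k t s| <= e) ->
  cf2 g (G k) m n @[k --> L] --> cf2 g F m n.
Proof.
move=> r0 gA GA FG; have FA := hol2_lim FF GA FG.
have [B B0 gB] := hol_bounded r0 gA.
rewrite (cf2E _ _ r0 gA FA).
rewrite (_ : (fun k => _) = (fun k => cf (fun t => cf (fun s => g t * G k t s) m) n)); last first.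
  by apply/funext => k; rewrite (cf2E _ _ r0 gA (GA k)).
apply: (@cf2_lim R r T L FF (fun k t s => g t * G k t s) (fun t s => g t * F t s)) => //.
  by move=> k; exact: hol2_mulfst.
move=> e e0; apply: filterS (FG (e / B) (divr_gt0 e0 B0)) => k h t s tr sr.
rewrite -mulrBr normrM -[leRHS](divfK (lt0r_neq0 B0)) mulrC.
by apply: ler_pM => //; [exact: h|exact: gB].
Qed.

Fixpoint stirling2 (k j : nat) : nat :=
  match k, j with
  | 0, 0 => 1
  | 0, _.+1 => 0
  | _.+1, 0 => 0
  | k'.+1, j'.+1 => stirling2 k' j' + j'.+1 * stirling2 k' j'.+1
  end.

Lemma stirling2_small (k j : nat) : (k < j)%N -> stirling2 k j = 0%N.
Proof.
elim: k j => [|k IH] [|j]//= kj; rewrite !IH ?muln0//; exact: ltnW.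
Qed.

Lemma stirling2_diag (k : nat) : stirling2 k k = 1%N.
Proof. by elim: k => //= k ->; rewrite stirling2_small// muln0. Qed.

(** The j-th falling factorial moment enters with the factor [N^-(k - j)], so only the diagonal and
    this subdiagonal reach order [1 / N]. *)
Lemma stirling2_subdiag (k : nat) : stirling2 k.+1 k = 'C(k.+1, 2).
Proof.
elim: k => // k IH.
by rewrite -[LHS]/(stirling2 k.+1 k + k.+1 * stirling2 k.+1 k.+1)%N IH stirling2_diag muln1 [RHS]binS bin1.
Qed.

Lemma expr_gbin (x : C) (k : nat) :
  x ^+ k = \sum_(j < k.+1) (stirling2 k j * j`!)%:R * gbin x j.
Proof.
elim: k => [|k IH]; first by rewrite big_ord1 expr0 gbin0 mulr1.
have xg j : x * gbin x j = j.+1%:R * gbin x j.+1 + j%:R * gbin x j by rewrite gbinS; ring.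
have -> : x ^+ k.+1 = \sum_(j < k.+1) (stirling2 k j * j.+1`!)%:R * gbin x j.+1 +
    \sum_(j < k.+1) (stirling2 k j * j`!)%:R * (j%:R * gbin x j).
  rewrite exprS IH mulr_sumr -big_split; apply: eq_bigr => j _ /=.
  by rewrite mulrCA xg factS !natrM; ring.
have -> : \sum_(j < k.+1) (stirling2 k j * j`!)%:R * (j%:R * gbin x j) =
    \sum_(j < k.+1) (j.+1 * stirling2 k j.+1 * j.+1`!)%:R * gbin x j.+1.
  rewrite big_ord_recl mul0r mulr0 add0r [RHS]big_ord_recr /= stirling2_small// muln0 mul0n mul0r addr0.
  by apply: eq_bigr => j _ /=; rewrite /bump /= add1n !natrM; ring.
rewrite [RHS]big_ord_recl mul0r add0r -big_split; apply: eq_bigr => j _.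
by rewrite lift0 /= -mulrDl -natrD -mulnDl.
Qed.

Lemma mPP_moment (N k : nat) (q : R) (l : signature N) :
  (atomic_integral (mPP q l) (fun t => t ^+ k))%:C%C =
  (N%:R ^+ k.+1)^-1 * \sum_(a < N) ((xexp l a)%:~R ^+ k *
    \prod_(b < N | b != a) (((xexp l a)%:~R - (xexp l b)%:~R - q%:C%C) /
                            ((xexp l a)%:~R - (xexp l b)%:~R))) :> C.
Proof.
rewrite /atomic_integral /mPP big_map big_enum /= rmorph_sum mulr_sumr.
apply: eq_bigr => a _; rewrite /= /pp_atom /pp_weight -/(xexp l a).
(* [shifted] and [xexp] differ by the constant [N - 1], and the weights depend on differences
   only. *)
have -> : \prod_(j < N | j != a) (((shifted l a - shifted l j)%:~R - q) / (shifted l a - shifted l j)%:~R)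
  = \prod_(j < N | j != a) (((xexp l a - xexp l j)%:~R - q) / (xexp l a - xexp l j)%:~R).
  apply: eq_bigr => b _; have -> : shifted l a - shifted l b = xexp l a - xexp l b; last by [].
  by rewrite /shifted /xexp; have := ltn_ord a; have := ltn_ord b; lia.
rewrite !rmorphM rmorph_prod rmorphXn rmorphM fmorphV rmorph_int rmorph_nat /=.
rewrite (eq_bigr (fun b => ((xexp l a)%:~R - (xexp l b)%:~R - q%:C%C) /
                            ((xexp l a)%:~R - (xexp l b)%:~R))).
  by rewrite exprMn exprS invfM exprVn; ring.
by move=> b _; rewrite !rmorphM rmorphB fmorphV rmorph_int /= intrB.
Qed.

Lemma pp_moment (rp r : C) (N K k : nat) (q : R) (l : signature N) (w : C) :
  0 < rp -> rp <= 1 / 2 -> pow_disc rp -> 0 < r -> r + r <= rp ->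
  K.-primitive_root w -> (K <= N)%N -> (k < K)%N ->
  schur l (ones R N) * (atomic_integral (mPP q l) (fun t => t ^+ k))%:C%C =
  (N%:R ^+ k.+1)^-1 * \sum_(j < k.+1) (stirling2 k j * j`!)%:R * \sum_(m < j.+1) 'C(N, m.+1)%:R *
    cf2 (fun t => Cpow (1 + t) (j%:R - q%:C%C)) (fun t s => schur l (rayv N K w t s)) (j - m) m.
Proof.
move=> rp0 rp2 rpP r0 rrp pw KN kK; rewrite mPP_moment mulrCA; congr (_ * _).
have E (j : 'I_k.+1) := @pp_ray_formula R rp r rp0 rp2 rpP r0 rrp N K l w q%:C%C j pw KN
  (leq_ltn_trans (leq_ord j) kK).
transitivity (\sum_(j < k.+1) (stirling2 k j * j`!)%:R * (schur l (ones R N) * \sum_(a < N)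
    gbin (xexp l a)%:~R j * \prod_(b < N | b != a)
      (((xexp l a)%:~R - (xexp l b)%:~R - q%:C%C) / ((xexp l a)%:~R - (xexp l b)%:~R)))); last first.
  by apply: eq_bigr => j _; exact: (congr1 (fun X : C => (stirling2 k j * j`!)%:R * X) (esym (E j))).
rewrite (eq_bigr (fun j : 'I_k.+1 => schur l (ones R N) * \sum_(a < N) ((stirling2 k j * j`!)%:R *
   gbin (xexp l a)%:~R j) * \prod_(b < N | b != a)
      (((xexp l a)%:~R - (xexp l b)%:~R - q%:C%C) / ((xexp l a)%:~R - (xexp l b)%:~R)))); last first.
  move=> j _; rewrite mulrCA; congr (_ * _); rewrite mulr_sumr.
  by apply: eq_bigr => a _; rewrite mulrA.
rewrite -mulr_sumr exchange_big; congr (_ * _); apply: eq_bigr => a _ /=.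
by rewrite -mulr_suml -expr_gbin.
Qed.

End Moments.

(** * Exchanging the expectation with Taylor coefficients *)

Section Expectation.
Variable R : realType.
Local Notation C := (Cx R).

(* The limit of a divergent net is the junk value [0]. *)
Lemma usum_cvg (I : choiceType) (x : I -> C) : usum x != 0 ->
  partial_sum x @ totally --> usum x.
Proof.
have [//|nc] := pselect (cvg (partial_sum x @ totally)).
by rewrite /usum (dvgP nc) => /eqP.
Qed.

Lemma partial_sum_diff (I : choiceType) (x : I -> C) (J J' : {fset I}) : (J `<=` J')%fset ->
  partial_sum x J' - partial_sum x J = \sum_(i <- J' | i \notin J) x i.
Proof.
move=> JJ; rewrite /partial_sum (bigID (fun i => i \in J)) /=.
rewrite (_ : \sum_(i <- J' | i \in J) x i = \sum_(i <- J) x i); first by rewrite addrAC subrr add0r.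
rewrite -big_filter; apply: perm_big; apply: uniq_perm.
- exact: filter_uniq.
- exact: fset_uniq.
by move=> i; rewrite mem_filter; case: (boolP (i \in J)) => //= iJ; exact: (fsubsetP JJ).
Qed.

(** The Weierstrass test for nets: the terms outside [J] are dominated by those of [D], so [J] can
    be chosen from [D] alone. *)
Lemma dominated_usum (I : choiceType) (T : Type) (P : T -> Prop) (x : T -> I -> C) (S : T -> C)
    (D : I -> C) (d : C) : (forall u i, P u -> `|x u i| <= D i) ->
  partial_sum D @ totally --> d -> (forall u, P u -> partial_sum (x u) @ totally --> S u) ->
  forall e : C, 0 < e -> \forall J \near totally, forall u, P u ->
    `|S u - partial_sum (x u) J| <= e.
Proof.
move=> xD Dd xS e e0.
have e2 := halfC_gt0 e0; have e4 := halfC_gt0 e2.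
have /cvgrPdist_le/(_ _ e4)[J0 _ h0] := Dd.
exists J0 => // J J0J u Pu; have /cvgrPdist_le/(_ _ e2)[J1 _ h1] := xS u Pu.
pose J' := (J `|` J1)%fset.
have JJ' : (J `<=` J')%fset by exact: fsubsetUl.
have -> : S u - partial_sum (x u) J = (S u - partial_sum (x u) J') +
   (partial_sum (x u) J' - partial_sum (x u) J) by ring.
rewrite (splitr e) (le_trans (ler_normD _ _))// lerD//; first by apply: h1; exact: fsubsetUr.
apply: (@le_trans _ _ `|partial_sum D J' - partial_sum D J|).
  rewrite !partial_sum_diff//; apply: le_trans (ler_norm_sum _ _ _) _.
  have D0 i : 0 <= D i by exact: le_trans (normr_ge0 _) (xD u i Pu).
  by rewrite ger0_norm ?sumr_ge0//; apply: ler_sum => i _; exact: xD.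
have -> : partial_sum D J' - partial_sum D J = (d - partial_sum D J) - (d - partial_sum D J') by ring.
rewrite (splitr (e / 2)) (le_trans (ler_normB _ _))// lerD//; apply: h0 => //=.
exact: fsubset_trans JJ'.
Qed.

(** The vertices of the real cube of radius [h] around 1 in the first [K] coordinates. By positivity
    they control the Schur functions on the whole complex neighborhood. *)
Definition corner (N K : nat) (h : C) (e : {ffun 'I_N -> bool}) : 'rV[C]_N :=
  \row_i (if (i < K)%N then (if e i then 1 + h else 1 - h) else 1).

Lemma corner_ext_ones (N K : nat) (KN : (K <= N)%N) (h : C) (e : {ffun 'I_N -> bool}) :
  corner K h e = ext_ones N (\row_(b < K) (if e (widen_ord KN b) then 1 + h else 1 - h)).
Proof.
apply/rowP => i; rewrite !mxE; case: insubP => [b iK bi|/negPf->//].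
by rewrite iK /= mxE; congr (if e _ then _ else _); apply/val_inj; rewrite /= bi.
Qed.

Lemma norm_exprz_le (z h : C) (n : int) : 0 <= h -> h < 1 -> 1 - h <= `|z| -> `|z| <= 1 + h ->
  `|z ^ n| <= (1 + h) ^ n + (1 - h) ^ n.
Proof.
move=> h0 h1 zl zu; have p : 0 < 1 - h by rewrite subr_gt0.
have p' : 0 < 1 + h by rewrite ltr_wpDr.
have z0 : 0 < `|z| by exact: lt_le_trans zl.
case: n => n.
  rewrite -!exprnP normrX ler_wpDr ?exprn_ge0 ?(ltW p)//.
  by rewrite lerXn2r// ?nnegrE ?(ltW p').
rewrite NegzE -!exprnN normfV normrX ler_wpDl ?invr_ge0 ?exprn_ge0 ?(ltW p')//.
by rewrite lef_pV2 ?posrE ?exprn_gt0// lerXn2r// ?nnegrE ?(ltW p).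
Qed.

Lemma schur_pos (N : nat) (l : signature N) (u : 'rV[C]_N) : (forall i, 0 < u 0 i) ->
  0 < schur l u.
Proof.
move=> u0; have [s s0 hs] := schur_mono R l.
have -> := (hs u _).1; last by move=> i; rewrite lt0r_neq0.
case: s s0 {hs} => [//|a s] _; rewrite /monosum big_cons ltr_pwDl//.
  by apply: prodr_gt0 => i _; rewrite exprz_gt0.
by apply: sumr_ge0 => b _; apply: prodr_ge0 => i _; rewrite exprz_ge0// ltW.
Qed.

(** The monomials have nonnegative coefficients. According to the sign of the exponent, a power is
    largest at [1 + h] or at [1 - h]; bounding it by the sum of both and expanding the product over
    the coordinates yields the sum over the corners. *)
Lemma schur_le_corners (N K : nat) (l : signature N) (h : C) (u : 'rV[C]_N) : 0 <= h -> h < 1 ->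
  (forall i : 'I_N, if (i < K)%N then (1 - h <= `|u 0 i|) && (`|u 0 i| <= 1 + h) else u 0 i == 1) ->
  `|schur l u| <= \sum_(e : {ffun 'I_N -> bool}) schur l (corner K h e).
Proof.
move=> h0 h1 hu; have p : 0 < 1 - h by rewrite subr_gt0.
have p' : 0 < 1 + h by rewrite ltr_wpDr.
have cT e : torus (@corner N K h e).
  by move=> i; rewrite mxE; case: ifP => _; rewrite ?oner_eq0//; case: ifP => _; rewrite lt0r_neq0.
have uT : torus u.
  move=> i; have := hu i; case: ifP => _; last by move/eqP->; rewrite oner_eq0.
  by case/andP => ul _; rewrite -normr_gt0 (lt_le_trans p).
have [s _ hs] := schur_mono R l; rewrite (hs u uT).1.
rewrite (eq_bigr (fun e => monosum s (corner K h e))) => [|e _]; last exact: (hs _ (cT e)).1.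
rewrite exchange_big; apply: le_trans (ler_norm_sum _ _ _) _; apply: ler_sum => a _ /=.
rewrite normr_prod.
pose c (i : 'I_N) (b : bool) : C := (if (i < K)%N then (if b then 1 + h else 1 - h) else 1) ^ a i.
have -> : \sum_(e : {ffun 'I_N -> bool}) mono a (corner K h e) =
    \prod_(i < N) \sum_(b : bool) c i b.
  rewrite bigA_distr_bigA; apply: eq_bigr => e _; apply: eq_bigr => i _.
  by rewrite mxE.
apply: ler_prod => i _; rewrite normr_ge0 /= big_bool /c; have := hu i.
case: ifP => _; first by case/andP => ul uu; exact: norm_exprz_le.
by move/eqP->; rewrite exp1rz normr1 lerDl ler01.
Qed.

Section Ray.
Variables (rp r : C) (N K k : nat) (q : R) (rho : signature N -> R) (w : C) (r' : R).
Hypotheses (rp0 : 0 < rp) (rp2 : rp <= 1 / 2) (rpP : pow_disc rp) (r0 : 0 < r) (rrp : r + r <= rp).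
Hypotheses (rr' : r + r < r'%:C%C) (rho0 : forall l, 0 <= rho l).
Hypothesis sgf0 : forall v : 'rV[C]_K, polydisc r' v -> sgf rho (ext_ones N v) != 0.
Hypotheses (pw : K.-primitive_root w) (KN : (K <= N)%N) (kK : (k < K)%N).

Let w1 : `|w| = 1. Proof. exact: norm_primitive_root pw. Qed.
Let coefl (l : signature N) : C := (rho l)%:C%C / schur l (ones R N).
Let term (l : signature N) (t s : C) : C := schur l (rayv N K w t s).

Let termA l : hol2 r (term l).
Proof. exact: (hol2_schur_ray rp2 rpP r0 rrp). Qed.

Let PJ (J : {fset signature N}) (t s : C) : C := partial_sum (sgf_term rho (rayv N K w t s)) J.

Let PJE J : PJ J = (fun t s => \sum_(l <- J) coefl l * term l t s).
Proof.
apply/funext => t; apply/funext => s; apply: eq_bigr => l _.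
by rewrite /sgf_term /coefl /term mulrAC mulrA.
Qed.

Let ones_gt0 l : 0 < schur l (ones R N).
Proof. by apply: schur_pos => i; rewrite mxE ltr01. Qed.

(** At each corner the series converges since its value is nonzero, a divergent one having value 0.
    The sum over the corners is a majorant on the whole ray, on a disc whose radius does not depend
    on [N]. *)
Let PJ_unif (e : C) : 0 < e -> \forall J \near totally, forall t s, `|t| < r -> `|s| < r ->
  `|sgf rho (rayv N K w t s) - PJ J t s| <= e.
Proof.
move=> e0; pose h := r + r.
have h0 : 0 <= h by rewrite ltW// addr_gt0.
have h1 : h < 1 by apply: le_lt_trans (halfC_lt ltr01); apply: le_trans rp2.
pose D l := \sum_(c : {ffun 'I_N -> bool}) sgf_term rho (corner K h c) l.
have cP c : partial_sum (sgf_term rho (corner K h c)) @ totally --> sgf rho (corner K h c).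
  apply: usum_cvg; rewrite -/(sgf _ _) (corner_ext_ones KN); apply: sgf0 => b; rewrite mxE.
  by case: ifP => _; rewrite addrAC subrr add0r ?normrN ger0_norm.
have DP : partial_sum D @ totally --> \sum_(c : {ffun 'I_N -> bool}) sgf rho (corner K h c).
  rewrite (_ : partial_sum D = fun J => \sum_(c : {ffun 'I_N -> bool})
     partial_sum (sgf_term rho (corner K h c)) J); last by apply/funext => J; exact: exchange_big.
  by apply: complex_cvg_sum => c _; exact: cP.
have ryP t s (b : nat) : `|t| < r -> `|s| < r -> `|ry K w t s b| < h.
  by move=> tr sr; exact: (norm_ry r0 (lexx h)).
have := @dominated_usum _ (C * C)%type (fun u => `|u.1| < r /\ `|u.2| < r)
  (fun u => sgf_term rho (rayv N K w u.1 u.2)) (fun u => sgf rho (rayv N K w u.1 u.2)) D _ _ DP _ e e0.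
move=> H; apply: filterS (H _ _) => [J hJ t s tr sr||].
- exact: (hJ (t, s)).
- move=> [t s] l [/= tr sr]; rewrite /sgf_term /D /sgf_term -mulr_sumr -mulr_suml !normrM normfV.
  rewrite norm_real_complex (ger0_norm (rho0 l)) (gtr0_norm (ones_gt0 l)) ler_wpM2l ?lecR//.
  rewrite ler_wpM2r ?invr_ge0 ?(ltW (ones_gt0 l))//.
  apply: schur_le_corners => // i; rewrite mxE; have := ryP t s i tr sr.
  case: ifP => iK; last by rewrite /ry iK addr0.
  move=> /ltW hy; apply/andP; split.
    rewrite lerBlDr -{1}(normr1 C) -{1}(addrK (ry K w t s i) 1).
    by apply: le_trans (ler_normB _ _) _; rewrite lerD2l.
  by apply: le_trans (ler_normD _ _) _; rewrite normr1 lerD2l.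
move=> [t s] [/= tr sr]; apply: usum_cvg; rewrite -/(sgf _ _) -ext_ones_ray; apply: sgf0 => b.
by rewrite mxE addrAC subrr add0r (lt_trans (ryP t s b tr sr)).
Qed.

Lemma hol2_sgf_ray : hol2 r (fun t s => sgf rho (rayv N K w t s)).
Proof.
apply: (hol2_lim (G := PJ) (totally_filter (I := signature N)) _ PJ_unif) => J; rewrite PJE.
by apply: hol2_sum => l _; exact: hol2Z.
Qed.

(** Finite partial sums satisfy the identity by linearity, and their right sides converge by
    [cf2_cvg]. This also proves that the series defining the expectation converges. *)
Lemma expect_ray :
  (expect rho (fun l => atomic_integral (mPP q l) (fun t => t ^+ k)))%:C%C =
  (N%:R ^+ k.+1)^-1 * \sum_(j < k.+1) (stirling2 k j * j`!)%:R * \sum_(m < j.+1) 'C(N, m.+1)%:R *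
    cf2 (fun t => Cpow (1 + t) (j%:R - q%:C%C)) (fun t s => sgf rho (rayv N K w t s)) (j - m) m.
Proof.
set X := RHS; pose g (j : nat) t : C := Cpow (1 + t) (j%:R - q%:C%C).
have r_rp : r <= rp by apply: le_trans rrp; rewrite lerDl ltW.
have gA j : hol r (g j) by have [h _ _ _ _] := rpP (j%:R - q%:C%C); apply: hol_sub h.
pose I (l : signature N) := atomic_integral (mPP q l) (fun t => t ^+ k).
have IE J : (partial_sum (fun l => rho l * I l) J)%:C%C = (N%:R ^+ k.+1)^-1 *
    \sum_(j < k.+1) (stirling2 k j * j`!)%:R * \sum_(m < j.+1) 'C(N, m.+1)%:R * cf2 (g j) (PJ J) (j - m) m :> C.
  rewrite /partial_sum rmorph_sum /=.
  rewrite (eq_bigr (fun l => coefl l * (schur l (ones R N) * (I l)%:C%C))); last first.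
    by move=> l _; rewrite rmorphM /coefl mulrA divfK// lt0r_neq0.
  rewrite (eq_bigr (fun l => (N%:R ^+ k.+1)^-1 * \sum_(j < k.+1) (stirling2 k j * j`!)%:R *
     \sum_(m < j.+1) 'C(N, m.+1)%:R * (coefl l * cf2 (g j) (term l) (j - m) m))).
    rewrite -mulr_sumr exchange_big; congr (_ * _); apply: eq_bigr => j _ /=.
    rewrite -mulr_sumr exchange_big; congr (_ * _); apply: eq_bigr => m _ /=.
    by rewrite -mulr_sumr PJE (cf2_sum _ _ _ _ r0 (gA j) termA).
  move=> l _; rewrite (pp_moment q l rp0 rp2 rpP r0 rrp pw KN kK) mulrCA; congr (_ * _).
  rewrite mulr_sumr; apply: eq_bigr => j _; rewrite mulrCA; congr (_ * _).
  by rewrite mulr_sumr; apply: eq_bigr => m _; rewrite mulrCA.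
have XL : (fun J => (partial_sum (fun l => rho l * I l) J)%:C%C : C) @ totally --> X.
  rewrite (_ : (fun J => _) = fun J => (N%:R ^+ k.+1)^-1 *
    \sum_(j < k.+1) (stirling2 k j * j`!)%:R * \sum_(m < j.+1) 'C(N, m.+1)%:R * cf2 (g j) (PJ J) (j - m) m).
    apply: cvgM; first exact: cvg_cst.
    apply: complex_cvg_sum => j _; apply: cvgM; first exact: cvg_cst.
    apply: complex_cvg_sum => m _; apply: cvgM; first exact: cvg_cst.
    apply: (@cf2_cvg R r _ _ (totally_filter (I := signature N)) (g j) PJ) => //.
      by move=> J; rewrite PJE; apply: hol2_sum => l _; exact: hol2Z.
  by apply/funext => J; exact: IE.
have XR : partial_sum (fun l => rho l * I l) @ totally --> complex.Re X by exact: complex_cvg_real XL.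
have -> : expect rho (fun l => atomic_integral (mPP q l) (fun t => t ^+ k)) = complex.Re X.
  exact: cvg_lim XR.
exact: complex_cvg_unique (cvg_real_complex _ XR) XL.
Qed.

End Ray.
End Expectation.

(** * First-order expansions in [1 / N] *)

Section FirstOrder.
Variable R : realType.
Local Notation C := (Cx R).

Lemma cvg_ext_ge (f g : nat -> C) (l : C) (n0 : nat) : (forall n, (n0 <= n)%N -> f n = g n) ->
  f @ \oo --> l -> g @ \oo --> l.
Proof.
move=> fg /cvgrPdist_le fl; apply/cvgrPdist_le => e e0; have [n1 _ h] := fl e e0.
exists (maxn n0 n1) => // n; rewrite /= geq_max => /andP[n0n n1n].
by rewrite -fg//; exact: h.
Qed.

Lemma natV_cvg0 : (fun N : nat => N%:R^-1 : C) @ \oo --> (0 : C).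
Proof.
apply/cvgrPdist_le => e e0; have [n0 h] := natSV_small e0.
exists n0.+1 => // -[//|n] /= nn; rewrite sub0r normrN ger0_norm ?invr_ge0//.
exact: h.
Qed.

(* [Y N = a + b / N + o(1 / N)] *)
Definition o1 (Y : nat -> C) (a b : C) : Prop := (fun N => N%:R * (Y N - a)) @ \oo --> b.

Lemma o1_ext (Y Z : nat -> C) (a b : C) (n0 : nat) : (forall n, (n0 <= n)%N -> Y n = Z n) ->
  o1 Y a b -> o1 Z a b.
Proof. by move=> YZ; apply: (@cvg_ext_ge _ _ _ n0) => n nn; rewrite YZ. Qed.

Lemma o1_cvg (Y : nat -> C) (a b : C) : o1 Y a b -> Y @ \oo --> a.
Proof.
move=> Yb; apply: (@cvg_ext_ge (fun N => a + (N%:R * (Y N - a)) * N%:R^-1) _ _ 1).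
  move=> n n0; have n1 : (n%:R : C) != 0 by rewrite pnatr_eq0 -lt0n.
  by field.
have h : (fun N => a + (N%:R * (Y N - a)) * N%:R^-1) @ \oo --> a + b * 0.
  by apply: cvgD; [exact: cvg_cst|apply: cvgM; [exact: Yb|exact: natV_cvg0]].
by move: h; rewrite mulr0 addr0.
Qed.

Lemma o1_cst (c : C) : o1 (fun=> c) c 0.
Proof.
apply: (@cvg_ext_ge (fun=> 0) _ _ 0) => [n _|]; first by rewrite subrr mulr0.
exact: cvg_cst.
Qed.

Lemma o1D (Y Z : nat -> C) (a b c d : C) : o1 Y a b -> o1 Z c d ->
  o1 (fun N => Y N + Z N) (a + c) (b + d).
Proof.
move=> Yb Zd; have h : (fun N => N%:R * (Y N - a) + N%:R * (Z N - c)) @ \oo --> b + d.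
  by apply: cvgD; [exact: Yb|exact: Zd].
by apply: (@cvg_ext_ge _ _ _ 0) h => n _; ring.
Qed.

Lemma o1M (Y Z : nat -> C) (a b c d : C) : o1 Y a b -> o1 Z c d ->
  o1 (fun N => Y N * Z N) (a * c) (b * c + a * d).
Proof.
move=> Yb Zd; have h : (fun N => N%:R * (Y N - a) * Z N + a * (N%:R * (Z N - c))) @ \oo --> b * c + a * d.
  apply: cvgD; apply: cvgM; [exact: Yb|exact: o1_cvg Zd|exact: cvg_cst|exact: Zd].
by apply: (@cvg_ext_ge _ _ _ 0) h => n _; ring.
Qed.

Lemma o1Z (Y : nat -> C) (a b c : C) : o1 Y a b -> o1 (fun N => c * Y N) (c * a) (c * b).
Proof.
by move=> Yb; have := o1M (o1_cst c) Yb; rewrite mul0r add0r.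
Qed.

Lemma o1_sum (I : Type) (s : seq I) (Y : I -> nat -> C) (a b : I -> C) :
  (forall i, o1 (Y i) (a i) (b i)) ->
  o1 (fun N => \sum_(i <- s) Y i N) (\sum_(i <- s) a i) (\sum_(i <- s) b i).
Proof.
move=> Yb; elim: s => [|i s IH].
  rewrite !big_nil; apply: (@o1_ext (fun=> 0) _ _ _ 0); last exact: o1_cst.
  by move=> n _; rewrite big_nil.
rewrite !big_cons; apply: (@o1_ext _ _ _ _ 0) (o1D (Yb i) IH).
by move=> n _; rewrite big_cons.
Qed.

Lemma o1_natV : o1 (fun N => N%:R^-1) 0 1.
Proof.
apply: (@cvg_ext_ge (fun=> 1) _ _ 1); last exact: cvg_cst.
by move=> n n0; rewrite subr0 divff// pnatr_eq0 -lt0n.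
Qed.

Lemma o1_natVX (i : nat) : o1 (fun N => N%:R ^- i) (i == 0%N)%:R (i == 1%N)%:R.
Proof.
elim: i => [|[|i] IH].
- by apply: (@o1_ext (fun=> 1) _ _ _ 0); [move=> n _; rewrite expr0 invr1|exact: o1_cst].
- by apply: (@o1_ext _ _ _ _ 0) o1_natV => n _; rewrite expr1.
have := o1M o1_natV IH; rewrite !mul0r mul1r addr0.
by apply: (@o1_ext _ _ _ _ 0) => n _; rewrite (exprS _ i.+1) invfM.
Qed.

(** Induction on [m], each step multiplying by [(1 - m / N) / (m + 1)]; the correction collects
    [0 + 1 + ... + (m - 1) = m (m - 1) / 2]. *)
Lemma o1_bin (m : nat) :
  o1 (fun N => 'C(N, m)%:R / N%:R ^+ m) m`!%:R^-1 (- ((m * m.-1)%:R / 2 / m`!%:R)).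
Proof.
elim: m => [|m IH].
  apply: (@o1_ext (fun=> 1) _ _ _ 0); first by move=> n _; rewrite bin0 divr1.
  by rewrite fact0 invr1 mul0n !mul0r oppr0; exact: o1_cst.
have m0 : (m.+1%:R : C) != 0 by rewrite pnatr_eq0.
have f0 : (m`!%:R : C) != 0 by rewrite pnatr_eq0 -lt0n fact_gt0.
have h : o1 (fun N => m.+1%:R^-1 * (1 + - m%:R * N%:R^-1)) (m.+1%:R^-1 * (1 + - m%:R * 0))
    (m.+1%:R^-1 * (0 + - m%:R * 1)).
  by apply: o1Z; apply: o1D; [exact: o1_cst|apply: o1Z; exact: o1_natV].
have := o1M IH h.
rewrite (_ : m`!%:R^-1 * _ = m.+1`!%:R^-1); last first.
  by rewrite factS natrM; field; rewrite f0 addrC natr1 m0.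
rewrite (_ : - _ * _ + _ = - ((m.+1 * m.+1.-1)%:R / 2 / m.+1`!%:R)); last first.
  rewrite factS !natrM /=; case: m {IH h} m0 f0 => [|m] m0 f0 /=.
    by rewrite fact0; field.
  rewrite -!natr1; field.
  by rewrite f0 !natr1.
apply: (@o1_ext _ _ _ _ 1) => n n0.
have n1 : (n%:R : C) != 0 by rewrite pnatr_eq0 -lt0n.
have b : m.+1%:R * 'C(n, m.+1)%:R = (n%:R - m%:R) * 'C(n, m)%:R :> C.
  case: (leqP m n) => mn; last by rewrite !bin_small ?mulr0// (ltn_trans mn).
  by rewrite -natrB// -!natrM -mul_bin_left.
apply: (mulfI m0); rewrite [m.+1%:R * (_ / _)]mulrA b exprS; field.
by rewrite n1 addrC natr1 m0 expf_neq0.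
Qed.

End FirstOrder.

(** * Splitting the generating function into main part and error *)

Section Factorization.
Variable R : realType.
Local Notation C := (Cx R).

Lemma cf_inv_mul (r w : C) (K : nat) (f h : C -> C) (n : nat) : 0 < r -> K.-primitive_root w ->
  hol r f -> hol r h -> (forall t, `|t| < r -> f (w * t) = f t) -> (n < K)%N ->
  cf (fun t => f t * h t) n = f 0 * cf h n.
Proof.
move=> r0 pw fA hA fw nK; rewrite (cfM n r0 fA hA) big_ord_recl subn0 (cf0 r0 fA).
rewrite big1 ?addr0// => i _; rewrite (cf_inv r0 pw fA fw) ?mul0r// gtnNdvd//.
by rewrite lift0; have := ltn_ord i; lia.
Qed.

Definition incr (H : C -> C) (t s : C) : C := H (t + s) - H t.

(* On the ray, [S = Cexp (incr H) * G * (1 + ray_rest)] with [G t = Cexp (sum_b H (w^b t))]. *)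
Definition ray_rest (K : nat) (w : C) (H : C -> C) (S : C -> C -> C) (t s : C) : C :=
  S t s * Cexp (- \sum_(b < K) H (ry K w t s b)) - 1.

Lemma sum_ray (K : nat) (w : C) (H : C -> C) (t s : C) : (0 < K)%N ->
  \sum_(b < K) H (ry K w t s b) = incr H t s + \sum_(b < K) H (w ^+ b * t).
Proof.
case: K => // K _; rewrite !big_ord_recl /= expr0 mul1r /incr.
rewrite (eq_bigr (fun b : 'I_K => H (w ^+ lift ord0 b * t))).
  by rewrite /ry /=; ring.
by move=> b _; rewrite /ry lift0 ltnS ltn_ord.
Qed.

Lemma hol_double (r : C) (H : C -> C) : 0 < r -> hol (r + r) H -> hol r H.
Proof. by move=> r0; apply: hol_sub; rewrite lerDl ltW. Qed.

Lemma hol2_incr (r : C) (H : C -> C) : 0 < r -> hol (r + r) H -> hol2 r (incr H).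
Proof.
by move=> r0 HA; apply: hol2B => //; [exact: hol2_add|apply: hol2_fst; exact: hol_double HA].
Qed.

Lemma cf_incr (r : C) (H : C -> C) (t : C) (j : nat) : 0 < r -> hol (r + r) H -> `|t| < r ->
  cf (incr H t) j.+1 = dern j.+1 H t.
Proof.
move=> r0 HA tr; have sA : hol r (fun s => H (t + s)) by apply: hol_shift HA; rewrite lerD2r ltW.
by rewrite (cfB j.+1 r0 sA (hol_cst r (H t))) cf_cst subr0.
Qed.

Lemma hol_dern_double (r : C) (H : C -> C) (j : nat) : 0 < r -> hol (r + r) H -> hol r (dern j H).
Proof.
by move=> r0 HA; rewrite (_ : r = (r + r) / 2); [apply: hol_dern => //; rewrite addr_gt0|field].
Qed.

Lemma hol2_ray_rest (r w : C) (K : nat) (H : C -> C) (S : C -> C -> C) : 0 < r -> `|w| = 1 ->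
  hol (r + r) H -> hol2 r S -> hol2 r (ray_rest K w H S).
Proof.
move=> r0 w1 HA SA; apply: hol2B => //; last exact: hol2_cst.
apply: hol2M => //; apply: hol2_exp => //; apply: hol2N => //; apply: hol2_sum => b _.
exact: hol2_ry.
Qed.

(** Since [incr H t 0 = 0], the part of [S / E] of degree 0 in [s] is exactly [S t 0]: invariant
    under rotation with value 1 at 0, it acts as 1 in degrees below [K]. The same argument reduces
    the factor [G t] of the other terms to [G 0]. Thus the error enters only through its
    coefficients of degree [p + 1 > 0] in [s]. *)
Lemma cf2_factor (r w : C) (K : nat) (H g : C -> C) (S : C -> C -> C) (M n : nat) : 0 < r ->
  K.-primitive_root w -> hol (r + r) H -> hol r g -> hol2 r S ->
  (forall t, `|t| < r -> S (w * t) 0 = S t 0) -> S 0 0 = 1 -> (n < K)%N ->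
  cf2 g S M n = cf2 g (fun t s => Cexp (incr H t s)) M n +
    \sum_(p < M) Cexp (K%:R * H 0) * \sum_(i < n.+1)
      cf2 g (fun t s => Cexp (incr H t s)) (M - p.+1) i *
      cf (fun t => cf (ray_rest K w H S t) p.+1) (n - i).
Proof.
move=> r0 pw HA gA SA Sw S1 nK; have w1 := norm_primitive_root pw.
have K0 := prim_order_gt0 pw; have HA' := hol_double r0 HA.
pose E t s := Cexp (incr H t s); pose D := ray_rest K w H S.
pose G t := Cexp (\sum_(b < K) H (w ^+ b * t)).
have EA : hol2 r E by apply: hol2_exp => //; exact: hol2_incr.
have DA : hol2 r D by exact: hol2_ray_rest.
have GA : hol r G.
  apply: hol_exp => //; apply: hol_sum => b _; apply: hol_scale => //.
  by rewrite normrX w1 expr1n.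
have SE t s : S t s = (G t + G t * D t s) * E t s.
  rewrite /D /ray_rest (sum_ray _ _ _ _ K0) CexpN CexpD -/(E t s) -/(G t).
  have := Cexp_neq0 (incr H t s); have := Cexp_neq0 (\sum_(b < K) H (w ^+ b * t)).
  rewrite -/(G t) -/(E t s) => G0 E0; field.
  by rewrite G0 E0.
have E1 t : E t 0 = 1 by rewrite /E /incr addr0 subrr Cexp0.
have sE t : `|t| < r -> g t * cf (S t) M = S t 0 * (g t * cf (E t) M) +
    \sum_(p < M) G t * ((g t * cf (E t) (M - p.+1)) * cf (D t) p.+1).
  move=> tr; have DtA := hol2_row DA tr; have EtA := hol2_row EA tr.
  have TA : hol r (fun s => G t + G t * D t s).
    by apply: holD; [exact: hol_cst|exact: holZ].
  have -> : cf (S t) M = \sum_(i < M.+1) cf (fun s => G t + G t * D t s) i * cf (E t) (M - i).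
    by rewrite -(cfM M r0 TA EtA); apply: (cf_ext M r0) => s _; rewrite SE.
  rewrite big_ord_recl subn0 (cf0 r0 TA) mulrDr; congr (_ + _).
    by rewrite SE E1 mulr1 mulrCA.
  rewrite mulr_sumr; apply: eq_bigr => p _; rewrite lift0.
  rewrite (cfD p.+1 r0 (hol_cst r (G t)) (holZ (G t) r0 DtA)) cf_cst add0r (cfZ _ _ r0 DtA).
  by ring.
have S0A : hol r (fun t => S t 0).
  by apply: hol_ext (hol2_cf 0 r0 SA) => t tr; rewrite (cf0 r0 (hol2_row SA tr)).
have gEA m : hol r (fun t => g t * cf (E t) m) by apply: holM => //; exact: hol2_cf.
have gDA m p : hol r (fun t => (g t * cf (E t) m) * cf (D t) p).
  by apply: holM => //; exact: hol2_cf.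
have -> : cf2 g S M n = cf (fun t => S t 0 * (g t * cf (E t) M) +
    \sum_(p < M) G t * ((g t * cf (E t) (M - p.+1)) * cf (D t) p.+1)) n.
  by apply: (cf_ext n r0) => t tr; exact: sE.
rewrite (cfD n r0); last 2 first.
- exact: holM.
- by apply: hol_sum => p _; apply: holM.
congr (_ + _); first by rewrite (cf_inv_mul r0 pw S0A (gEA M) Sw nK) S1 mul1r.
rewrite (cf_sum _ n r0) => [|p _]; last exact: holM.
apply: eq_bigr => p _; rewrite (cf_inv_mul r0 pw GA (gDA _ _)) => [||//].
  rewrite /G (_ : \sum_(b < K) H (w ^+ b * 0) = K%:R * H 0).
    by congr (_ * _); rewrite (cfM n r0 (gEA _) (hol2_cf _ r0 DA)).
  by rewrite (eq_bigr (fun=> H 0)) => [|b _]; rewrite ?mulr0// sumr_const card_ord mulr_natl.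
move=> t _; congr Cexp.
case: K pw K0 {nK D DA SE sE gDA G GA} => // K pw _.
rewrite [RHS]big_ord_recl [LHS]big_ord_recr /= expr0 mul1r addrC; congr (_ + _).
  by rewrite mulrA -exprSr (prim_expr_order pw) mul1r.
by apply: eq_bigr => b _; rewrite mulrA -exprSr.
Qed.

End Factorization.

(** * Expansion of the main part in powers of [N] *)

Section Expansion.
Variable R : realType.
Local Notation C := (Cx R).

Lemma cf2_exp (r : C) (g : C -> C) (F : C -> C -> C) (M n : nat) : 0 < r -> hol r g -> hol2 r F ->
  (forall t, F t 0 = 0) ->
  cf2 g (fun t s => Cexp (F t s)) M n =
  \sum_(l < M.+1) l`!%:R^-1 * cf2 g (fun t s => F t s ^+ l) M n.
Proof.
move=> r0 gA FA F0; have lA (l : nat) : hol r (fun t => g t * cf (fun s => F t s ^+ l) M).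
  by apply: holM => //; apply: (@hol2_cf R r (fun t s => F t s ^+ l)) => //; exact: hol2X.
transitivity (cf (fun t => \sum_(l < M.+1) l`!%:R^-1 * (g t * cf (fun s => F t s ^+ l) M)) n).
  apply: (cf_ext n r0) => t tr; rewrite (cf_exp M r0 (hol2_row FA tr) (F0 t)) mulr_sumr.
  by apply: eq_bigr => l _; rewrite [RHS]mulrC mulrA.
rewrite (cf_sum _ n r0) => [|l _]; last exact: holZ.
by apply: eq_bigr => l _; rewrite (cfZ _ _ r0 (lA l)).
Qed.

Section Asymptotics.
Variables (r : C) (g psi phi : C -> C).
Hypotheses (r0 : 0 < r) (gA : hol r g) (psiA : hol (r + r) psi) (phiA : hol (r + r) phi).

Let Hn (N : nat) (z : C) : C := N%:R * psi z + phi z.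

Let P := incr psi.
Let Q := incr phi.
Let PA : hol2 r P. Proof. exact: hol2_incr. Qed.
Let QA : hol2 r Q. Proof. exact: hol2_incr. Qed.
Let P0 t : P t 0 = 0. Proof. by rewrite /P /incr addr0 subrr. Qed.
Let Q0 t : Q t 0 = 0. Proof. by rewrite /Q /incr addr0 subrr. Qed.

Let mon (l i : nat) (t s : C) : C := Q t s ^+ (l - i) * P t s ^+ i.
Let monA l i : hol2 r (mon l i). Proof. by apply: hol2M => //; exact: hol2X. Qed.
Let coefE (M n l i : nat) : C := 'C(l, i)%:R / l`!%:R * cf2 g (mon l i) M n.

Lemma hol_Hn (N : nat) : hol (r + r) (fun z => N%:R * psi z + phi z).
Proof. by apply: holD => //; apply: holZ => //; rewrite addr_gt0. Qed.

(** A polynomial in [N] of degree at most [M]: the increments vanish at [s = 0], so no power [l > M]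
    reaches degree [M] in [s]. *)
Let cf2_E (N M n : nat) : cf2 g (fun t s => Cexp (incr (Hn N) t s)) M n =
  \sum_(l < M.+1) \sum_(i < l.+1) coefE M n l i * N%:R ^+ i.
Proof.
have FA : hol2 r (incr (Hn N)) by apply: hol2_incr => //; exact: hol_Hn.
rewrite (cf2_exp M n r0 gA FA); last by move=> t; rewrite /incr addr0 subrr.
apply: eq_bigr => l _.
have -> : (fun t s => incr (Hn N) t s ^+ l) =
    (fun t s => \sum_(i < l.+1) ('C(l, i)%:R * N%:R ^+ i) * mon l i t s).
  apply/funext => t; apply/funext => s.
  rewrite (_ : incr (Hn N) t s = Q t s + N%:R * P t s); last by rewrite /incr /Hn /Q /P /incr; ring.
  rewrite exprDn; apply: eq_bigr => i _; rewrite exprMn /mon -mulr_natl; ring.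
rewrite (@cf2_sum R r _ _ g (fun i : 'I_l.+1 => mon l i) (fun i : 'I_l.+1 => 'C(l, i)%:R * N%:R ^+ i)
  M n r0 gA (fun i => monA l i)) mulr_sumr; apply: eq_bigr => i _.
by rewrite /coefE; ring.
Qed.

(* [exp_lead] and [exp_next] are the coefficients of [N^M] and [N^(M-1)] in the M-th s-coefficient of
   [Cexp (N incr psi + incr phi)]. *)
Definition exp_lead (M n : nat) : C := M`!%:R^-1 * cf (fun t => g t * dern 1 psi t ^+ M) n.

Definition exp_next (M n : nat) : C :=
  if M is M'.+1 then M'`!%:R^-1 * (cf (fun t => g t * (dern 1 phi t * dern 1 psi t ^+ M')) n +
    cf (fun t => g t * (M'%:R * dern 1 psi t ^+ M'.-1 * dern 2 psi t)) n)
  else 0.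

Let coef_top M n : coefE M n M M = exp_lead M n.
Proof.
rewrite /coefE /exp_lead binn mul1r; congr (_ * _); apply: (cf_ext n r0) => t tr; congr (_ * _).
rewrite -(cf_incr 0 r0 psiA tr) -(cf_expn_low M r0 (hol2_row PA tr) (P0 t)).2.
by apply: (cf_ext _ r0) => s _; rewrite /mon subnn expr0 mul1r.
Qed.

(** Two terms carry [N^M] in degree [M + 1]: one factor [Q] among lowest terms of [P], and the
    second lowest coefficient of [P^M]. *)
Let coef_next M n : coefE M.+1 n M.+1 M + coefE M.+1 n M M = exp_next M.+1 n.
Proof.
rewrite /coefE /exp_next binn mul1r mulrDr; congr (_ + _ * _).
  have f0 : (M`!%:R : C) != 0 by rewrite pnatr_eq0 -lt0n fact_gt0.
  rewrite binSn factS natrM invfM mulrA divff ?pnatr_eq0// mul1r; congr (_ * _).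
  apply: (cf_ext n r0) => t tr; congr (_ * _).
  have [lo top] := cf_expn_low M r0 (hol2_row PA tr) (P0 t).
  rewrite -(cf_incr 0 r0 psiA tr) -top -(cf_incr 0 r0 phiA tr).
  have lq i : (i < 1)%N -> cf (Q t) i = 0.
    by case: i => // _; rewrite (cf0 r0 (hol2_row QA tr)) Q0.
  rewrite -(cf_mul_low r0 (hol2_row QA tr) (holX M r0 (hol2_row PA tr)) lq lo).2.
  by apply: (cf_ext _ r0) => s _; rewrite /mon subSn// subnn expr1.
apply: (cf_ext n r0) => t tr; congr (_ * _).
rewrite -!(cf_incr _ r0 psiA tr) -(cf_expn_next M r0 (hol2_row PA tr) (P0 t)).
by apply: (cf_ext _ r0) => s _; rewrite /mon subnn expr0 mul1r.
Qed.

Lemma o1_cf2_exp (M n : nat) :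
  o1 (fun N => cf2 g (fun t s => Cexp (incr (fun z => N%:R * psi z + phi z) t s)) M n / N%:R ^+ M)
    (exp_lead M n) (exp_next M n).
Proof.
pose c l i := coefE M n l i.
have h : o1 (fun N => \sum_(l < M.+1) \sum_(i < l.+1) c l i * N%:R ^- (M - i))
   (\sum_(l < M.+1) \sum_(i < l.+1) c l i * ((M - i)%N == 0%N)%:R)
   (\sum_(l < M.+1) \sum_(i < l.+1) c l i * ((M - i)%N == 1%N)%:R).
  by apply: o1_sum => l; apply: o1_sum => i; apply: o1Z; exact: o1_natVX.
have eA : \sum_(l < M.+1) \sum_(i < l.+1) c l i * ((M - i)%N == 0%N)%:R = exp_lead M n.
  rewrite big_ord_recr big1 => [|l _]; last first.
    apply: big1 => i _; have -> : ((M - i)%N == 0%N) = false; last by rewrite mulr0.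
    by have /= := ltn_ord i; have /= := ltn_ord l; lia.
  rewrite /= add0r big_ord_recr big1 => [|i _]; last first.
    have -> : ((M - i)%N == 0%N) = false; last by rewrite mulr0.
    by have /= := ltn_ord i; lia.
  by rewrite /= add0r subnn mulr1; exact: coef_top.
have eB : \sum_(l < M.+1) \sum_(i < l.+1) c l i * ((M - i)%N == 1%N)%:R = exp_next M n.
  rewrite /c; case: M {h eA c} => [|M].
    by rewrite big_ord1 big_ord1 mulr0.
  rewrite big_ord_recr big_ord_recr big1 => [|l _]; last first.
    apply: big1 => i _; have -> : ((M.+1 - i)%N == 1%N) = false; last by rewrite mulr0.
    by have /= := ltn_ord i; have /= := ltn_ord l; lia.
  rewrite -coef_next /= add0r addrC; congr (_ + _).
    rewrite big_ord_recr big_ord_recr big1 => [|i _]; last first.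
      have -> : ((M.+1 - i)%N == 1%N) = false; last by rewrite mulr0.
      by have /= := ltn_ord i; lia.
    by rewrite /= subnn subSn// subnn mulr1 mulr0 addr0 add0r.
  rewrite big_ord_recr big1 => [|i _]; last first.
    have -> : ((M.+1 - i)%N == 1%N) = false; last by rewrite mulr0.
    by have /= := ltn_ord i; lia.
  by rewrite /= subSn// subnn eqxx mulr1 add0r.
rewrite -eA -eB; apply: (@o1_ext _ _ _ _ _ 1) h => N N0.
have n1 : (N%:R : C) != 0 by rewrite pnatr_eq0 -lt0n.
rewrite cf2_E mulr_suml; apply: eq_bigr => l _; rewrite mulr_suml; apply: eq_bigr => i _.
rewrite -mulrA; congr (_ * _).
have iM : (i <= M)%N by have /= := ltn_ord i; have /= := ltn_ord l; lia.
have -> : N%:R ^+ M = N%:R ^+ (M - i) * N%:R ^+ i :> C by rewrite -exprD subnK.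
by rewrite invfM mulrCA divff ?mulr1// expf_neq0.
Qed.

End Asymptotics.
End Expansion.

(** * First-order asymptotics of the generating function on the ray *)

Section RayAsymptotics.
Variable R : realType.
Local Notation C := (Cx R).

Lemma sgf_ray_rotate (N K : nat) (rho : signature N -> R) (w t : C) : K.-primitive_root w ->
  (K <= N)%N -> torus (rayv N K w t 0) ->
  sgf rho (rayv N K w (w * t) 0) = sgf rho (rayv N K w t 0).
Proof.
move=> pw KN T; have K0 := prim_order_gt0 pw.
have lt (b : 'I_N) : ((if (b < K)%N then b.+1 %% K else b) < N)%N.
  by case: ifP => // _; rewrite (leq_trans (ltn_pmod _ K0)).
pose f (b : 'I_N) := Ordinal (lt b).
have fI : injective f.
  move=> b c /(congr1 val) /=; case: ifP => bK; case: ifP => cK.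
  - move/eqP; rewrite -(addn1 b) -(addn1 c) eqn_modDr !modn_small// => /eqP bc.
    exact: val_inj.
  - by move=> e; move: cK; rewrite -e ltn_pmod.
  - by move=> e; move: bK; rewrite e ltn_pmod.
  exact: val_inj.
have -> : rayv N K w (w * t) 0 = \row_b (rayv N K w t 0) 0 (perm fI b).
  apply/rowP => b; rewrite !mxE permE /ry /= !addr0; congr (1 + _).
  case: ifP => bK; last by rewrite bK.
  rewrite ltn_pmod//; case: eqP => [->|_].
    (* For [K = 1] the successor of index 0 is 0 itself, and [w = 1]. *)
    case: (K =P 1%N) => [K1|/eqP K1].
      by have := prim_expr_order pw; rewrite K1 expr1 modn1 /= => ->; rewrite mul1r.
    rewrite modn_small /= ?expr1// ; lia.
  case: eqP => [bK0|_]; last by rewrite (prim_expr_mod pw) exprSr mulrA.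
  by rewrite mulrA -exprSr -(prim_expr_mod pw) bK0 expr0 mul1r.
by congr usum; apply/funext => l; rewrite /sgf_term schur_sym.
Qed.

Section Family.
Variables (r w : C) (K : nat) (g psi phi : C -> C) (S : nat -> C -> C -> C) (n0 : nat).
Hypotheses (r0 : 0 < r) (pw : K.-primitive_root w) (gA : hol r g).
Hypotheses (psiA : hol (r + r) psi) (phiA : hol (r + r) phi).

Let Hn (N : nat) (z : C) : C := N%:R * psi z + phi z.

Hypothesis SA : forall N, (n0 <= N)%N -> hol2 r (S N).
Hypothesis S1 : forall N, (n0 <= N)%N -> S N 0 0 = 1.
Hypothesis Sw : forall N, (n0 <= N)%N -> forall t, `|t| < r -> S N (w * t) 0 = S N t 0.
Hypothesis Srest : forall e : C, 0 < e -> exists n1, forall N, (n1 <= N)%N ->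
  forall t s, `|t| < r -> `|s| < r -> `|ray_rest K w (Hn N) (S N) t s| <= e.

Let G (N : nat) : C := Cexp (K%:R * Hn N 0).

(** At [t = s = 0] the error is [1 / G N - 1], as [S N 0 0 = 1]; hence its smallness forces the
    limit. *)
Let G_cvg : G @ \oo --> (1 : C).
Proof.
have V : (fun N => (G N)^-1) @ \oo --> (1 : C).
  apply/cvgrPdist_le => e e0; have [n1 h] := Srest e0.
  exists (maxn n0 n1) => // N /=; rewrite geq_max => /andP[n0N n1N].
  have := h N n1N 0 0; rewrite normr0 => /(_ r0 r0); rewrite /ray_rest S1// mul1r.
  rewrite CexpN distrC (_ : \sum_(b < K) Hn N (ry K w 0 0 b) = K%:R * Hn N 0)//.
  rewrite (eq_bigr (fun=> Hn N 0)) ?sumr_const ?card_ord ?mulr_natl// => b _.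
  by rewrite /ry addr0 mulr0 !if_same.
have V1 : (fun N => ((G N)^-1)^-1) @ \oo --> (1^-1 : C) by exact: cvgV (oner_neq0 C) V.
move: V1; rewrite invr1.
by apply: (@cvg_ext_ge R _ _ _ 0) => N _; rewrite invrK.
Qed.

Let rest_cvg (p i : nat) :
  (fun N => cf (fun t => cf (ray_rest K w (Hn N) (S N) t) p) i) @ \oo --> (0 : C).
Proof.
apply/cvgrPdist_le => e e0; pose B := (2 / r) ^+ p * (2 / r) ^+ i.
have B0 : 0 < B by rewrite mulr_gt0 ?exprn_gt0 ?divr_gt0.
have [n1 h] := Srest (divr_gt0 e0 B0).
exists (maxn n0 n1) => // N /=; rewrite geq_max => /andP[n0N n1N].
rewrite sub0r normrN -[leRHS](divfK (lt0r_neq0 B0)) /B mulrA.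
apply: cf2_le => //; last exact: h.
apply: hol2_ray_rest => //; first exact: norm_primitive_root pw; last exact: SA.
exact: hol_Hn.
Qed.

(** An error coefficient of degree [p + 1] meets a coefficient of the main part of size
    [N^(M - p - 1)]; after division by [N^M] and multiplication by [N] there remains [N^-p] times a
    null sequence. *)
Lemma o1_cf2_family (M n : nat) : (n < K)%N ->
  o1 (fun N => cf2 g (S N) M n / N%:R ^+ M) (exp_lead g psi M n) (exp_next g psi phi M n).
Proof.
move=> nK; pose E (N m i : nat) : C := cf2 g (fun t s => Cexp (incr (Hn N) t s)) m i.
pose D (N p i : nat) : C := cf (fun t => cf (ray_rest K w (Hn N) (S N) t) p) i.
have EL m i : (fun N => E N m i / N%:R ^+ m) @ \oo --> exp_lead g psi m i.
  exact: (@o1_cvg R _ _ _ (@o1_cf2_exp R r g psi phi r0 gA psiA phiA m i)).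
have L1 : (fun N => \sum_(p < M) G N * \sum_(i < n.+1)
    (E N (M - p.+1)%N i / N%:R ^+ (M - p.+1)) * N%:R ^- p * D N p.+1 (n - i)%N) @ \oo -->
   \sum_(p < M) 1 * \sum_(i < n.+1) exp_lead g psi (M - p.+1) i * (p == 0 :> nat)%:R * 0.
  apply: complex_cvg_sum => p _; apply: cvgM; first exact: G_cvg.
  apply: complex_cvg_sum => i _; apply: cvgM; last exact: rest_cvg.
  by apply: cvgM; [exact: EL|exact: (@o1_cvg R _ _ _ (@o1_natVX R p))].
have L2 : (fun N => N%:R * (E N M n / N%:R ^+ M - exp_lead g psi M n) + \sum_(p < M) G N * \sum_(i < n.+1)
    (E N (M - p.+1)%N i / N%:R ^+ (M - p.+1)) * N%:R ^- p * D N p.+1 (n - i)%N) @ \oo -->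
    exp_next g psi phi M n + \sum_(p < M) 1 * \sum_(i < n.+1) exp_lead g psi (M - p.+1) i * (p == 0 :> nat)%:R * 0.
  by apply: cvgD; [exact: (@o1_cf2_exp R r g psi phi r0 gA psiA phiA M n)|exact: L1].
move: L2; rewrite [X in _ + X]big1 ?addr0; last first.
  by move=> p _; rewrite mul1r big1// => i _; rewrite mulr0.
apply: (@cvg_ext_ge R _ _ _ (maxn n0 1)) => N; rewrite geq_max => /andP[n0N N0].
have n1 : (N%:R : C) != 0 by rewrite pnatr_eq0 -lt0n.
rewrite (cf2_factor M r0 pw (hol_Hn r0 psiA phiA N) gA (SA n0N) (Sw n0N) (S1 n0N) nK).
rewrite -/(E N M n) [X in _ = _ * (X - _)]mulrDl [X in _ = _ * X]addrAC [RHS]mulrDr; congr (_ + _); rewrite mulr_suml mulr_sumr.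
apply: eq_bigr => p _; rewrite -/(G N) -!mulrA mulrCA; congr (_ * _).
rewrite mulr_suml mulr_sumr; apply: eq_bigr => i _; rewrite -/(E N (M - p.+1)%N i) -/(D N p.+1 (n - i)%N).
have -> : N%:R ^+ M = N%:R * (N%:R ^+ (M - p.+1) * N%:R ^+ p) :> C.
  by rewrite -exprD -exprS; congr (_ ^+ _); have := ltn_ord p; lia.
by field; rewrite !expf_neq0// n1.
Qed.

End Family.
End RayAsymptotics.

(** * Algebra identifying the limits with the stated sums *)

Section LimitValues.
Variable R : realType.
Local Notation C := (Cx R).

Lemma pick_last (k : nat) (f : nat -> C) : \sum_(j < k.+1) f j * ((k - j)%N == 0%N)%:R = f k.
Proof.
rewrite big_ord_recr big1 => [|i _]; last first.
  have -> : ((k - i)%N == 0%N) = false; last by rewrite mulr0.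
  by have /= := ltn_ord i; lia.
by rewrite /= subnn mulr1 add0r.
Qed.

Lemma pick_prev (k : nat) (f : nat -> C) :
  \sum_(j < k.+1) f j * ((k - j)%N == 1%N)%:R = if k is k'.+1 then f k' else 0.
Proof.
rewrite big_ord_recr /= subnn mulr0 addr0; case: k => [|k]; first by rewrite big_ord0.
rewrite big_ord_recr big1 => [|i _]; last first.
  have -> : ((k.+1 - i)%N == 1%N) = false; last by rewrite mulr0.
  by have /= := ltn_ord i; lia.
by rewrite /= subSn// subnn mulr1 add0r.
Qed.

(** [T] and [Z] are leading coefficients for the moments [k + 1] and [k], while [B] is the
    next-order one. Eliminating [T] by the first relation cancels all [Y]; the coefficient of [Z]
    becomes [- (k + 1 - q) / 2] from the expansion of the binomial coefficient plus [k / 2] from the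
    Stirling number, that is [- (1 - q) / 2]. *)
Lemma limit_identity (k : nat) (q : C) (X Y Z T B : nat -> C) :
  (forall m, (m < k.+1)%N ->
     m.+1%:R * T m.+1 = (k.+1%:R - q) * Z m + 2 * (k - m)%:R * Y m) ->
  (forall m, (m < k.+1)%N -> B m = (k - m)`!%:R^-1 * (X m + (k - m)%:R * Y m)) -> B k.+1 = 0 ->
  k.+1`!%:R * \sum_(m < k.+2) (- ((m.+1 * m)%:R / 2 / m.+1`!%:R) * ((k.+1 - m)`!%:R^-1 * T m) +
     m.+1`!%:R^-1 * B m) +
  ('C(k.+1, 2) * k`!)%:R * \sum_(m < k.+1) m.+1`!%:R^-1 * ((k - m)`!%:R^-1 * Z m) =
  \sum_(m < k.+1) 'C(k.+1, m.+1)%:R * (X m - (1 - q) / 2 * Z m).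
Proof.
move=> hT hB B0; have f0 m : (m`!%:R : C) != 0 by rewrite pnatr_eq0 -lt0n fact_gt0.
rewrite big_split /= big_ord_recl muln0 !mul0r oppr0 mul0r add0r.
rewrite [X in _ * (_ + X)]big_ord_recr /= B0 mulr0 addr0 -big_split /= !mulr_sumr -big_split.
apply: eq_bigr => m _ /=; have mk := ltn_ord m.
have bm : 'C(k.+1, m.+1)%:R = k.+1`!%:R / (m.+1`!%:R * (k - m)`!%:R) :> C.
  have := bin_fact (ltn_ord m); rewrite subSS => <-.
  by rewrite natrM [X in _ * X / _](natrM C m.+1`!) mulfK// mulf_neq0.
have bk : 2 * 'C(k.+1, 2)%:R = k.+1%:R * k%:R :> C.
  by rewrite -!natrM -(mul_bin_diag k.+1 1) bin1.
have c2 : 'C(k.+1, 2)%:R = k.+1%:R * k%:R / 2 :> C.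
  by rewrite -bk; field.
rewrite /bump /= add1n subSS bm (hB m mk) (natrM C 'C(k.+1, 2)) c2 (factS k) (natrM C k.+1 k`!).
have -> : - ((m.+2 * m.+1)%:R / 2 / (m.+2)`!%:R) * ((k - m)`!%:R^-1 * T m.+1) =
   - (2^-1 / m.+1`!%:R / (k - m)`!%:R * (m.+1%:R * T m.+1)) :> C.
  rewrite (factS m.+1) (natrM C m.+2 m.+1) (natrM C m.+2 m.+1`!); field.
  by rewrite !f0 /= -natrD pnatr_eq0.
rewrite (hT m mk); have -> : k.+1%:R = k%:R + 1 :> C by rewrite -natr1.
by field; rewrite !f0.
Qed.

Lemma cfM_congr (r : C) (f h h' : C -> C) (n : nat) : 0 < r -> hol r f -> hol r h -> hol r h' ->
  (forall i, cf h i = cf h' i) -> cf (fun t => f t * h t) n = cf (fun t => f t * h' t) n.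
Proof.
move=> r0 fA hA hA' hh; rewrite (cfM n r0 fA hA) (cfM n r0 fA hA').
by apply: eq_bigr => i _; rewrite hh.
Qed.

Lemma cf_dern1 (r : C) (f : C -> C) (m : nat) : 0 < r -> hol r f ->
  cf (dern 1 f) m = m.+1%:R * cf f m.+1.
Proof. by move=> r0 fA; rewrite (cf_dern 1 m r0 fA) add1n bin1. Qed.

(** The product rule for [u^c psi'^M] read off in degree [m]. It supplies the relation that
    eliminates the second derivative of [psi] in [limit_identity]. *)
Lemma cf_pow_dern (rp r : C) (psi : C -> C) (c : C) (M m : nat) : 0 < rp -> pow_disc rp ->
  0 < r -> r + r <= rp -> hol (r + r) psi ->
  m.+1%:R * cf (fun t => Cpow (1 + t) c * dern 1 psi t ^+ M) m.+1 =
  c * cf (fun t => Cpow (1 + t) (c - 1) * dern 1 psi t ^+ M) m +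
  2 * M%:R * cf (fun t => Cpow (1 + t) c * (dern 1 psi t ^+ M.-1 * dern 2 psi t)) m.
Proof.
move=> rp0 rpP r0 rrp psiA; have rr0 : 0 < r + r by rewrite addr_gt0.
have r_rp : r <= rp by apply: le_trans rrp; rewrite lerDl ltW.
have dA j : hol r (dern j psi) by exact: hol_dern_double.
have [gA _ _ _ gd] := rpP c; have [hA _ _ _ _] := rpP (c - 1).
have gA' := hol_sub r_rp gA; have hA' := hol_sub r_rp hA.
have h0 := halfC_gt0 r0; have hr := ltW (halfC_lt r0).
have XA n : hol r (fun t => dern 1 psi t ^+ n) by exact: holX.
have fA := holM r0 gA' (XA M).
rewrite -(cf_dern1 m r0 fA).
have ddA : hol (r / 2) (dern 1 (dern 1 psi)) by exact: hol_dern.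
pose P t := M%:R * (Cpow (1 + t) c * dern 1 psi t ^+ M.-1).
have PA : hol r P by apply: holZ => //; exact: holM.
have -> : cf (dern 1 (fun t => Cpow (1 + t) c * dern 1 psi t ^+ M)) m =
    cf (fun t => c * (Cpow (1 + t) (c - 1) * dern 1 psi t ^+ M) + P t * dern 1 (dern 1 psi) t) m.
  apply: (cf_ext m h0) => t tr; rewrite (dern1M r0 gA' (XA M) tr) (dern1X M r0 (dA 1%N) tr) gd.
    by rewrite /P; ring.
  by apply: lt_le_trans tr _; rewrite ler_pM2r ?invr_gt0.
have hol' : hol (r / 2) (fun t => c * (Cpow (1 + t) (c - 1) * dern 1 psi t ^+ M)).
  by apply: holZ => //; apply: hol_sub hr _; exact: holM.
rewrite (cfD m h0 hol' (holM h0 (hol_sub hr PA) ddA)).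
rewrite (cfZ _ _ h0); last by apply: hol_sub hr _; exact: holM.
congr (_ + _).
(* Divided derivatives compose with a binomial factor, so [dern 1 (dern 1 psi)] and [2 * dern 2 psi]
   have the same coefficients; under [cf] of a product this suffices. *)
have d2A : hol (r / 2) (fun t => 2 * dern 2 psi t) by apply: holZ => //; apply: hol_sub hr _.
rewrite (cfM_congr m h0 (hol_sub hr PA) ddA d2A) => [|i].
  rewrite -(cfZ _ _ r0); last by apply: holM => //; exact: holM.
  by apply: (cf_ext m r0) => t _; rewrite /P; ring.
rewrite (cf_dern1 i r0 (dA 1%N)) (cf_dern1 i.+1 rr0 psiA) (cfZ _ _ r0 (dA 2)) (cf_dern 2 i rr0 psiA).
rewrite add2n !mulrA; congr (_ * _); rewrite -!natrM; congr (_%:R).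
by rewrite -(mul_bin_diag i.+2 1) bin1 mulnC.
Qed.

End LimitValues.

(** * Assembling the limit of the moments *)

Section Main.
Variable R : realType.
Local Notation C := (Cx R).
Variables (q : R) (rho : forall N : nat, signature N -> R) (Psi Phi : C -> C) (k : nat).
Variables (rp r : C) (r' : R) (w : C).

Let K := k.+1.
Let psi (z : C) : C := Psi (1 + z).
Let phi (z : C) : C := Phi (1 + z).

Hypotheses (rho_prob : forall N, is_prob (@rho N)).
Hypotheses (rp0 : 0 < rp) (rp2 : rp <= 1 / 2) (rpP : pow_disc rp).
Hypotheses (r0 : 0 < r) (rrp : r + r <= rp) (rr' : r + r < r'%:C%C).
Hypotheses (psiA : hol (r + r) psi) (phiA : hol (r + r) phi).
Hypothesis pw : K.-primitive_root w.
Hypothesis logS : forall e : R, 0 < e -> \forall N \near \oo,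
  exists L : 'rV[C]_K -> C,
    [/\ forall v, polydisc r' v -> {for v, continuous L},
        L (ones R K) = 0,
        forall v, polydisc r' v -> Cexp (L v) = sgf (@rho N) (ext_ones N v) &
        forall v, polydisc r' v ->
          `|L v - N%:R * (\sum_(i < K) Psi (v 0 i)) - \sum_(i < K) Phi (v 0 i)| < e%:C%C].

Let w1 : `|w| = 1. Proof. exact: norm_primitive_root pw. Qed.
Let S (N : nat) (t s : C) : C := sgf (@rho N) (rayv N K w t s).
Let g (j : nat) (t : C) : C := Cpow (1 + t) (j%:R - q%:C%C).

Let r_rp : r <= rp. Proof. by apply: le_trans rrp; rewrite lerDl ltW. Qed.
Let gA j : hol r (g j).
Proof. by have [h _ _ _ _] := rpP (j%:R - q%:C%C); apply: hol_sub h. Qed.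

Let ray_polydisc (t s : C) : `|t| < r -> `|s| < r -> polydisc r' (rayv K K w t s).
Proof.
move=> tr sr b; rewrite mxE addrAC subrr add0r; apply: lt_trans rr'.
exact: (norm_ry r0 (lexx (r + r))).
Qed.

(** A single logarithm [L] suffices: [Cexp] never vanishes, and [L = 0] at the ones vector gives the
    value 1. *)
Let family : exists n0 : nat, [/\ (K <= n0)%N,
  forall N, (n0 <= N)%N -> forall v : 'rV[C]_K, polydisc r' v -> sgf (@rho N) (ext_ones N v) != 0 &
  forall N, (n0 <= N)%N -> S N 0 0 = 1].
Proof.
have [n1 _ h1] := logS ltr01; exists (maxn K n1); split.
- exact: leq_maxl.
- move=> N; rewrite geq_max => /andP[_ /h1 [L [_ _ LS _]]] v vr.
  by rewrite -LS// Cexp_neq0.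
move=> N; rewrite geq_max => /andP[_ /h1 [L [_ L1 LS _]]].
have rE : rayv K K w 0 0 = ones R K.
  by apply/rowP => b; rewrite !mxE /ry addr0 mulr0 !if_same addr0.
rewrite /S -ext_ones_ray -LS; last by apply: ray_polydisc; rewrite normr0.
by rewrite rE L1 Cexp0.
Qed.

Let S_rest (e : C) : 0 < e -> exists n1, forall N, (n1 <= N)%N ->
  forall t s, `|t| < r -> `|s| < r ->
    `|ray_rest K w (fun z => N%:R * psi z + phi z) (S N) t s| <= e.
Proof.
(* [y <= 1] makes [Cexp_sub1_le] applicable, and [y <= x / 2] absorbs its factor 2. *)
move=> /complex_gt0P[x x0 ->]; pose y := Num.min (x / 2) 1.
have y0 : 0 < y by rewrite lt_min divr_gt0//= ltr01.
have [n1 _ h1] := logS y0; exists n1 => N /h1 [L [_ _ LS Le]] t s tr sr.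
have P := ray_polydisc tr sr.
set d := L (rayv K K w t s) - \sum_(b < K) (N%:R * psi (ry K w t s b) + phi (ry K w t s b)).
have dy : `|d| < y%:C%C.
  rewrite (_ : d = L (rayv K K w t s) - N%:R * (\sum_(i < K) Psi ((rayv K K w t s) 0 i)) -
     \sum_(i < K) Phi ((rayv K K w t s) 0 i)); first exact: Le.
  rewrite /d big_split mulr_sumr opprD addrA; congr (_ - _ - _).
    by apply: eq_bigr => b _; rewrite mxE.
  by apply: eq_bigr => b _; rewrite mxE.
have -> : ray_rest K w (fun z => N%:R * psi z + phi z) (S N) t s = Cexp d - 1.
  by rewrite /ray_rest /S -ext_ones_ray -LS// -CexpD.
apply: le_trans (Cexp_sub1_le _) _.
  by apply: le_trans (ltW dy) _; rewrite (_ : 1 = 1%:C%C)// lecR ge_min lexx orbT.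
apply: (@le_trans _ _ (2 * y%:C%C)); first by rewrite ler_pM2l// ltW.
rewrite (_ : 2 * y%:C%C = (2 * y)%:C%C); last by rewrite rmorphM rmorph_nat.
rewrite lecR -[leRHS](divfK (_ : 2 != 0))// mulrC ler_pM2r// ge_min lexx//.
Qed.

(** [a0] and [a1] are the two orders of ['C(N, m + 1) / N^(m + 1)] times the normalised coefficient.
    The remaining [N^-(k - j)] appears in [lim0] and [lim1] as the tests [k - j = 0] and
    [k - j = 1]. *)
Let a0 (j m : nat) : C := m.+1`!%:R^-1 * exp_lead (g j) psi (j - m) m.
Let a1 (j m : nat) : C := - ((m.+1 * m)%:R / 2 / m.+1`!%:R) * exp_lead (g j) psi (j - m) m +
  m.+1`!%:R^-1 * exp_next (g j) psi phi (j - m) m.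
Let lim0 : C := \sum_(j < k.+1) (stirling2 k j * j`!)%:R * \sum_(m < j.+1) a0 j m * ((k - j)%N == 0%N)%:R.
Let lim1 : C := \sum_(j < k.+1) (stirling2 k j * j`!)%:R * \sum_(m < j.+1)
  (a1 j m * ((k - j)%N == 0%N)%:R + a0 j m * ((k - j)%N == 1%N)%:R).

Let o1_expect : o1 (fun N => (expect (@rho N)
    (fun l => atomic_integral (mPP q l) (fun t => t ^+ k)))%:C%C) lim0 lim1.
Proof.
have [n0 [Kn0 sgf0 S1]] := family.
have SA N : (n0 <= N)%N -> hol2 r (S N).
  move=> n0N; apply: (hol2_sgf_ray rp2 rpP r0 rrp rr' (rho_prob N).1 (sgf0 N n0N) pw).
  exact: leq_trans n0N.
have Sw N : (n0 <= N)%N -> forall t, `|t| < r -> S N (w * t) 0 = S N t 0.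
  move=> n0N t tr; apply: sgf_ray_rotate => //; first exact: leq_trans n0N.
  by apply: (torus_ray rp2 r0 rrp) => //; rewrite normr0.
have O (j : 'I_k.+1) (m : 'I_j.+1) : o1 (fun N => cf2 (g j) (S N) (j - m) m / N%:R ^+ (j - m))
    (exp_lead (g j) psi (j - m) m) (exp_next (g j) psi phi (j - m) m).
  apply: (@o1_cf2_family R r w K (g j) psi phi S n0) => //.
  by have := ltn_ord j; have := ltn_ord m; rewrite /K; lia.
have T : o1 (fun N => \sum_(j < k.+1) (stirling2 k j * j`!)%:R * \sum_(m < j.+1)
    ('C(N, m.+1)%:R / N%:R ^+ m.+1) * (cf2 (g j) (S N) (j - m) m / N%:R ^+ (j - m)) * N%:R ^- (k - j))
    lim0 lim1.
  apply: o1_sum => j; apply: o1Z; apply: o1_sum => m; apply: o1M; last exact: o1_natVX.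
  by apply: o1M; [exact: (@o1_bin R m.+1)|exact: O].
apply: (@o1_ext _ _ _ _ _ n0) T => N n0N.
have KN : (K <= N)%N by exact: leq_trans n0N.
have n1 : (N%:R : C) != 0 by rewrite pnatr_eq0 -lt0n (leq_trans _ KN).
rewrite (expect_ray q rp0 rp2 rpP r0 rrp rr' (rho_prob N).1 (sgf0 N n0N) pw KN (ltnSn k)).
rewrite mulr_sumr; apply: eq_bigr => j _; rewrite mulrCA; congr (_ * _).
rewrite mulr_sumr; apply: eq_bigr => m _; rewrite -/(g j) -/(S N).
have -> : N%:R ^+ k.+1 = N%:R ^+ m.+1 * N%:R ^+ (j - m) * N%:R ^+ (k - j) :> C.
  by rewrite -!exprD; congr (_ ^+ _); have := ltn_ord j; have := ltn_ord m; lia.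
by rewrite !invfM; ring.
Qed.

Let dA j : hol r (dern j psi). Proof. exact: hol_dern_double. Qed.
Let dA' j : hol r (dern j phi). Proof. exact: hol_dern_double. Qed.

Let der1 (F : C -> C) (z : C) : hol (r + r) (fun z => F (1 + z)) -> `|z| < r ->
  derive1 F (1 + z) = dern 1 (fun z => F (1 + z)) z.
Proof.
move=> FA zr; apply: (@derive1_dern R (r + r)) => //; first by rewrite addr_gt0.
by rewrite (_ : (r + r) / 2 = r)//; field.
Qed.

Let f0 m : (m`!%:R : C) != 0.
Proof. by rewrite pnatr_eq0 -lt0n fact_gt0. Qed.

Let limit_a : \sum_(m < k.+1) ('C(k, m)%:R / (m.+1)`!%:R) *
    derive1n m (fun u : C => Cpow u (k%:R - q%:C%C) * (derive1 Psi u) ^+ (k - m)) 1 = lim0.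
Proof.
rewrite /lim0 [RHS](eq_bigr (fun j : 'I_k.+1 =>
  ((stirling2 k j * j`!)%:R * \sum_(m < j.+1) a0 j m) * ((k - j)%N == 0%N)%:R)); last first.
  by move=> j _; rewrite -mulr_suml mulrA.
rewrite (pick_last k (fun j => (stirling2 k j * j`!)%:R * \sum_(m < j.+1) a0 j m)) stirling2_diag mul1n mulr_sumr.
apply: eq_bigr => m _.
have FA : hol r (fun t => g k t * dern 1 psi t ^+ (k - m)) by apply: holM => //; exact: holX.
have FE z : `|z| < r -> g k z * dern 1 psi z ^+ (k - m) =
    Cpow (1 + z) (k%:R - q%:C%C) * derive1 Psi (1 + z) ^+ (k - m).
  by move=> zr; rewrite der1.
rewrite (@derive1n_cf R m r (fun u => Cpow u (k%:R - q%:C%C) * (derive1 Psi u) ^+ (k - m)) 1 r0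
  (hol_ext FE FA)) -(cf_ext m r0 FE) /a0 /exp_lead.
have mk : (m <= k)%N by rewrite -ltnS.
have bk : k`!%:R = 'C(k, m)%:R * (m`!%:R * (k - m)`!%:R) :> C by rewrite -!natrM bin_fact.
rewrite bk; move: (cf _ _) => X; field.
by rewrite !f0.
Qed.

(** Two contributions of order [1 / N]: the corrections [a1] at [j = k], and the leading terms [a0]
    at [j = k - 1] weighted by a subdiagonal Stirling number. *)
Let limit_b : \sum_(m < k) ('C(k, m.+1)%:R / m`!%:R) *
    derive1n m (fun u : C => Cpow u (k%:R - q%:C%C) * (derive1 Phi u - (1 - q%:C%C) / (2 * u))
           * (derive1 Psi u) ^+ (k - m.+1)) 1 = lim1.
Proof.
pose F0 j : C := (stirling2 k j * j`!)%:R * \sum_(m < j.+1) a1 j m.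
pose F1 j : C := (stirling2 k j * j`!)%:R * \sum_(m < j.+1) a0 j m.
rewrite /lim1 [RHS](eq_bigr (fun j : 'I_k.+1 => F0 j * ((k - j)%N == 0%N)%:R + F1 j * ((k - j)%N == 1%N)%:R));
  last by move=> j _; rewrite big_split /= -!mulr_suml mulrDr !mulrA.
rewrite big_split /= pick_last pick_prev /F0 /F1 stirling2_diag mul1n.
case: k => [|k'].
  by rewrite big_ord0 big_ord1 /a1 subnn /exp_next /= !(mul0n, muln0, mul0r, mulr0, oppr0, addr0).
rewrite stirling2_subdiag.
pose a := dern 1 psi.
have XA (M : nat) : hol r (fun t => a t ^+ M) by apply: holX => //; exact: dA.
refine (etrans _ (esym (@limit_identity R k' q%:C%C
  (fun m => cf (fun t => g k'.+1 t * (dern 1 phi t * a t ^+ (k' - m))) m)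
  (fun m => cf (fun t => g k'.+1 t * (a t ^+ (k' - m).-1 * dern 2 psi t)) m)
  (fun m => cf (fun t => g k' t * a t ^+ (k' - m)) m)
  (fun m => cf (fun t => g k'.+1 t * a t ^+ (k'.+1 - m)) m)
  (fun m => exp_next (g k'.+1) psi phi (k'.+1 - m) m) _ _ _))).
- apply: eq_bigr => m _; rewrite -mulrA; congr (_ * _).
  pose f1 t := g k'.+1 t * (dern 1 phi t * a t ^+ (k' - m)).
  pose f2 t := g k' t * a t ^+ (k' - m).
  have f1A : hol r f1 by apply: holM => //; apply: holM.
  have f2A : hol r f2 by apply: holM.
  have FE z : `|z| < r -> f1 z - (1 - q%:C%C) / 2 * f2 z =
      Cpow (1 + z) (k'.+1%:R - q%:C%C) * (derive1 Phi (1 + z) - (1 - q%:C%C) / (2 * (1 + z)))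
           * derive1 Psi (1 + z) ^+ (k'.+1 - m.+1).
    move=> zr; rewrite !der1// subSS -/(a z) /f1 /f2 -/(g k'.+1 z).
    have zrp : `|z| < rp by exact: lt_le_trans r_rp.
    (* The denominator [2 u] of the theorem: the terms from the lower moment carry [u^(k - 1 - q)],
       which is [u^(k - q) / u]. *)
    have gE : g k'.+1 z = (1 + z) * g k' z.
      have [_ _ gD gi _] := rpP 1; rewrite /g -natr1 addrAC [_ + 1]addrC gD//.
      by rewrite -[X in Cpow _ X * _]/(1%:~R) gi// expr1z.
    have z0 := one_plus_neq0 rp2 zrp.
    by rewrite gE; field.
  have FA := holB r0 f1A (holZ ((1 - q%:C%C) / 2) r0 f2A).
  rewrite (@derive1n_cf R m r (fun u => Cpow u (k'.+1%:R - q%:C%C) *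
     (derive1 Phi u - (1 - q%:C%C) / (2 * u)) * derive1 Psi u ^+ (k'.+1 - m.+1)) 1 r0
     (hol_ext FE FA)) -(cf_ext m r0 FE) mulKf//.
  by rewrite (cfB m r0 f1A (holZ _ r0 f2A)) (cfZ _ _ r0 f2A).
- move=> m mk; rewrite subSS.
  have := @cf_pow_dern R rp r psi (k'.+1%:R - q%:C%C) (k' - m) m rp0 rpP r0 rrp psiA.
  by rewrite (_ : k'.+1%:R - q%:C%C - 1 = k'%:R - q%:C%C)// -natr1; ring.
- move=> m mk; rewrite subSn// /exp_next; congr (_ * (_ + _)).
  rewrite -(cfZ _ _ r0); last by apply: holM => //; apply: holM.
  by apply: (cf_ext m r0) => t _; ring.
by rewrite subnn.
Qed.

Lemma pp_moment_limit : o1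
  (fun N => (expect (@rho N) (fun l => atomic_integral (mPP q l) (fun t => t ^+ k)))%:C%C)
  (\sum_(m < k.+1) ('C(k, m)%:R / (m.+1)`!%:R) *
     derive1n m (fun u : C => Cpow u (k%:R - q%:C%C) * (derive1 Psi u) ^+ (k - m)) 1)
  (\sum_(m < k) ('C(k, m.+1)%:R / m`!%:R) *
     derive1n m (fun u : C => Cpow u (k%:R - q%:C%C) * (derive1 Phi u - (1 - q%:C%C) / (2 * u))
       * (derive1 Psi u) ^+ (k - m.+1)) 1).
Proof. by rewrite limit_a limit_b; exact: o1_expect. Qed.

End Main.

Theorem theorem19 (R : realType) (q : R)
  (rho : forall N : nat, signature N -> R)
  (Psi Phi : Cx R -> Cx R) :
  -1 <= q <= 1 ->
  (forall N, is_prob (rho N)) ->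
  (forall N, sgf_unif_conv (rho N)) ->
  analytic_near Psi 1 -> analytic_near Phi 1 ->
  (forall k : nat, exists2 r : R, 0 < r &
     forall e : R, 0 < e -> \forall N \near \oo,
       exists L : 'rV[Cx R]_k -> Cx R,
         [/\ forall v, polydisc r v -> {for v, continuous L},
             L (@ones R k) = 0,
             forall v, polydisc r v -> Cexp (L v) = sgf (rho N) (ext_ones N v) &
             forall v, polydisc r v ->
               `|L v - N%:R * (\sum_(i < k) Psi (v 0 i))
                     - \sum_(i < k) Phi (v 0 i)| < e%:C%C]) ->
  forall k : nat,
    (fun N : nat => (
       N%:R * ((expect (rho N)
                  (fun l => atomic_integral (mPP q l) (fun t => t ^+ k)))%:C%C
               - \sum_(m < k.+1)
                   ('C(k, m)%:R / (m.+1)`!%:R) *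
                   derive1n m (fun u : Cx R =>
                      Cpow u (k%:R - q%:C%C) * (derive1 Psi u) ^+ (k - m)) 1) : Cx R))
    @ \oo -->
    (\sum_(m < k)
        ('C(k, m.+1)%:R / m`!%:R) *
        derive1n m (fun u : Cx R =>
           Cpow u (k%:R - q%:C%C)
           * (derive1 Phi u - (1 - q%:C%C) / (2 * u))
           * (derive1 Psi u) ^+ (k - m.+1)) 1 : Cx R).
Proof.
move=> _ rhoP _ /analytic_hol[r1 r10 psiA] /analytic_hol[r2 r20 phiA] logS k.
(* [k + 1] variables: the rays must be faithful up to degree [k] in [t]. *)
have [r' r'0 hr'] := logS k.+1.
have [rp rp0 [rp2 rpP]] := Cpow_hol R.
have [w pw] := @primitive_root_exists R k.+1 isT.
have r'0C : 0 < (r'%:C%C : Cx R) by rewrite ltcR.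
have [c1 [c10 c1a c1b]] := lt_minC r10 r20; have [c2 [c20 c2a c2b]] := lt_minC rp0 r'0C.
have [c [c0 ca cb]] := lt_minC c10 c20.
(* The coordinate [t + s] and the shifts by [t] need twice the radius, so [r + r] has to stay
   strictly below every available radius. *)
pose r := c / 4; have r0 : 0 < r by rewrite divr_gt0.
have rr : r + r < c by rewrite (_ : r + r = c / 2) ?halfC_lt// /r; field.
apply: (@pp_moment_limit R q rho Psi Phi k rp r r' w) => //.
- exact: le_trans (ltW rr) (le_trans cb c2a).
- exact: lt_le_trans rr (le_trans cb c2b).
- by apply: hol_sub psiA; exact: le_trans (ltW rr) (le_trans ca c1a).
by apply: hol_sub phiA; exact: le_trans (ltW rr) (le_trans ca c1b).
Qed.
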